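(* Let $M\ge1$ be an integer and let $\{(N_k,B_k)\}_{k=1}^M$ be finitely many admissible pairs with $0\in B_k\subseteq\{0,1,2,\dots\}$ for all $1\le k\le M$. Then for every sequence $\mathbf{n}=\{n_k\}_{k=1}^\infty$ of positive integers: (i) the mapping $\mu^{\mathbf{n}}:\Omega_M\times\mathcal{B}(\mathbb{R})\to[0,+\infty]$, $(\boldsymbol{\omega},B)\mapsto\mu^{\mathbf{n}}(\boldsymbol{\omega})(B)$, is well defined (i.e. the infinite convolution $\mu^{\mathbf{n}}(\boldsymbol{\omega})$ exists for every $\boldsymbol{\omega}\in\Omega_M$) and is a random measure; (ii) for every Bernoulli measure $\mathbb{P}$ on $\Omega_M$, $\mu^{\mathbf{n}}(\boldsymbol{\omega})$ is a spectral measure for $\mathbb{P}$-a.e. $\boldsymbol{\omega}\in\Omega_M$; (iii) if $\mathbf{n}$ is unbounded, $\mu^{\mathbf{n}}$ is a spectral random measure.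
   Context: $\Omega_M=\{1,2,\dots,M\}^{\mathbb{N}}$ is the set of infinite sequences $\boldsymbol{\omega}=\omega_1\omega_2\cdots$ with entries in $\{1,\dots,M\}$, with the metric $d(\boldsymbol{\alpha},\boldsymbol{\beta})=2^{-|\boldsymbol{\alpha}\wedge\boldsymbol{\beta}|}$, where $|\boldsymbol{\alpha}\wedge\boldsymbol{\beta}|$ is the length of the maximal common initial segment ($d=0$ if the sequences are equal), and with its Borel $\sigma$-algebra. $\mathcal{B}(\mathbb{R})$ is the Borel $\sigma$-algebra of $\mathbb{R}$. Bernoulli measure: given a probability vector $(p_1,\dots,p_M)$ ($p_j\ge0$, $\sum_{j=1}^M p_j=1$), the associated Bernoulli measure $\mathbb{P}$ is the Borel probability measure on $\Omega_M$ with $\mathbb{P}(\{\boldsymbol{\omega}:\omega_1=\alpha_1,\dots,\omega_k=\alpha_k\})=p_{\alpha_1}\cdots p_{\alpha_k}$ for all finite words $\alpha_1\cdots\alpha_k$. Admissible pair: for an integer $N\ge2$ and a finite $B\subset\mathbb{Z}$ with $\#B\ge2$, $(N,B)$ is an admissible pair if there is $L\subset\mathbb{Z}$ such that the matrix $\left[\frac{1}{\sqrt{\#B}}e^{-2\pi i\,bl/N}\right]_{b\in B,\,l\in L}$ is unitary (in particular $\#L=\#B$). For a finite nonempty $A\subset\mathbb{R}$, $\delta_A=\frac{1}{\#A}\sum_{a\in A}\delta_a$ with $\delta_a$ the Dirac measure at $a$; $cA=\{ca:a\in A\}$; $*$ is convolution. For $\boldsymbol{\omega}\in\Omega_M$,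 put $$\mu^{\mathbf{n}}_{k}(\boldsymbol{\omega}) =\delta_{N_{\omega_{1}}^{-n_{1}}B_{\omega_{1}}} * \delta_{N_{\omega_{1}}^{-n_{1}}N_{\omega_{2}}^{-n_{2}}B_{\omega_{2}}} * \cdots * \delta_{N_{\omega_{1}}^{-n_{1}}\cdots N_{\omega_{k}}^{-n_{k}}B_{\omega_{k}}}.$$ The infinite convolution $\mu^{\mathbf{n}}(\boldsymbol{\omega})$ is said to exist if $\mu^{\mathbf{n}}_k(\boldsymbol{\omega})$ converges weakly, as $k\to\infty$, to a Borel probability measure on $\mathbb{R}$, and $\mu^{\mathbf{n}}(\boldsymbol{\omega})$ denotes this limit. A mapping $R:\Omega_M\times\mathcal{B}(\mathbb{R})\to[0,+\infty]$ is a random measure if $\boldsymbol{\omega}\mapsto R(\boldsymbol{\omega},A)$ is Borel measurable for every $A\in\mathcal{B}(\mathbb{R})$ and $R(\boldsymbol{\omega})=R(\boldsymbol{\omega},\cdot)$ is a measure for every $\boldsymbol{\omega}\in\Omega_M$. A Borel probability measure $\nu$ on $\mathbb{R}$ is a spectral measure if there is $\Lambda\subset\mathbb{R}$ such that $\{e^{2\pi i\lambda x}:\lambda\in\Lambda\}$ is an orthonormal basis of $L^2(\nu)$. A random measure $R$ is a spectral random measure if $R(\boldsymbol{\omega})$ is a spectral measure for all $\boldsymbol{\omega}\in\Omega_M$. *)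

(* Defs.v *)
From HB Require Import structures.
From mathcomp Require Import all_boot all_order all_algebra finmap.
From mathcomp Require Import spectral complex.
From mathcomp Require Import all_classical all_reals all_analysis.
From mathcomp Require Import measurable_realfun.

Set Implicit Arguments.
Unset Strict Implicit.
Unset Printing Implicit Defensive.

Import Order.TTheory GRing.Theory Num.Theory.
Import numFieldNormedType.Exports.

Local Open Scope classical_set_scope.
Local Open Scope ring_scope.

(* Sequences over an alphabet of M = m.+1 letters, indexed from 0 (the letter
   written omega_(k+1) is [w k]).  [R] is a phantom parameter that lets the
   metric structure over [R] be inferred from the type. *)
Definition codespace (R : realType) (m : nat) : Type := nat -> 'I_m.+1.

Section codespace_metric.
Context (R : realType) (m : nat).
Local Notation Omega := (codespace R m).

HB.instance Definition _ := gen_eqMixin Omega.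
HB.instance Definition _ := gen_choiceMixin Omega.
HB.instance Definition _ := isPointed.Build Omega (fun=> ord0).

(* The least index at which two sequences differ is the length of their maximal
   common initial segment. *)
Definition code_dist (a b : Omega) : R :=
  match pselect (exists k, a k != b k) with
  | left ab => 2 ^- ex_minn ab
  | right _ => 0
  end.

Lemma code_dist_le (a b : Omega) (e : nat) :
  code_dist a b <= 2 ^- e <-> forall k, (k < e)%N -> a k = b k.
Proof.
rewrite /code_dist; case: pselect => [ab|nab].
  case: ex_minnP => j abj jmin.
  rewrite lef_pV2 ?posrE ?exprn_gt0// ler_eXn2l ?ltr1n//; split.
    move=> ej k ke; apply/eqP; apply: contraTT ke => /jmin jk.
    by rewrite -leqNgt (leq_trans ej).
  move=> H; rewrite leqNgt; apply/negP => /H /eqP; exact/negP.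
split=> [_ k _|_]; last by rewrite invr_ge0 exprn_ge0.
by apply/eqP; apply: contra_notT nab => abk; exists k.
Qed.

Lemma code_dist_eq0 (a b : Omega) : code_dist a b = 0 -> a = b.
Proof.
move=> ab0; apply/funext => k; apply: ((code_dist_le a b k.+1).1 _ k) => //.
by rewrite ab0 invr_ge0 exprn_ge0.
Qed.

Lemma code_distxx (a : Omega) : code_dist a a = 0.
Proof.
by rewrite /code_dist; case: pselect => // ab; case: ex_minnP => k; rewrite eqxx.
Qed.

Lemma code_dist_dich (a b : Omega) :
  code_dist a b = 0 \/ exists e, code_dist a b = 2 ^- e.
Proof.
by rewrite /code_dist; case: pselect => [ab|_]; [right; eexists|left].
Qed.

Lemma code_dist_ge0 (a b : Omega) : 0 <= code_dist a b.
Proof.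
by case: (code_dist_dich a b) => [->//|[e ->]]; rewrite invr_ge0 exprn_ge0.
Qed.

Lemma code_dist_sym (a b : Omega) : code_dist a b = code_dist b a.
Proof.
wlog suff H : a b / code_dist a b <= code_dist b a.
  by apply/eqP; rewrite eq_le !H.
case: (code_dist_dich b a) => [/code_dist_eq0 ->|[e ba]].
  by rewrite !code_distxx.
rewrite ba; apply/code_dist_le => k ke.
by apply/esym; apply: ((code_dist_le b a e).1 _ k) => //; rewrite ba.
Qed.

Lemma code_dist_ultra (b a c : Omega) :
  code_dist a c <= Num.max (code_dist a b) (code_dist b c).
Proof.
set d := Num.max _ _.
have [d0|[e de]] : d = 0 \/ exists e, d = 2 ^- e.
  by rewrite /d /Num.max; case: ifP => _; exact: code_dist_dich.
  have /code_dist_eq0 -> : code_dist a b = 0.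
    by apply/eqP; rewrite eq_le code_dist_ge0 andbT -d0 le_max lexx.
  by rewrite le_max lexx orbT.
rewrite de; apply/code_dist_le => k ke.
rewrite ((code_dist_le a b e).1 _ k)// -?de ?le_max ?lexx//.
by rewrite ((code_dist_le b c e).1 _ k)// -?de ?le_max ?lexx ?orbT.
Qed.

Lemma code_dist_triangle (b a c : Omega) :
  code_dist a c <= code_dist a b + code_dist b c.
Proof.
apply: le_trans (code_dist_ultra b a c) _.
by rewrite ge_max lerDl lerDr !code_dist_ge0.
Qed.

HB.instance Definition _ := isMetric.Build R Omega
  code_distxx code_dist_eq0 code_dist_sym code_dist_triangle.

End codespace_metric.

Definition borel_codespace (R : realType) (m : nat) :=
  g_sigma_algebraType (@open (codespace R m)).

Definition bernoulli_measure (R : realType) (m : nat)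
    (P : probability (borel_codespace R m) R) : Prop :=
  exists p : 'I_m.+1 -> R,
    [/\ forall j, 0 <= p j,
        \sum_j p j = 1 &
        forall a : seq 'I_m.+1,
          P [set w | mkseq w (size a) = a] = (\prod_(j <- a) p j)%:E].

Section complex_exponentials.
Context (R : realType).
Local Open Scope complex_scope.

Definition expi (t : R) : R[i] := cos t +i* sin t.

(* [unitarymx] only says that the rows are orthonormal, so that the matrix is
   required to be square separately. *)
Definition admissible_pair (N : nat) (B : {fset int}) : Prop :=
  [/\ (2 <= N)%N,
      (2 <= #|` B|)%N &
      exists L : {fset int}, #|` L| = #|` B| /\
        \matrix_(i < #|` B|, j < #|` L|)
          ((Num.sqrt (#|` B|%:R : R))^-1%:C *
           expi (- (2 * pi * (nth 0 B i)%:~R * (nth 0 L j)%:~R / N%:R)))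
        \is unitarymx].

End complex_exponentials.

Section complex_L2.
Context (R : realType).
Local Open Scope complex_scope.
Implicit Types (nu : {measure set R -> \bar R}) (f g : R -> R[i]).

Definition cmeasurable_fun f : Prop :=
  measurable_fun [set: R] (fun x => complex.Re (f x)) /\
  measurable_fun [set: R] (fun x => complex.Im (f x)).

Definition cintegral nu f : R[i] :=
  (\int[nu]_x complex.Re (f x)) +i* (\int[nu]_x complex.Im (f x)).

Definition L2normsq nu f : \bar R := (\int[nu]_x (Normc.normc (f x) ^+ 2)%:E)%E.

Definition in_L2 nu f : Prop := cmeasurable_fun f /\ (L2normsq nu f < +oo)%E.

Definition L2dot nu f g : R[i] := cintegral nu (fun x => f x * (g x)^*).

(* The family [u] indexed by [D] is orthonormal in L^2(nu), with dense linear
   span. *)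
Definition orthonormal_basis nu (I : eqType) (D : set I) (u : I -> R -> R[i])
    : Prop :=
  [/\ forall i, D i -> in_L2 nu (u i),
      forall i j, D i -> D j -> L2dot nu (u i) (u j) = (i == j)%:R &
      forall f, in_L2 nu f -> forall e : R, 0 < e ->
        exists (s : seq I) (c : I -> R[i]),
          (forall i, i \in s -> D i) /\
          (L2normsq nu (fun x => f x - \sum_(i <- s) c i * u i x)%R < e%:E)%E].

Definition spectral_measure nu : Prop :=
  nu [set: R] = 1%E /\
  exists Lambda : set R,
    orthonormal_basis nu Lambda (fun l x => expi (2 * pi * l * x)).

End complex_L2.

Section random_measures.
Context (R : realType) (m : nat).
Implicit Types rho : borel_codespace R m -> {measure set R -> \bar R}.

Definition random_measure rho : Prop :=
  forall A : set R, measurable A ->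
    measurable_fun [set: borel_codespace R m] (rho ^~ A).

Definition spectral_random_measure rho : Prop :=
  random_measure rho /\ forall w, spectral_measure (rho w).

End random_measures.

Section uniform_fset.
Context (R : realType) (A : {fset R}).

Definition delta_fset : set R -> \bar R :=
  mscale (#|` A|%:R^-1)%:nng (msum (fun i => \d_(nth 0 A i)) #|` A|).

HB.instance Definition _ := Measure.on delta_fset.

Let delta_fset_fin : fin_num_fun delta_fset.
Proof.
move=> S mS; rewrite /delta_fset /mscale/= fin_numM// /msum.
by apply/sum_fin_numP => i _ _; rewrite fin_num_measure.
Qed.

HB.instance Definition _ :=
  Measure_isFinite.Build _ _ _ delta_fset delta_fset_fin.

End uniform_fset.

Section convolution.
Context (R : realType) (mu nu : {finite_measure set R -> \bar R}).

Definition mconvolution : set R -> \bar R :=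
  pushforward (mu \x nu)%E (fun z : R * R => z.1 + z.2).

Let measurable_add : measurable_fun [set: R * R] (fun z : R * R => z.1 + z.2).
Proof. exact: measurable_funD. Qed.

Let mconv A : measurable A ->
  measurable ((fun z : R * R => z.1 + z.2) @^-1` A).
Proof. by move=> mA; rewrite -[X in measurable X]setTI; exact: measurable_add. Qed.

Let conv0 : mconvolution set0 = 0%E.
Proof. by rewrite /mconvolution /pushforward preimage_set0 measure0. Qed.

Let conv_ge0 A : (0 <= mconvolution A)%E.
Proof. exact: measure_ge0. Qed.

Let conv_sigma_additive : semi_sigma_additive mconvolution.
Proof.
move=> F mF tF mUF; rewrite /mconvolution /pushforward preimage_bigcup.
apply: measure_semi_sigma_additive.
- by move=> n; exact: mconv.
- apply/trivIsetP => /= i j _ _ ij; rewrite -preimage_setI.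
  by move/trivIsetP : tF => /(_ _ _ _ _ ij) ->//; rewrite preimage_set0.
- by rewrite -preimage_bigcup; exact: mconv.
Qed.

HB.instance Definition _ := isMeasure.Build _ _ _ mconvolution
  conv0 conv_ge0 conv_sigma_additive.

Let conv_fin : fin_num_fun mconvolution.
Proof.
move=> A mA; rewrite ge0_fin_numE//.
apply: (@le_lt_trans _ _ ((mu \x nu)%E setT)).
  by rewrite /mconvolution /pushforward; apply: le_measure; rewrite ?inE//; exact: mconv.
rewrite -setXTT product_measure1E// -ge0_fin_numE ?mule_ge0//.
by rewrite fin_numM// fin_num_measure.
Qed.

HB.instance Definition _ := Measure_isFinite.Build _ _ _ mconvolution conv_fin.

End convolution.

Definition weak_cvg (R : realType) (mu_ : nat -> {finite_measure set R -> \bar R})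
    (nu : probability R R) : Prop :=
  forall f : R -> R, continuous f -> bounded_fun f ->
    (\int[mu_ k]_x (f x)%:E)%E @[k --> \oo] --> (\int[nu]_x (f x)%:E)%E.

Section infinite_convolution.
Context (R : realType) (m : nat).
Context (N : 'I_m.+1 -> nat) (B : 'I_m.+1 -> {fset int}) (n : nat -> nat).
Implicit Type w : codespace R m.

Definition conv_factor w (k : nat) : {finite_measure set R -> \bar R} :=
  delta_fset [fset (\prod_(j < k.+1) (N (w j))%:R ^- n j) * b%:~R
             | b in B (w k)]%fset.

(* [partial_conv w k] is the convolution of the first k + 1 factors. *)
Fixpoint partial_conv w (k : nat) : {finite_measure set R -> \bar R} :=
  if k is k'.+1 then mconvolution (partial_conv w k') (conv_factor w k)
  else conv_factor w 0.

Definition infinite_conv_exists w : Prop :=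
  exists nu : probability R R, weak_cvg (partial_conv w) nu.

(* Weak limits are unique on Borel sets; a junk value is returned when there is
   none. *)
Definition infinite_conv w : probability R R :=
  get [set nu : probability R R | weak_cvg (partial_conv w) nu].

End infinite_convolution.

(* Main.v *)
From HB Require Import structures.
Require Import Defs.
From mathcomp Require Import all_boot all_order all_algebra finmap.
From mathcomp Require Import spectral complex.
From mathcomp Require Import all_classical all_reals all_analysis.
From mathcomp Require Import measurable_realfun.
From mathcomp Require Import ring lra zify.

(** Write P(k) for the product of the first k bases N^n, and let the mask of a
    digit set B be the mean of the exponentials of b x over the digits b. The
    Fourier transform of the k-th partial convolution is the product of the masks
    of its digit sets evaluated at t / P(1), t / P(2), and so on.

    Existence and measurability. As the digits are nonnegative, each further
    convolution factor pushes mass to the right, so the distribution functions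
    decrease and converge; the supports stay in a fixed interval [0, K], and the
    limit function defines the limit measure
    ([infinite_conv_exists_of_nonneg]). Integrals of continuous functions are
    limits of quantities depending on finitely many letters, hence measurable in
    the code ([random_measure_weak_limits]).

    Spectrality. Admissibility of (N, B) is a Parseval identity for the mask
    ([admissible_parseval]), and multiplying these identities gives a finite
    spectrum for every partial convolution. The frequencies of level b may be
    translated by multiples of P(b)/D, where D divides all digits, without
    affecting the first b factors. A level is called good when, thanks to such
    translations, the remaining tail of the transform can be kept away from 0
    uniformly ([good_level]). If infinitely many levels are good for the same
    bound, one builds an increasing union of finite spectra which is orthogonal
    for the limit measure and whose Parseval sums increase to 1
    ([spectrum_exists]); since the limit measure has bounded support,
    exponentials are total in L^2 ([in_closed_span_L2]), and the union is a
    spectrum ([spectral_of_parseval]).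

    It remains to find good levels. Just before a large exponent n k, the next
    scale is so large that the tail is close to 1 on a whole period; so
    unbounded exponents give infinitely many good levels for every code
    ([good_levels_of_unbounded]).

    For bounded exponents, let D be the greatest common divisor of all digits of
    the letters of positive probability, and fix u in [0, 1[. The translates
    (u + K)/D, K < P(i), at which the first i masks do not vanish form a tree in
    which every node has a child. When the number of nodes stays constant over a
    stretch of levels meeting all these letters, the masks have modulus 1 along
    the unique branches, so the products of the digits by a fixed point are
    integers, and by the Bezout relation u = 0 ([constant_run_u0]). Otherwise the
    number of nodes eventually exceeds the number of zeros that the next i0
    masks, which are trigonometric polynomials of bounded degree, can have. So
    for every u some translate avoids all zeros ([tree_avoids_zeros]).
    Compactness in u and the finiteness of the set of exponents turn this into a
    uniform lower bound at each position where a certain periodic word W occurs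
    ([good_level_at_word]). Under a Bernoulli measure almost every code consists
    of letters of positive probability and contains W infinitely often
    ([ae_recurrent_word]). *)

Set Implicit Arguments.
Unset Strict Implicit.
Unset Printing Implicit Defensive.

Import Order.TTheory GRing.Theory Num.Theory.
Import numFieldNormedType.Exports.

Local Open Scope classical_set_scope.
Local Open Scope ring_scope.

(** * Complex exponentials and norms *)

#[global] Arguments conjc : simpl never.

Section expi_theory.
Context (R : realType).
Local Open Scope complex_scope.
Local Notation C := (R[i]).
Local Notation normc := (@Normc.normc R).
Implicit Types (x y t : R) (z : C).

(** The squared modulus as a real number: the modulus itself is a square root,
    and identities between squares are polynomial in the real and imaginary
    parts. *)
Definition nsq (z : C) : R := complex.Re z ^+ 2 + complex.Im z ^+ 2.

Lemma normc_sqr z : normc z ^+ 2 = nsq z.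
Proof. by case: z => a b; rewrite /nsq /= sqr_sqrtr// addr_ge0 ?sqr_ge0. Qed.

Lemma normc_ge0 z : 0 <= normc z.
Proof. by case: z => a b /=; exact: sqrtr_ge0. Qed.

Lemma nsq_ge0 z : 0 <= nsq z.
Proof. by rewrite addr_ge0 ?sqr_ge0. Qed.

Lemma nsqM z w : nsq (z * w) = nsq z * nsq w.
Proof. by rewrite -!normc_sqr Normc.normcM exprMn. Qed.

Lemma nsq0 : nsq 0 = 0.
Proof. by rewrite /nsq /= expr0n addr0. Qed.

Lemma nsq1 : nsq 1 = 1.
Proof. by rewrite /nsq /= expr0n addr0 expr1n. Qed.

Lemma nsq_eq0 z : nsq z = 0 -> z = 0.
Proof.
move=> z0; apply: Normc.eq0_normc; apply/eqP.
by rewrite -sqrf_eq0 normc_sqr z0.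
Qed.

Lemma nsqE z : (nsq z)%:C = z * conjc z.
Proof.
by case: z => a b; apply/eqP; rewrite eq_complex /nsq /conjc /=; apply/andP; split; apply/eqP; ring.
Qed.

Lemma conjcM z w : conjc (z * w) = conjc z * conjc w :> C.
Proof. exact: (rmorphM (@conjc R)). Qed.

Lemma conjc_sum (I : Type) (s : seq I) (F : I -> C) :
  conjc (\sum_(i <- s) F i) = \sum_(i <- s) conjc (F i) :> C.
Proof. exact: (raddf_sum (@conjc R)). Qed.

Lemma conjCE z : Num.conj z = conjc z.
Proof.
have [->|z0] := eqVneq z 0; first by rewrite conjc0 rmorph0.
by apply: (mulfI z0); rewrite -normCK sqr_normc.
Qed.

Lemma nsqJ z : nsq (conjc z) = nsq z.
Proof. by case: z => a b; rewrite /nsq /conjc /= sqrrN. Qed.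

Lemma nsqDle z w : nsq (z + w) <= 2 * nsq z + 2 * nsq w.
Proof.
case: z w => [a b] [c d]; rewrite /nsq /=; rewrite -subr_ge0.
have -> : 2 * (a ^+ 2 + b ^+ 2) + 2 * (c ^+ 2 + d ^+ 2) -
  ((a + c) ^+ 2 + (b + d) ^+ 2) = (a - c) ^+ 2 + (b - d) ^+ 2 by ring.
by rewrite addr_ge0 ?sqr_ge0.
Qed.

Lemma normc_ReIm z : normc z <= `|complex.Re z| + `|complex.Im z|.
Proof.
case: z => a b /=; rewrite -(@ler_pXn2r _ 2) ?nnegrE ?sqrtr_ge0 ?addr_ge0//.
rewrite sqr_sqrtr ?addr_ge0 ?sqr_ge0// sqrrD -[a ^+ 2]real_normK ?num_real//.
by rewrite -[b ^+ 2]real_normK ?num_real// addrAC lerDl mulrn_wge0// mulr_ge0.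
Qed.

Lemma normcB z w : normc (z - w) = normc (w - z).
Proof. by rewrite -normcN opprB. Qed.

Lemma normc_real x : normc x%:C = `|x|.
Proof. by rewrite /= expr0n addr0 sqrtr_sqr. Qed.

Lemma normc_sum (I : Type) (s : seq I) (F : I -> C) :
  normc (\sum_(i <- s) F i) <= \sum_(i <- s) normc (F i).
Proof.
elim/big_rec2: _ => [|i y z _ IH]; first by rewrite Normc.normc0.
by rewrite (le_trans (le_normcD _ _))// lerD2l.
Qed.

Lemma Re_sum (I : Type) (s : seq I) (F : I -> C) :
  complex.Re (\sum_(i <- s) F i) = \sum_(i <- s) complex.Re (F i).
Proof. by elim/big_rec2: _ => // i y z _ <-; case: (F i) z => [a b] []. Qed.

Lemma Im_sum (I : Type) (s : seq I) (F : I -> C) :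
  complex.Im (\sum_(i <- s) F i) = \sum_(i <- s) complex.Im (F i).
Proof. by elim/big_rec2: _ => // i y z _ <-; case: (F i) z => [a b] []. Qed.

Lemma expiD x y : expi (x + y) = expi x * expi y.
Proof.
by rewrite /expi cosD sinD; apply/eqP; rewrite eq_complex /= eqxx/=; apply/eqP; ring.
Qed.

Lemma expi0 : expi (0 : R) = 1.
Proof. by rewrite /expi cos0 sin0. Qed.

Lemma expiN x : expi (- x) = conjc (expi x) :> C.
Proof. by rewrite /expi /conjc cosN sinN. Qed.

Lemma nsq_expi x : nsq (expi x) = 1.
Proof. by rewrite /nsq /= cos2Dsin2. Qed.

Lemma normc_expi x : normc (expi x) = 1.
Proof. by rewrite /= cos2Dsin2 sqrtr1. Qed.

Lemma expiMn (k : nat) x : expi (k%:R * x) = expi x ^+ k.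
Proof.
elim: k => [|k IH]; first by rewrite mul0r expi0.
by rewrite -natr1 mulrDl mul1r expiD IH exprSr.
Qed.

Lemma expi_2pi : expi (2 * pi : R) = 1.
Proof. by rewrite /expi mulr_natl cos2pi sin2pi. Qed.

Lemma expi_int y : y \is a Num.int -> expi (2 * pi * y) = 1.
Proof.
move=> /intrP[[k|k] ->]; last rewrite NegzE mulrNz mulrN expiN.
  by rewrite -pmulrn mulrC expiMn expi_2pi expr1n.
by rewrite -pmulrn mulrC expiMn expi_2pi expr1n conjc1.
Qed.

(** Reducing y modulo 1 to t in [0, 1[, the real part gives cos (2 pi t) = 1,
    hence sin (pi t) = 0, and the sine is positive on ]0, pi[. *)
Lemma expi_eq1 y : expi (2 * pi * y) = 1 -> y \is a Num.int.
Proof.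
move=> y1.
set t := y - (Num.floor y)%:~R.
have t0 : 0 <= t by rewrite subr_ge0 ge_floor.
have t1 : t < 1 by rewrite ltrBlDl -intrD1 lt_succ_floor.
have yE : y = t + (Num.floor y)%:~R by rewrite /t subrK.
have : expi (2 * pi * t) = 1.
  by move: y1; rewrite {1}yE mulrDr expiD (@expi_int (_%:~R)) ?mulr1// intr_int.
have -> : 2 * pi * t = (pi * t) *+ 2 by rewrite -mulrA mulr_natl.
rewrite /expi cos_mulr2n sin_mulr2n.
have [t00|tn0] := eqVneq t 0; first by move=> _; rewrite yE t00 add0r intr_int.
have : 0 < sin (pi * t).
  apply: sin_gt0_pi; rewrite mulr_gt0 ?pi_gt0//= ?lt_neqAle ?t0 1?eq_sym ?tn0//.
  by rewrite eq_sym -lt_neqAle -[ltRHS]mulr1 ltr_pM2l ?pi_gt0.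
move=> s0 []; rewrite cos2sin2 => c0 _.
have : sin (pi * t) ^+ 2 = 0 by move: c0; rewrite mulr2n; lra.
by move/eqP; rewrite sqrf_eq0 gt_eqF.
Qed.

Lemma expi_period x y : y \is a Num.int -> expi (2 * pi * (x + y)) = expi (2 * pi * x).
Proof. by move=> yi; rewrite mulrDr expiD (expi_int yi) mulr1. Qed.

(** The mean value theorem on the real and imaginary parts costs the harmless
    factor 2. *)
Lemma expi_lip x y : normc (expi x - expi y) <= 2 * `|x - y|.
Proof.
apply: (le_trans (normc_ReIm _)); rewrite /expi/= mulr_natl mulr2n.
wlog xy : x y / x <= y.
  move=> H; have [/H//|] := boolP (x <= y); rewrite -ltNge => /ltW/H.
  by rewrite (distrC (cos _)) (distrC (sin _)) (distrC y x).
move: xy; rewrite le_eqVlt => /predU1P[->|xy]; first by rewrite !subrr normr0 addr0.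
have lip (f f' : R -> R) : (forall z : R, is_derive z 1 f (f' z)) ->
    (forall z : R, `|f' z| <= 1) -> `|f x - f y| <= `|x - y|.
  move=> df bf; have [|c _] := @MVT _ f f' x y xy => //.
    apply: derivable_within_continuous => z _; exact: ex_derive.
  by rewrite distrC => ->; rewrite normrM distrC ler_piMl.
have b1 (z : R) : `|- sin z| <= 1 :> R by rewrite normrN ler_norml sin_geN1 sin_le1.
have b2 (z : R) : `|cos z| <= 1 :> R by rewrite ler_norml cos_geN1 cos_le1.
have l1 := lip _ _ (@is_derive_cos R) b1.
have l2 := lip _ _ (@is_derive_sin R) b2.
exact: lerD l1 l2.
Qed.

Lemma normc_prod_le1 (I : Type) (s : seq I) (F : I -> C) :
  (forall i, normc (F i) <= 1) -> normc (\prod_(i <- s) F i) <= 1.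
Proof.
move=> F1; elim/big_rec: _ => [|i z _ IH]; first by rewrite Normc.normc1.
by rewrite Normc.normcM mulr_ile1 ?normc_ge0.
Qed.

(** Telescoping: factors of modulus at most 1 are exchanged one at a time. *)
Lemma normc_prodB (I : Type) (s : seq I) (F G : I -> C) :
  (forall i, normc (F i) <= 1) -> (forall i, normc (G i) <= 1) ->
  normc (\prod_(i <- s) F i - \prod_(i <- s) G i) <=
  \sum_(i <- s) normc (F i - G i).
Proof.
move=> F1 G1; elim: s => [|i s IH]; first by rewrite !big_nil subrr Normc.normc0.
rewrite !big_cons.
set f := \prod_(j <- s) F j; set g := \prod_(j <- s) G j.
have -> : F i * f - G i * g = (F i - G i) * f + G i * (f - g) by ring.
rewrite (le_trans (le_normcD _ _))// !Normc.normcM lerD//.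
  by rewrite ler_piMr ?normc_ge0// normc_prod_le1.
by rewrite (le_trans _ IH)// ler_piMl ?normc_ge0.
Qed.

End expi_theory.

(** * Masks of digit sets and their Parseval identity *)

Section maskf_theory.
Context (R : realType).
Local Open Scope complex_scope.
Local Notation C := (R[i]).
Local Notation normc := (@Normc.normc R).

(** The Fourier transform of the uniform measure on B. It has period 1, and
    period 1/D when D divides all digits. *)
Definition maskf (B : seq int) (x : R) : C :=
  (size B)%:R^-1 * \sum_(b <- B) expi (2 * pi * (b%:~R * x)).

Lemma natr_complex (n : nat) : (n%:R : C) = (n%:R : R)%:C.
Proof. by rewrite rmorph_nat. Qed.

Lemma normc_nat (n : nat) : normc (n%:R : C) = n%:R.
Proof. by rewrite natr_complex normc_real ger0_norm. Qed.

Lemma maskf_period B x y : (forall b, b \in B -> b%:~R * y \is a Num.int) ->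
  maskf B (x + y) = maskf B x.
Proof.
move=> By; rewrite /maskf; congr (_ * _); apply: eq_big_seq => b bB.
by rewrite (mulrDr b%:~R) (expi_period _ (By _ bB)).
Qed.

Lemma maskf0 B : (0 < size B)%N -> maskf B 0 = 1.
Proof.
move=> B0; rewrite /maskf (eq_bigr (fun=> 1)); last first.
  by move=> b _; rewrite !mulr0 expi0.
rewrite big_const_seq count_predT iter_addr_0 mulVf//.
by rewrite pnatr_eq0 -lt0n.
Qed.

Lemma normc_maskf_le1 B x : normc (maskf B x) <= 1.
Proof.
rewrite /maskf Normc.normcM Normc.normcV normc_nat.
have [->|B0] := eqVneq (size B) 0; first by rewrite invr0 mul0r.
rewrite ler_pdivrMl ?ltr0n ?lt0n// mulr1 (le_trans (normc_sum _ _))//.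
rewrite (eq_bigr (fun=> 1)); last by move=> b _; rewrite normc_expi.
by rewrite big_const_seq count_predT iter_addr_0.
Qed.

Lemma maskf_lip B K x y : 0 <= K -> (forall b, b \in B -> `|b%:~R| <= K :> R) ->
  normc (maskf B x - maskf B y) <= 4 * pi * K * `|x - y|.
Proof.
move=> K0 BK; rewrite /maskf -mulrBr -sumrB Normc.normcM Normc.normcV normc_nat.
have [B0|B0] := eqVneq (size B) 0.
  by rewrite (size0nil B0) big_nil Normc.normc0 mulr0 !mulr_ge0 ?pi_ge0.
rewrite ler_pdivrMl ?ltr0n ?lt0n// (le_trans (normc_sum _ _))//.
have -> : (size B)%:R * (4 * pi * K * `|x - y|) =
    \sum_(b <- B) (4 * pi * K * `|x - y|).
  by rewrite big_const_seq count_predT iter_addr_0 mulr_natl.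
rewrite !big_seq; apply: ler_sum => b bB.
rewrite (le_trans (expi_lip _ _))// -mulrBr -mulrBr !normrM.
rewrite (ger0_norm (pi_ge0 _)) ger0_norm//.
have : `|b%:~R| * `|x - y| <= K * `|x - y| by rewrite ler_wpM2r ?BK.
move=> h; have := pi_ge0 R => p0.
have -> : 4 * pi * K * `|x - y| = 2 * (2 * pi * (K * `|x - y|)) by ring.
by rewrite !ler_wpM2l// mulr_ge0.
Qed.

(** Unitarity of the exponential matrix of an admissible pair, expressed on
    the mask. Unlike unitarity, this identity is stable under products of
    masks, and it already contains the orthogonality and the distinctness of
    the frequencies. *)
Definition parseval_frequencies (B : seq int) (N : nat) (L : seq int) :=
  forall x : R, \sum_(l <- L) nsq (maskf B (x + l%:~R / N%:R)) = 1.

(** Expand the squared moduli into a double sum over pairs of digits and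
    exchange the sums: the inner sums over the frequencies vanish off the
    diagonal. *)
Lemma parseval_of_orthogonal_rows (B : seq int) (N : nat) (L : seq int) :
  uniq B -> (0 < size B)%N ->
  (forall b b', b \in B -> b' \in B ->
    \sum_(l <- L) expi (2 * pi * ((b%:~R - b'%:~R) * (l%:~R / N%:R)))
      = ((size B)%:R *+ (b == b') : C)) ->
  parseval_frequencies B N L.
Proof.
move=> uB B0 orth x.
apply: (@complexI R).
rewrite rmorph_sum /=.
set c : C := (size B)%:R^-1.
have cJ : conjc c = c by rewrite /c natr_complex -fmorphV conjc_real.
transitivity (\sum_(l <- L) \sum_(b <- B) \sum_(b' <- B)
   c * c * expi (2 * pi * ((b%:~R - b'%:~R) * x)) *
   expi (2 * pi * ((b%:~R - b'%:~R) * (l%:~R / N%:R)))).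
  apply: eq_bigr => l _; rewrite nsqE /maskf conjcM -/c cJ.
  rewrite conjc_sum mulrACA big_distrlr/= mulr_sumr; apply: eq_bigr => b _.
  rewrite mulr_sumr; apply: eq_bigr => b' _.
  rewrite -[RHS]mulrA -expiN -!expiD; congr (_ * expi _).
  by ring.
rewrite exchange_big/=.
under eq_bigr do rewrite exchange_big/=.
rewrite (eq_big_seq (fun b => c)); last first.
  move=> b bB.
  under eq_bigr do rewrite -mulr_sumr.
  rewrite (bigD1_seq b)//= [X in _ + X]big1_seq ?addr0; last first.
    by move=> b' /andP[bb' b'B]; rewrite orth// eq_sym (negbTE bb') mulr0n mulr0.
  rewrite orth// eqxx mulr1n subrr mul0r mulr0 expi0 mulr1 -mulrA mulVf ?mulr1//.
  by rewrite pnatr_eq0 -lt0n.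
rewrite big_const_seq count_predT iter_addr_0 -(mulr_natl c) mulfV//.
by rewrite pnatr_eq0 -lt0n.
Qed.

Lemma parseval_shift B N L (k : int) : parseval_frequencies B N L ->
  parseval_frequencies B N [seq l - k | l <- L].
Proof.
move=> H x; rewrite -[RHS](H (x - k%:~R / N%:R)) big_map; apply: eq_bigr => l _.
by congr (nsq (maskf _ _)); rewrite intrB mulrBl; ring.
Qed.

(** Replacing N by N^k only rescales the frequencies, by N^(k-1). *)
Lemma parseval_pow B N L (k : nat) : (0 < N)%N -> (0 < k)%N ->
  parseval_frequencies B N L ->
  parseval_frequencies B (N ^ k) [seq l * (N ^ k.-1)%N%:Z | l <- L].
Proof.
move=> N0 k0 H x; rewrite -[RHS](H x) big_map; apply: eq_bigr => l _.
congr (nsq (maskf _ (x + _))); rewrite -{2}(prednK k0) expnSr intrM.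
rewrite -pmulrn natrM -mulrA; congr (_ * _).
by rewrite invfM mulrCA mulrA mulVf ?mul1r// pnatr_eq0 expn_eq0 negb_and -lt0n N0.
Qed.

(** The frequencies may be translated so as to contain 0, because the identity
    holds at every point. The sign change comes from the minus sign in the
    exponent of the matrix. *)
Lemma admissible_parseval (N : nat) (B : {fset int}) :
  admissible_pair R N B ->
  exists L : seq int, 0 \in L /\ parseval_frequencies B N L.
Proof.
case=> N2 B2 [L [sL /unitarymxP U]].
have PL : parseval_frequencies B N (map -%R L).
  apply: parseval_of_orthogonal_rows; [exact: fset_uniq|exact: ltnW|].
  move=> b b' bB b'B.
  rewrite big_map.
  have ib : (index b B < #|` B|)%N by rewrite index_mem.
  have ib' : (index b' B < #|` B|)%N by rewrite index_mem.
  have /matrixP/(_ (Ordinal ib) (Ordinal ib')) := U.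
  rewrite !mxE /= -val_eqE /=.
  have -> : (index b B == index b' B) = (b == b').
    by apply/eqP/eqP => [|->//]; exact: index_inj.
  move=> E.
  have s0 : (#|` B|%:R : C) != 0 by rewrite pnatr_eq0 -lt0n ltnW.
  rewrite (_ : (size B)%:R *+ (b == b') = #|` B|%:R * ((b == b')%:R : C)); last by rewrite mulr_natr.
  rewrite -E mulr_sumr (big_nth 0) big_mkord; apply: eq_bigr => j _.
  rewrite !mxE /= !nth_index//.
  set s : C := _%:C.
  have ss : s * conjc s = (#|` B|%:R)^-1.
    by rewrite /s conjc_real -rmorphM /= -invfM -expr2 sqr_sqrtr// fmorphV rmorph_nat.
  rewrite conjCE conjcM -expiN [X in _ = _ * X]mulrACA ss [RHS]mulrA mulfV// mul1r -expiD; congr expi.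
  by rewrite rmorphN/=; ring.
have [l0 l0L] : exists l, l \in map -%R L.
  case: (map -%R L) PL => [/(_ 0)|l l' _]; last by exists l; rewrite mem_head.
  by rewrite big_nil => /esym/eqP; rewrite oner_eq0.
exists [seq l - l0 | l <- map -%R L]; split; last exact: parseval_shift.
by apply/mapP; exists l0; rewrite // subrr.
Qed.

(** The mask is a mean of numbers of modulus 1. When the mean has modulus 1
    the variance vanishes, so all terms agree with the one of the digit 0,
    which is 1. *)
Lemma maskf_nsq1 B x : uniq B -> 0 \in B -> nsq (maskf B x) = 1 ->
  forall b, b \in B -> b%:~R * x \is a Num.int.
Proof.
move=> uB B0 m1 b bB; apply: expi_eq1.
have [->|bn0] := eqVneq b 0; first by rewrite mul0r mulr0 expi0.
set z := expi _.
have sB : (0 < size B)%N by case: (B) bB.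
set m := maskf B x in m1.
pose e (b : int) : C := expi (2 * pi * (b%:~R * x)).
have Sm : \sum_(b <- B) e b = (size B)%:R * m.
  by rewrite /m /maskf mulrA mulfV ?mul1r// pnatr_eq0 -lt0n.
have SmRe : \sum_(b <- B) complex.Re (e b) = (size B)%:R * complex.Re m.
  by rewrite -Re_sum Sm natr_complex; case: (m) => u v /=; ring.
have SmIm : \sum_(b <- B) complex.Im (e b) = (size B)%:R * complex.Im m.
  by rewrite -Im_sum Sm natr_complex; case: (m) => u v /=; ring.
have : \sum_(b <- B) nsq (e b - m) = 0.
  transitivity (\sum_(b <- B) (2 - 2 * (complex.Re m * complex.Re (e b)
                                 + complex.Im m * complex.Im (e b)))).
    apply: eq_bigr => b' _.
    have -> : (2 : R) = nsq (e b') + nsq m by rewrite nsq_expi m1.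
    rewrite nsq_expi m1 -[X in _ = X - _](_ : nsq (e b') + nsq m = _); last by rewrite nsq_expi m1.
    by case: (e b') (m) => [u v] [u' v']; rewrite /nsq/=; ring.
  transitivity (\sum_(b <- B) (2 : R) - 2 * (complex.Re m * \sum_(b <- B) complex.Re (e b)
                 + complex.Im m * \sum_(b <- B) complex.Im (e b))).
    by rewrite 2!mulr_sumr -big_split mulr_sumr -sumrB.
  rewrite SmRe SmIm.
  rewrite big_const_seq count_predT iter_addr_0 -mulr_natr.
  move: m1; rewrite /nsq => m1; rewrite -mulr_natr.
  transitivity (2 * (size B)%:R * (1 - (complex.Re m ^+ 2 + complex.Im m ^+ 2))); first by ring.
  by rewrite m1 subrr mulr0.
move=> /eqP; rewrite psumr_eq0; last by move=> *; exact: nsq_ge0.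
move=> /allP em.
have eE b' : b' \in B -> e b' = m.
  by move=> /em /= /eqP /nsq_eq0 /eqP; rewrite subr_eq0 => /eqP.
by rewrite /z -/(e b) (eE b bB) -(eE 0 B0) /e mul0r mulr0 expi0.
Qed.

End maskf_theory.

(** * Products of masks along a sequence of digit sets *)

Section partial_products.
Context (R : realType) (Ns : nat -> nat) (Bs : nat -> seq int).
Local Open Scope complex_scope.
Local Notation C := (R[i]).
Local Notation normc := (@Normc.normc R).

Definition nprod a b : nat := (\prod_(a <= j < b) Ns j)%N.

(** The Fourier transform of the convolution of the factors with indices from
    a to b - 1, every factor being scaled by the whole product of the bases up
    to its own index. *)
Definition mprod a b (xi : R) : C :=
  \prod_(a <= i < b) maskf (Bs i) (xi / (nprod 0 i.+1)%:R).

Lemma mprod_nil a xi : mprod a a xi = 1.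
Proof. by rewrite /mprod big_geq. Qed.

Lemma mprod_cat b a c xi : (a <= b)%N -> (b <= c)%N ->
  mprod a c xi = mprod a b xi * mprod b c xi.
Proof. by move=> ab bc; rewrite /mprod (big_cat_nat (n := b)). Qed.

Lemma mprod_recr a b xi : (a <= b)%N ->
  mprod a b.+1 xi = mprod a b xi * maskf (Bs b) (xi / (nprod 0 b.+1)%:R).
Proof. by move=> ab; rewrite /mprod big_nat_recr. Qed.

Lemma nprod_cat b a c : (a <= b)%N -> (b <= c)%N ->
  nprod a c = (nprod a b * nprod b c)%N.
Proof. by move=> ab bc; rewrite /nprod (big_cat_nat (n := b)). Qed.

Lemma normc_mprod_le1 a b xi : normc (mprod a b xi) <= 1.
Proof. by apply: normc_prod_le1 => i; exact: normc_maskf_le1. Qed.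

Hypothesis Ns2 : forall i, (2 <= Ns i)%N.

Lemma nprod_gt0 a b : (0 < nprod a b)%N.
Proof.
rewrite /nprod; elim/big_ind: _ => //= [x y x0 y0|i _]; first by rewrite muln_gt0 x0.
exact: leq_trans (Ns2 i).
Qed.

Lemma nprodR_gt0 a b : 0 < (nprod a b)%:R :> R.
Proof. by rewrite ltr0n nprod_gt0. Qed.

Lemma nprodR_neq0 a b : (nprod a b)%:R != 0 :> R.
Proof. by rewrite gt_eqF ?nprodR_gt0. Qed.

Lemma nprod_recr a b : (a <= b)%N -> nprod a b.+1 = (nprod a b * Ns b)%N.
Proof. by move=> ab; rewrite /nprod big_nat_recr. Qed.

Lemma nprod_ge_exp a b : (2 ^ (b - a) <= nprod a b)%N.
Proof.
have [ba|ab] := leqP b a.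
  by move: (ba); rewrite -subn_eq0 => /eqP ->; rewrite nprod_gt0.
rewrite -(subnK (ltnW ab)) addnK; elim: (b - a)%N => [|k IH].
  by rewrite nprod_gt0.
by rewrite addSn nprod_recr ?leq_addl// expnSr leq_mul.
Qed.

(** The bases are at least 2, so that consecutive inverses satisfy 1/P(b+1) <=
    1/P(b) - 1/P(b+1) and the sum telescopes. *)
Lemma sum_inv_nprod a b : (a <= b)%N ->
  \sum_(a <= i < b) (nprod 0 i.+1)%:R^-1 <= (nprod 0 a)%:R^-1 - (nprod 0 b)%:R^-1 :> R.
Proof.
elim: b => [|b IH]; first by rewrite leqn0 => /eqP ->; rewrite big_geq// subrr.
rewrite leq_eqVlt => /predU1P[->|]; first by rewrite big_geq// subrr.
rewrite ltnS => ab; rewrite big_nat_recr//=.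
have := IH ab; set S := \sum_(_ <= _ < _) _; set p := (nprod 0 a)%:R^-1.
set q := (nprod 0 b)%:R^-1; set r := (nprod 0 b.+1)%:R^-1 => h.
have : 2 * r <= q.
  rewrite /r /q nprod_recr// natrM invfM mulrCA ler_piMr ?invr_ge0//.
  by rewrite ler_pdivrMr ?mul1r ?ler_nat ?ltr0n ?(leq_trans _ (Ns2 b)).
by rewrite addrC; lra.
Qed.

Section bounded_digits.
Variable K : R.
Hypothesis K0 : 0 <= K.
Hypothesis BK : forall i b, b \in Bs i -> `|b%:~R| <= K :> R.

(** The Lipschitz constants of the factors decay geometrically; hence the
    bound does not depend on the number b - a of factors. *)
Lemma mprod_lip a b xi xi' :
  normc (mprod a b xi - mprod a b xi') <= 4 * pi * K * `|xi - xi'| / (nprod 0 a)%:R.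
Proof.
have [ba|ab] := leqP b a.
  by rewrite /mprod !big_geq// subrr Normc.normc0 divr_ge0 ?mulr_ge0 ?pi_ge0.
rewrite (le_trans (normc_prodB _ _ _))//; try by move=> i; exact: normc_maskf_le1.
apply: (@le_trans _ _ (4 * pi * K * `|xi - xi'| * \sum_(a <= i < b) (nprod 0 i.+1)%:R^-1)).
  rewrite mulr_sumr; apply: ler_sum => i _.
  rewrite (le_trans (maskf_lip _ _ K0 (@BK i)))// -mulrBl normrM -!mulrA !ler_wpM2l ?pi_ge0//.
  by rewrite ger0_norm// invr_ge0.
rewrite ler_wpM2l ?mulr_ge0 ?pi_ge0// (le_trans (sum_inv_nprod (ltnW ab)))//.
by rewrite gerBl invr_ge0.
Qed.

Hypothesis B0 : forall i, 0 \in Bs i.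

Lemma size_Bs_gt0 i : (0 < size (Bs i))%N.
Proof. by have := B0 i; case: (Bs i). Qed.

Lemma mprod0 a b : mprod a b 0 = 1.
Proof. by rewrite /mprod big1// => i _; rewrite mul0r maskf0// size_Bs_gt0. Qed.

Lemma mprod_near0 a b xi : 1 - 4 * pi * K * `|xi| / (nprod 0 a)%:R <= normc (mprod a b xi).
Proof.
have := @mprod_lip a b 0 xi; rewrite mprod0 sub0r normrN => h.
have : normc 1 <= normc (1 - mprod a b xi) + normc (mprod a b xi).
  by rewrite -{1}(subrK (mprod a b xi) 1) le_normcD.
by rewrite Normc.normc1; lra.
Qed.

End bounded_digits.

Section lattice.
Variable D : nat.
Hypothesis D0 : (0 < D)%N.
Hypothesis DB : forall i b, b \in Bs i -> (D %| b)%Z.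

(** This gain of the factor 1/D over the obvious period is what allows a
    translation by a fraction t/D in the choice of frequencies. *)
Lemma mprod_period a b xi (t : int) :
  mprod a b (xi + (nprod 0 b)%:R * (t%:~R / D%:R)) = mprod a b xi.
Proof.
rewrite /mprod !big_nat; apply: eq_bigr => i /andP[_ ib].
rewrite mulrDl (@nprod_cat i.+1 0 b)// natrM.
rewrite maskf_period// => c /DB /dvdzP[q ->].
rewrite intrM -pmulrn.
have -> : q%:~R * D%:R * ((nprod 0 i.+1)%:R * (nprod i.+1 b)%:R * (t%:~R / D%:R) / (nprod 0 i.+1)%:R)
  = q%:~R * (nprod i.+1 b)%:R * t%:~R :> R.
  have d0 : D%:R != 0 :> R by rewrite pnatr_eq0 -lt0n.
  have := nprodR_neq0 0 i.+1 => p0.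
  by field; rewrite d0 p0.
by rewrite !rpredM ?intr_int ?natr_int.
Qed.

Lemma mprod_period_int a b xi (t : int) :
  mprod a b (xi + (nprod 0 b)%:R * t%:~R) = mprod a b xi.
Proof.
have -> : t%:~R = (t * D%:Z)%:~R / D%:R :> R.
  by rewrite intrM -pmulrn mulfK// pnatr_eq0 -lt0n.
exact: mprod_period.
Qed.

(** Lam is a spectrum of the finite convolution of the first b factors. *)
Definition parseval_at b (Lam : seq R) :=
  forall xi, \sum_(l <- Lam) nsq (mprod 0 b (xi + l)) = 1.

Hypothesis hL : forall i, exists L : seq int, 0 \in L /\ @parseval_frequencies R (Bs i) (Ns i) L.

(** Frequencies of consecutive factors combine as digits of a mixed radix
    expansion, and the identities of the single masks multiply because each
    mask does not see the higher digits. *)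
Lemma block_frequencies a k : exists G : seq int, 0 \in G /\
  forall xi, \sum_(g <- G) nsq (mprod a (a + k) (xi + (nprod 0 a)%:R * g%:~R)) = 1.
Proof.
elim: k => [|k [G [G0 IH]]].
  exists [:: 0]; split; first exact: mem_head.
  by move=> xi; rewrite big_seq1 addn0 mprod_nil nsq1.
have [L [L0 PL]] := hL (a + k).
exists [seq g + (nprod a (a + k))%:Z * l | g <- G, l <- L]; split.
  by apply/allpairsP; exists (0, 0); rewrite /= G0 L0 mulr0 addr0.
move=> xi; rewrite big_allpairs_dep -[RHS](IH xi)/=; apply: eq_bigr => g _.
rewrite -[RHS]mulr1 -[X in _ = _ * X](PL ((xi + (nprod 0 a)%:R * g%:~R) / (nprod 0 (a + k).+1)%:R)) mulr_sumr.
apply: eq_bigr => l _; rewrite -nsqM addnS mprod_recr ?leq_addr//.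
have -> : xi + (nprod 0 a)%:R * (g + (nprod a (a + k))%:Z * l)%:~R =
    xi + (nprod 0 a)%:R * g%:~R + (nprod 0 (a + k))%:R * l%:~R :> R.
  by rewrite (@nprod_cat a 0 (a + k)) ?leq_addr// natrM intrD intrM -pmulrn; ring.
congr (nsq (_ * maskf _ _)).
  by rewrite mprod_period_int.
rewrite mulrDl; congr (_ + _); rewrite nprod_recr// natrM.
have n0 : (Ns (a + k))%:R != 0 :> R by rewrite pnatr_eq0 -lt0n (leq_trans _ (Ns2 _)).
have := nprodR_neq0 0 (a + k) => p0.
by field; rewrite n0 p0.
Qed.

End lattice.

End partial_products.

(** * Spectra from infinitely many good levels *)

Section spectrum_construction.
Context (R : realType) (Ns : nat -> nat) (Bs : nat -> seq int).
Local Open Scope complex_scope.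
Local Notation C := (R[i]).
Local Notation normc := (@Normc.normc R).
Local Notation nprod := (nprod Ns).
Local Notation mprod := (@mprod R Ns Bs).
Local Notation parseval_at := (@parseval_at R Ns Bs).

(** The tail of the convolution after level n, rescaled, is bounded below by
    eps in modulus at some representative of every class modulo 1/D. The bound
    is uniform in the number of factors kept, so that it passes to the limit. *)
Definition good_level D n (eps : R) := forall x : R, exists t : int,
  forall b, (n <= b)%N ->
    eps <= normc (mprod n b ((nprod 0 n)%:R * (x + t%:~R / D%:R))).

Lemma uniq_notin_rem (T : eqType) (s : seq T) :
  (forall x, x \in s -> x \notin rem x s) -> uniq s.
Proof.
elim: s => [//|x s IH] H /=; apply/andP; split.
  by have := H x (mem_head _ _); rewrite /= eqxx.
apply: IH => y ys; have := H y; rewrite in_cons ys orbT /= => /(_ isT).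
have [<-|xy] := eqVneq x y; first by apply: contra => /mem_rem.
by rewrite in_cons negb_or => /andP[].
Qed.

Hypothesis Ns2 : forall i, (2 <= Ns i)%N.
Variable K : R.
Hypothesis K0 : 0 <= K.
Hypothesis BK : forall i b, b \in Bs i -> `|b%:~R| <= K :> R.
Hypothesis B0 : forall i, 0 \in Bs i.

(** Evaluated at the opposite of a frequency l, the identity contains the term
    1 coming from l; all other terms must vanish. *)
Lemma parseval_at_orthogonal b Lam : parseval_at b Lam ->
  uniq Lam /\ forall l l', l \in Lam -> l' \in Lam -> l != l' ->
    mprod 0 b (l - l') = 0.
Proof.
move=> PL.
have key l l' : l' \in Lam -> l \in rem l' Lam -> mprod 0 b (l - l') = 0.
  move=> l'L lr; apply: nsq_eq0; have := PL (- l').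
  rewrite (big_rem l')//= addNr (mprod0 _ _ B0) nsq1 => /eqP.
  rewrite -subr_eq0 addrAC subrr add0r psumr_eq0; last by move=> *; exact: nsq_ge0.
  by move=> /allP/(_ _ lr)/=; rewrite addrC => /eqP.
split.
  apply: uniq_notin_rem => l lL; apply/negP => /(key _ _ lL).
  by rewrite subrr (mprod0 _ _ B0) => /eqP; rewrite oner_eq0.
move=> l l' lL l'L ll'; apply: key => //.
by move: lL; rewrite (perm_mem (perm_to_rem l'L)) in_cons (negbTE ll').
Qed.

Variable D : nat.
Hypothesis D0 : (0 < D)%N.
Hypothesis DB : forall i b, b \in Bs i -> (D %| b)%Z.
Hypothesis hL : forall i, exists L : seq int, 0 \in L /\ @parseval_frequencies R (Bs i) (Ns i) L.

(** The finite spectrum is extended up to a good level b. The old frequencies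
    are kept: they stay small compared with the scale of b, so the tail is
    close to 1 there. Every new frequency is moved by a multiple of P(b)/D,
    invisible to the first b factors, to a place where the tail is at least
    eps. Both bounds survive a translation by a bounded xi by the Lipschitz
    estimate. *)
Lemma parseval_extension a Lam rho eta eps : parseval_at a Lam ->
  0 < eta -> 0 < eps ->
  (forall n0, exists n, (n0 <= n)%N /\ good_level D n eps) ->
  exists b X, [/\ parseval_at b (Lam ++ X),
    forall xi l b', `|xi| <= rho -> l \in Lam -> (b <= b')%N ->
      1 - eta <= normc (mprod b b' (xi + l)) &
    forall xi l b', `|xi| <= rho -> l \in X -> (b <= b')%N ->
      eps / 2 <= normc (mprod b b' (xi + l))].
Proof.
move=> PL eta0 eps0 Hgood.
set M := `|rho| + \sum_(l <- Lam) `|l|.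
have ML l : l \in Lam -> `|rho| + `|l| <= M.
  by move=> lL; rewrite lerD2l (big_rem l)//= lerDl sumr_ge0.
have M0 : 0 <= M by rewrite addr_ge0// sumr_ge0.
(* The level is chosen so large that moving an argument by at most M changes
   every tail by at most e. *)
set e := Num.min eta (eps / 2).
have e0 : 0 < e by rewrite lt_min eta0 divr_gt0.
set c := 4 * pi * K * M / e.
have [b [nb Gb]] := Hgood (maxn a (Num.truncn c).+1).
have ab : (a <= b)%N by rewrite (leq_trans _ nb)// leq_maxl.
have cb : c <= (nprod 0 b)%:R.
  rewrite (le_trans (ltW (truncnS_gt c)))// ler_nat.
  rewrite (leq_trans (leq_maxr a _))// (leq_trans nb)//.
  by rewrite (leq_trans (ltnW (ltn_expl b (ltnSn 1))))// -{1}(subn0 b) nprod_ge_exp.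
have Pb0 := nprodR_gt0 R Ns2 0 b.
have small y : `|y| <= M -> 4 * pi * K * `|y| / (nprod 0 b)%:R <= e.
  move=> yM; rewrite ler_pdivrMr// [leRHS]mulrC -ler_pdivrMr// (le_trans _ cb)//.
  by rewrite ler_wpM2r ?invr_ge0 ?(ltW e0)// ler_wpM2l// !mulr_ge0 ?pi_ge0.
have [G [G0 PG]] := block_frequencies Ns2 D0 DB hL a (b - a).
rewrite subnKC// in PG.
have [t Ht] := choice Gb.
pose lam l (g : int) : R := l + (nprod 0 a)%:R * g%:~R.
pose sh y : R := y + (nprod 0 b)%:R * ((t (y / (nprod 0 b)%:R))%:~R / D%:R).
(* The frequencies of the block with g = 0 are the old ones, left unmoved. *)
exists b, [seq sh (lam l g) | l <- Lam, g <- rem 0 G]; split.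
- move=> xi; rewrite big_cat big_allpairs_dep /= -big_split/= -[RHS](PL xi).
  apply: eq_bigr => l _.
  rewrite -[RHS]mulr1 -[X in _ = _ * X](PG (xi + l)) [X in _ = _ * X](big_rem 0)//=.
  rewrite mulr0 addr0 mulrDr mulr_sumr; congr (_ + _).
    by rewrite -nsqM -mprod_cat.
  apply: eq_bigr => g _.
  rewrite /sh addrA (mprod_period Ns2 D0 DB) /lam addrA -nsqM (@mprod_cat _ _ _ a)//.
  by rewrite (mprod_period_int Ns2 D0 DB).
- move=> xi l b' xir lL bb'.
  apply: le_trans (mprod_near0 Ns2 K0 BK B0 _ _ _).
  rewrite lerD2l lerN2; apply: (@le_trans _ _ e); last by rewrite ge_min lexx.
  apply: small; rewrite (le_trans (ler_normD _ _))//.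
  by rewrite (le_trans _ (ML _ lL))// lerD2r (le_trans xir)// ler_norm.
- move=> xi l b' xir /allpairsP[[l0 g] /= [l0L gG ->]] bb'.
  set y := lam l0 g.
  have := Ht (y / (nprod 0 b)%:R) b' bb'.
  have -> : (nprod 0 b)%:R * (y / (nprod 0 b)%:R + (t (y / (nprod 0 b)%:R))%:~R / D%:R) = sh y.
    by rewrite mulrDr mulrCA mulfV ?mulr1// gt_eqF.
  move=> h1.
  have := mprod_lip Ns2 K0 BK b b' (sh y) (xi + sh y).
  have -> : sh y - (xi + sh y) = - xi by rewrite opprD addrC addrNK.
  rewrite normrN => h2.
  have h3 : 4 * pi * K * `|xi| / (nprod 0 b)%:R <= eps / 2.
    apply: (@le_trans _ _ e); last by rewrite ge_min lexx orbT.
    by apply: small; rewrite (le_trans xir)// (le_trans (ler_norm _))// lerDl sumr_ge0.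
  have h4 : normc (mprod b b' (sh y)) <= normc (mprod b b' (sh y) - mprod b b' (xi + sh y))
      + normc (mprod b b' (xi + sh y)).
    by rewrite -{1}(subrK (mprod b b' (xi + sh y)) (mprod b b' (sh y))) le_normcD.
  by lra.
Qed.

Section limit.
Variable f : R -> C.
Hypothesis f_lim : forall xi e, 0 < e -> exists k0, forall k, (k0 <= k)%N ->
  normc (f xi - mprod 0 k xi) < e.

(** Splitting a long product at level b, the tail is at least c in modulus. *)
Lemma limit_ge b c xi : (forall b', (b <= b')%N -> c <= normc (mprod b b' xi)) ->
  c * normc (mprod 0 b xi) <= normc (f xi).
Proof.
move=> cb; apply/ler_addgt0Pr => e e0.
have [k0 /(_ (maxn k0 b) (leq_maxl _ _))] := f_lim xi e0.
set k := maxn k0 b => fk.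
have bk : (b <= k)%N by rewrite leq_maxr.
have h : normc (mprod 0 k xi) <= normc (mprod 0 k xi - f xi) + normc (f xi).
  by rewrite -{1}(subrK (f xi) (mprod 0 k xi)) le_normcD.
rewrite normcB in h.
have : c * normc (mprod 0 b xi) <= normc (mprod 0 k xi).
  rewrite (@mprod_cat _ _ _ b 0 k)// Normc.normcM [leRHS]mulrC.
  by rewrite ler_wpM2r ?normc_ge0 ?cb.
by lra.
Qed.

Lemma limit_le b xi : normc (f xi) <= normc (mprod 0 b xi).
Proof.
apply/ler_addgt0Pr => e e0.
have [k0 /(_ (maxn k0 b) (leq_maxl _ _))] := f_lim xi e0.
set k := maxn k0 b => fk.
have bk : (b <= k)%N by rewrite leq_maxr.
have h : normc (f xi) <= normc (f xi - mprod 0 k xi) + normc (mprod 0 k xi).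
  by rewrite -{1}(subrK (mprod 0 k xi) (f xi)) le_normcD.
have : normc (mprod 0 k xi) <= normc (mprod 0 b xi).
  by rewrite (@mprod_cat _ _ _ b)// Normc.normcM ler_piMr ?normc_ge0 ?normc_mprod_le1.
by lra.
Qed.

(** Let S j be the Parseval sum of the limit transform f over the j-th set of
    frequencies. The extension step splits the Parseval identity of the finite
    convolution into a part A carried by the old frequencies, where f nearly
    equals the finite product, so that A is at most about S j, and a part 1 -
    A carried by the new ones, where the square of f is at least a constant
    times that of the finite product. If S j stayed below 1 - e, then 1 - A
    would stay above e/2 and S j would grow by a fixed amount at each step,
    which is absurd for a bounded sequence. *)
Lemma spectrum_exists eps : 0 < eps ->
  (forall n0, exists n, (n0 <= n)%N /\ good_level D n eps) ->
  exists Lam : nat -> seq R,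
  [/\ forall j, {subset Lam j <= Lam j.+1},
      forall j, uniq (Lam j),
      forall j l l', l \in Lam j -> l' \in Lam j -> l != l' -> f (l - l') = 0 &
      forall xi e, 0 < e -> exists j, 1 - e <= \sum_(l <- Lam j) nsq (f (xi + l))].
Proof.
move=> eps0 Hgood.
(* At step j the translations xi are bounded by j and the loss on the old
   frequencies is at most 1/(j+1): every xi is eventually covered, and the
   losses tend to 0. *)
pose step (j : nat) (s s' : nat * seq R) := exists X, [/\ s'.2 = s.2 ++ X,
    parseval_at s'.1 s'.2,
    forall xi l b', `|xi| <= j%:R -> l \in s.2 -> (s'.1 <= b')%N ->
      1 - j.+1%:R^-1 <= normc (mprod s'.1 b' (xi + l)) &
    forall xi l b', `|xi| <= j%:R -> l \in X -> (s'.1 <= b')%N ->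
      eps / 2 <= normc (mprod s'.1 b' (xi + l))].
have [F HF] : {F : nat * (nat * seq R) -> nat * seq R &
    forall p, parseval_at p.2.1 p.2.2 -> step p.1 p.2 (F p)}.
  apply: (@choice _ _ (fun p s' => parseval_at p.2.1 p.2.2 -> step p.1 p.2 s')).
  move=> [j [a Lam]] /=.
  have [PL|nPL] := pselect (parseval_at a Lam); last by exists (0, [::]).
  have j0 : 0 < j.+1%:R^-1 :> R by rewrite invr_gt0.
  have [b [X [h1 h2 h3]]] := parseval_extension j%:R PL j0 eps0 Hgood.
  by exists (b, Lam ++ X) => _; exists X.
pose st := fix st j := if j is j'.+1 then F (j', st j') else (0, [:: 0]) : nat * seq R.
have Pst j : parseval_at (st j).1 (st j).2.
  elim: j => [|j IH] /=.
    by move=> xi; rewrite big_seq1 mprod_nil nsq1.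
  by have [X [_ ? _ _]] := HF (j, st j) IH.
have stepP j : step j (st j) (st j.+1) by exact: (HF (j, st j) (Pst j)).
exists (fun j => (st j).2); split.
- by move=> j l lj; have [X [-> _ _ _]] := stepP j; rewrite mem_cat lj.
- by move=> j; have [] := parseval_at_orthogonal (Pst j).
- move=> j l l' lj l'j ll'; have [_ /(_ _ _ lj l'j ll') h] := parseval_at_orthogonal (Pst j).
  by apply: Normc.eq0_normc; apply/eqP; rewrite eq_le normc_ge0 andbT
    (le_trans (limit_le (st j).1 _))// h Normc.normc0.
move=> xi e e0; apply: contrapT => nj.
pose S j := \sum_(l <- (st j).2) nsq (f (xi + l)).
have Sle j : S j < 1 - e.
  by rewrite ltNge; apply/negP => h; apply: nj; exists j.
have S0 j : 0 <= S j by rewrite sumr_ge0// => *; exact: nsq_ge0.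
set c := (eps / 2) ^+ 2.
have c0 : 0 < c by rewrite exprn_gt0 ?divr_gt0.
pose j0 := (Num.truncn (`|xi| + 4 / e)).+1.
have big_j j : (j0 <= j)%N -> `|xi| <= j%:R /\ j.+1%:R^-1 <= e / 4.
  rewrite -(ler_nat R) => jj; have := truncnS_gt (`|xi| + 4 / e) => h.
  have h4 : 0 < 4 / e by rewrite divr_gt0.
  have jx := le_trans (ltW h) jj.
  split; first by rewrite (le_trans _ jx)// lerDl ltW.
  rewrite -[e / 4]invrK lef_pV2 ?posrE// ?invr_gt0 ?divr_gt0// invf_div.
  have := normr_ge0 xi; move: jx; rewrite -natr1; lra.
have incr j : (j0 <= j)%N -> S j + c * (e / 2) <= S j.+1.
  move=> /big_j[xij ej]; have [X [eX PX h1 h2]] := stepP j.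
  set b := (st j.+1).1 in PX h1 h2.
  set A := \sum_(l <- (st j).2) nsq (mprod 0 b (xi + l)).
  set A' := \sum_(l <- X) nsq (mprod 0 b (xi + l)).
  have AA' : A + A' = 1 by rewrite -(PX xi) eX big_cat.
  set eta := j.+1%:R^-1 in h1 ej.
  have eta1 : 0 <= 1 - eta.
    by rewrite subr_ge0 invf_le1// ler1n.
  have eta0 : 0 <= eta by rewrite invr_ge0.
  have SA : (1 - eta) ^+ 2 * A <= S j.
    rewrite mulr_sumr /S !big_seq; apply: ler_sum => l lj.
    rewrite -!normc_sqr -exprMn ler_pXn2r ?nnegrE ?mulr_ge0 ?normc_ge0//.
    by apply: limit_ge => b' bb'; exact: h1.
  have SA' : c * A' <= \sum_(l <- X) nsq (f (xi + l)).
    rewrite mulr_sumr !big_seq; apply: ler_sum => l lX.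
    rewrite -!normc_sqr -exprMn ler_pXn2r ?nnegrE ?mulr_ge0 ?normc_ge0 ?divr_ge0 ?(ltW eps0)//.
    by apply: limit_ge => b' bb'; exact: h2.
  have SS : S j.+1 = S j + \sum_(l <- X) nsq (f (xi + l)) by rewrite /S eX big_cat.
  have A'0 : 0 <= A' by rewrite sumr_ge0// => *; exact: nsq_ge0.
  have A0 : 0 <= A by rewrite sumr_ge0// => *; exact: nsq_ge0.
  have A1 : A <= 1 by lra.
  have : A - 2 * eta <= (1 - eta) ^+ 2 * A.
    rewrite -subr_ge0 (_ : _ - _ = eta ^+ 2 * A + 2 * eta * (1 - A)); last by ring.
    by rewrite addr_ge0// mulr_ge0 ?sqr_ge0// ?mulr_ge0// subr_ge0.
  move=> h.
  have A'e : e / 2 <= A' by have := Sle j; lra.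
  have : c * (e / 2) <= c * A' by rewrite ler_wpM2l// ltW.
  by rewrite SS; lra.
have grow k : k%:R * (c * (e / 2)) <= S (j0 + k)%N.
  elim: k => [|k IH]; first by rewrite mul0r.
  have := incr (j0 + k)%N (leq_addr _ _); rewrite addnS -[k.+1%:R]natr1 mulrDl mul1r.
  by lra.
have ce0 : 0 < c * (e / 2) by rewrite mulr_gt0// divr_gt0.
have := grow (Num.truncn (1 / (c * (e / 2)))).+1.
have := truncnS_gt (1 / (c * (e / 2))).
rewrite ltr_pdivrMr// => h h'; have := Sle (j0 + (Num.truncn (1 / (c * (e / 2)))).+1)%N.
by lra.
Qed.

End limit.
End spectrum_construction.

(** * Closed spans of exponentials in L^2 *)

Section L2_closure.
Context (R : realType) (nu : probability R R).
Local Open Scope complex_scope.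
Local Notation C := (R[i]).
Implicit Types (f g : R -> C) (s : seq (R * C)).

Lemma L2normsqE f : L2normsq nu f = (\int[nu]_x (nsq (f x))%:E)%E.
Proof. by rewrite /L2normsq; apply: eq_integral => x _; rewrite normc_sqr. Qed.

Lemma measurable_nsq f : cmeasurable_fun f ->
  measurable_fun [set: R] (fun x => (nsq (f x))%:E).
Proof.
case=> mr mi; apply/measurable_EFinP; rewrite /nsq.
by apply: measurable_funD; apply: measurable_funX.
Qed.

Lemma cmeasurableD f g : cmeasurable_fun f -> cmeasurable_fun g ->
  cmeasurable_fun (fun x => f x + g x).
Proof.
case=> fr fi [gr gi]; split.
  rewrite (_ : (fun x => _) = (fun x => complex.Re (f x) + complex.Re (g x))).
    exact: measurable_funD.
  by apply/funext => x; case: (f x) (g x) => [a b] [c d].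
rewrite (_ : (fun x => _) = (fun x => complex.Im (f x) + complex.Im (g x))).
  exact: measurable_funD.
by apply/funext => x; case: (f x) (g x) => [a b] [c d].
Qed.

Lemma cmeasurableM f g : cmeasurable_fun f -> cmeasurable_fun g ->
  cmeasurable_fun (fun x => f x * g x).
Proof.
case=> fr fi [gr gi]; split.
  rewrite (_ : (fun x => _) = (fun x => complex.Re (f x) * complex.Re (g x)
                                 - complex.Im (f x) * complex.Im (g x))).
    by apply: measurable_funB; exact: measurable_funM.
  by apply/funext => x; case: (f x) (g x) => [a b] [c d].
rewrite (_ : (fun x => _) = (fun x => complex.Re (f x) * complex.Im (g x)
                                 + complex.Im (f x) * complex.Re (g x))).
  by apply: measurable_funD; exact: measurable_funM.
by apply/funext => x; case: (f x) (g x) => [a b] [c d].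
Qed.

Lemma cmeasurable_cst (c : C) : cmeasurable_fun (fun _ : R => c).
Proof. by split; exact: measurable_cst. Qed.

Lemma cmeasurable_real (h : R -> R) : measurable_fun [set: R] h ->
  cmeasurable_fun (fun x => (h x)%:C).
Proof. by move=> mh; split => //=; exact: measurable_cst. Qed.

Lemma cmeasurable_expi t : cmeasurable_fun (fun x : R => expi (2 * pi * t * x)).
Proof.
split => /=.
  apply: (@measurableT_comp _ _ _ _ _ _ (@cos R)); last exact: measurable_funM.
  by apply: continuous_measurable_fun; exact: continuous_cos.
apply: (@measurableT_comp _ _ _ _ _ _ (@sin R)); last exact: measurable_funM.
by apply: continuous_measurable_fun; exact: continuous_sin.
Qed.

Lemma cmeasurable_sum (I : Type) (r : seq I) (F : I -> R -> C) :
  (forall i, cmeasurable_fun (F i)) -> cmeasurable_fun (fun x => \sum_(i <- r) F i x).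
Proof.
move=> mF; elim: r => [|i r IH].
  by under [fun x => _]funext do rewrite big_nil; exact: cmeasurable_cst.
by under [fun x => _]funext do rewrite big_cons; exact: cmeasurableD.
Qed.

Definition trig s : R -> C := fun x => \sum_(p <- s) p.2 * expi (2 * pi * p.1 * x).

Lemma cmeasurable_trig s : cmeasurable_fun (trig s).
Proof.
apply: cmeasurable_sum => p; apply: cmeasurableM; first exact: cmeasurable_cst.
exact: cmeasurable_expi.
Qed.

Lemma cmeasurableB f g : cmeasurable_fun f -> cmeasurable_fun g ->
  cmeasurable_fun (fun x => f x - g x).
Proof.
move=> mf mg; rewrite (_ : (fun x => _) = (fun x => f x + (-1) * g x)).
  by apply: cmeasurableD => //; apply: cmeasurableM => //; exact: cmeasurable_cst.
by apply/funext => x; rewrite mulN1r.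
Qed.

Lemma L2normsqD f g : cmeasurable_fun f -> cmeasurable_fun g ->
  (L2normsq nu (fun x => f x + g x)%R <= 2%:E * L2normsq nu f + 2%:E * L2normsq nu g)%E.
Proof.
move=> mf mg; rewrite !L2normsqE.
rewrite -!ge0_integralZl_EFin//; try (by move=> x _; rewrite lee_fin nsq_ge0);
  try exact: measurable_nsq.
rewrite -ge0_integralD//; last first.
- by apply: emeasurable_funM; [exact: measurable_cst|exact: measurable_nsq].
- by move=> x _; rewrite -EFinM lee_fin mulr_ge0 ?nsq_ge0.
- by apply: emeasurable_funM; [exact: measurable_cst|exact: measurable_nsq].
- by move=> x _; rewrite -EFinM lee_fin mulr_ge0 ?nsq_ge0.
apply: ge0_le_integral => //.
- by move=> x _; rewrite lee_fin nsq_ge0.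
- by apply: measurable_nsq; exact: cmeasurableD.
- by apply: emeasurable_funD; (apply: emeasurable_funM; [exact: measurable_cst|exact: measurable_nsq]).
- by move=> x _; rewrite -!EFinM -EFinD lee_fin nsqDle.
Qed.

Lemma L2normsqZ (c : C) f : cmeasurable_fun f ->
  L2normsq nu (fun x => c * f x) = ((nsq c)%:E * L2normsq nu f)%E.
Proof.
move=> mf; rewrite !L2normsqE -ge0_integralZl_EFin ?nsq_ge0//.
- by apply: eq_integral => x _; rewrite nsqM EFinM.
- by move=> x _; rewrite lee_fin nsq_ge0.
- exact: measurable_nsq.
Qed.

Variable D : set R.

(** The frequencies may be repeated in the list; they are collected only when
    the basis property is derived. *)
Definition in_closed_span f := forall e : R, 0 < e -> exists s,
  (forall p, p \in s -> D p.1) /\ (L2normsq nu (fun x => f x - trig s x)%R < e%:E)%E.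

Lemma in_closed_spanD f g : cmeasurable_fun f -> cmeasurable_fun g ->
  in_closed_span f -> in_closed_span g -> in_closed_span (fun x => f x + g x).
Proof.
move=> mf mg hf hg e e0.
have e4 : 0 < e / 4 by rewrite divr_gt0.
have [s [sD sf]] := hf _ e4; have [s' [s'D s'g]] := hg _ e4.
exists (s ++ s'); split; first by move=> p; rewrite mem_cat => /orP[/sD|/s'D].
rewrite (_ : (fun x => _) = (fun x => (f x - trig s x) + (g x - trig s' x))); last first.
  by apply/funext => x; rewrite /trig big_cat/=; ring.
apply: le_lt_trans (L2normsqD _ _) _; try by apply: cmeasurableB => //; exact: cmeasurable_trig.
rewrite (_ : e%:E = (2%:E * (e / 4)%:E + 2%:E * (e / 4)%:E)%E); last first.
  by rewrite -!EFinM -EFinD; congr (_%:E); field.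
by apply: lteD; rewrite lte_pmul2l.
Qed.

Lemma in_closed_spanZ (c : C) f : cmeasurable_fun f ->
  in_closed_span f -> in_closed_span (fun x => c * f x).
Proof.
move=> mf hf e e0.
have c0 : 0 < nsq c + 1 by rewrite ltr_wpDl ?nsq_ge0.
have [s [sD sf]] := hf (e / (nsq c + 1)) (divr_gt0 e0 c0).
exists [seq (p.1, c * p.2) | p <- s]; split.
  by move=> p /mapP[q qs ->]; exact: (sD q qs).
rewrite (_ : (fun x => _) = (fun x => c * (f x - trig s x))); last first.
  apply/funext => x; rewrite /trig big_map mulrBr mulr_sumr; congr (_ - _).
  by apply: eq_bigr => p _; rewrite mulrA.
rewrite L2normsqZ; last by apply: cmeasurableB => //; exact: cmeasurable_trig.
have [->|cn0] := eqVneq (nsq c) 0; first by rewrite mul0e lte_fin.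
have cp : 0 < nsq c by rewrite lt_neqAle eq_sym cn0 nsq_ge0.
apply: (@lt_le_trans _ _ ((nsq c)%:E * (e / (nsq c + 1))%:E)%E).
  by rewrite lte_pmul2l.
rewrite -EFinM lee_fin mulrCA ler_piMr ?(ltW e0)// ler_pdivrMr// mul1r.
by rewrite lerDl.
Qed.

(** A closed span is closed. *)
Lemma in_closed_span_lim f : cmeasurable_fun f ->
  (forall e : R, 0 < e -> exists g, [/\ cmeasurable_fun g, in_closed_span g &
     (L2normsq nu (fun x => f x - g x)%R < e%:E)%E]) -> in_closed_span f.
Proof.
move=> mf H e e0.
have e4 : 0 < e / 4 by rewrite divr_gt0.
have [g [mg hg fg]] := H _ e4; have [s [sD sg]] := hg _ e4.
exists s; split => //.
rewrite (_ : (fun x => _) = (fun x => (f x - g x) + (g x - trig s x))); last first.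
  by apply/funext => x; ring.
apply: le_lt_trans (L2normsqD _ _) _; try by apply: cmeasurableB => //; exact: cmeasurable_trig.
rewrite (_ : e%:E = (2%:E * (e / 4)%:E + 2%:E * (e / 4)%:E)%E); last first.
  by rewrite -!EFinM -EFinD; congr (_%:E); field.
by apply: lteD; rewrite lte_pmul2l.
Qed.

Lemma in_closed_span0 : in_closed_span (fun=> 0).
Proof.
move=> e e0; exists [::]; split => //.
rewrite L2normsqE integral0_eq ?lte_fin// => x _.
by rewrite /trig big_nil subrr nsq0.
Qed.

Lemma in_closed_span_sum (I : Type) (r : seq I) (F : I -> R -> C) :
  (forall i, cmeasurable_fun (F i)) -> (forall i, in_closed_span (F i)) ->
  in_closed_span (fun x => \sum_(i <- r) F i x).
Proof.
move=> mF hF; elim: r => [|i r IH].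
  by under [fun x => _]funext do rewrite big_nil; exact: in_closed_span0.
under [fun x => _]funext do rewrite big_cons.
by apply: in_closed_spanD => //; exact: cmeasurable_sum.
Qed.

(** Dominated convergence turns pointwise convergence into convergence in L^2. *)
Lemma in_closed_span_dominated (h : nat -> R -> R) (f G : R -> R) :
  (forall n, measurable_fun [set: R] (h n)) -> measurable_fun [set: R] f ->
  (forall n, in_closed_span (fun x => (h n x)%:C)) ->
  {ae nu, forall x, h n x @[n --> \oo] --> f x} ->
  nu.-integrable [set: R] (EFin \o G) ->
  (forall n x, (f x - h n x) ^+ 2 <= G x) ->
  in_closed_span (fun x => (f x)%:C).
Proof.
move=> mh mf hh hf iG hG; apply: in_closed_span_lim; first exact: cmeasurable_real.
have mfh n : measurable_fun [set: R] (fun x => ((f x - h n x) ^+ 2)%:E).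
  by apply/measurable_EFinP; apply: measurable_funX; exact: measurable_funB.
have [//|||//||_ _] := @dominated_convergence _ _ _ nu [set: R] measurableT
   (fun n x => ((f x - h n x) ^+ 2)%:E) (fun=> 0%E) (EFin \o G).
- exact: measurable_cst.
- apply: filterS hf => x hx _.
  have -> : (0 : \bar R) = ((f x - f x) ^+ 2)%:E by rewrite subrr expr0n.
  apply: cvg_EFin; first by near=> n.
  rewrite (_ : fine \o _ = (fun n => (f x - h n x) * (f x - h n x))); last first.
    by apply/funext.
  by rewrite expr2; apply: cvgM; (apply: cvgB; [exact: cvg_cst|exact: hx]).
- by apply/aeW => x n _; rewrite /= ger0_norm ?sqr_ge0// lee_fin hG.
rewrite integral0 => /fine_cvgP[hfin /cvgrPdist_lt hc] e e0.
have [n [fn]] := filter_ex (filterI hfin (hc _ e0)).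
rewrite sub0r normrN /= => hn.
exists (fun x => (h n x)%:C); split => //; first exact: cmeasurable_real.
have -> : L2normsq nu (fun x => (f x)%:C - (h n x)%:C)%R = (\int[nu]_x ((f x - h n x) ^+ 2)%:E)%E.
  by rewrite L2normsqE; apply: eq_integral => x _; rewrite /nsq /= subrr expr0n addr0.
rewrite /= in fn.
by rewrite -(fineK fn) lte_fin (le_lt_trans (ler_norm _)).
Unshelve. all: by end_near.
Qed.

End L2_closure.

(** * Trigonometric polynomials approximating a half-line *)

Section trig_polynomials.
Context (R : realType).
Local Open Scope complex_scope.
Local Notation C := (R[i]).

Definition is_trig (h : R -> C) := exists s, h = trig s.

Lemma is_trig_cst (c : C) : is_trig (fun=> c).
Proof.
exists [:: (0, c)]; apply/funext => x.
by rewrite /trig big_seq1 /= mulr0 mul0r expi0 mulr1.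
Qed.

Lemma is_trigD g h : is_trig g -> is_trig h -> is_trig (fun x => g x + h x).
Proof.
by move=> [s ->] [s' ->]; exists (s ++ s'); apply/funext => x; rewrite /trig big_cat.
Qed.

Lemma is_trigM g h : is_trig g -> is_trig h -> is_trig (fun x => g x * h x).
Proof.
move=> [s ->] [s' ->]; exists [seq (p.1 + q.1, p.2 * q.2) | p <- s, q <- s'].
apply/funext => x; rewrite /trig big_allpairs_dep/= big_distrlr/=.
apply: eq_bigr => p _; apply: eq_bigr => q _.
by rewrite mulrACA -expiD; congr (_ * expi _); ring.
Qed.

Lemma is_trigX g n : is_trig g -> is_trig (fun x => g x ^+ n).
Proof.
move=> tg; elim: n => [|n IH]; first by under [fun x => _]funext do rewrite expr0; exact: is_trig_cst.
by under [fun x => _]funext do rewrite exprS; exact: is_trigM.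
Qed.

(** The sine in exponential form, the phase being absorbed in the
    coefficients. *)
Lemma is_trig_sin (t a : R) : is_trig (fun x => (sin (2 * pi * t * (x - a)))%:C).
Proof.
exists [:: (t, expi (- (2 * pi * t * a)) * (0 +i* (- 2^-1)));
         (- t, expi (2 * pi * t * a) * (0 +i* 2^-1))].
apply/funext => x; rewrite /trig big_cons big_seq1.
rewrite [X in _ = X + _]mulrAC -[X in _ = X * _ + _]expiD [X in _ = _ + X]mulrAC -[X in _ = _ + X * _]expiD /=.
have -> : - (2 * pi * t * a) + 2 * pi * t * x = 2 * pi * t * (x - a) by ring.
have -> : 2 * pi * t * a + 2 * pi * - t * x = - (2 * pi * t * (x - a)) by ring.
rewrite expiN; set u := 2 * pi * t * (x - a).
by apply/eqP; rewrite eq_complex /expi /conjc /=; apply/andP; split; apply/eqP; field.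
Qed.

(** On [0, 1] these polynomials converge to the indicator of [0, 1/2[: by the
    two Bernoulli inequalities, the value is close to 1 when n (2 t)^n is
    small and at most about 1 / (n (2 t)^n). *)
Definition step_poly (n : nat) (t : R) : R := (1 - t ^+ n) ^+ (n * 2 ^ n).

Lemma bernoulli_ge (u : R) m : 0 <= u <= 1 -> 1 - m%:R * u <= (1 - u) ^+ m.
Proof.
move=> /andP[u0 u1]; elim: m => [|m IH]; first by rewrite mul0r subr0 expr0.
rewrite exprS -[m.+1%:R]natr1.
apply: (@le_trans _ _ ((1 - u) * (1 - m%:R * u))).
  rewrite -subr_ge0 (_ : _ - _ = m%:R * u ^+ 2); last by ring.
  by rewrite mulr_ge0 ?sqr_ge0.
by rewrite ler_wpM2l// subr_ge0.
Qed.

Lemma bernoulli_le (u : R) m : 0 <= u <= 1 -> (1 - u) ^+ m * (1 + m%:R * u) <= 1.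
Proof.
move=> /andP[u0 u1]; elim: m => [|m IH]; first by rewrite mul0r addr0 expr0 mul1r.
apply: le_trans IH; rewrite exprSr -mulrA ler_wpM2l ?exprn_ge0 ?subr_ge0//.
rewrite -[m.+1%:R]natr1 -subr_ge0.
rewrite (_ : _ - _ = (m%:R + 1) * u ^+ 2); last by ring.
by rewrite mulr_ge0 ?sqr_ge0// addr_ge0.
Qed.

Lemma step_poly_itv n (t : R) : 0 <= t <= 1 -> 0 <= step_poly n t <= 1.
Proof.
move=> /andP[t0 t1].
have tn : 0 <= t ^+ n <= 1 by rewrite exprn_ge0// exprn_ile1.
move/andP: tn => [a b].
by rewrite exprn_ge0 ?subr_ge0//= exprn_ile1 ?subr_ge0// gerBl.
Qed.

Lemma natmulX_le (s : R) n : 0 <= s < 1 -> n%:R * s ^+ n <= (1 - s)^-1.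
Proof.
move=> /andP[s0 s1]; have s1' : 0 < 1 - s by rewrite subr_gt0.
rewrite -[leRHS]mul1r ler_pdivlMr//.
have : n%:R * s ^+ n <= \sum_(i < n) s ^+ i.
  rewrite -[n in n%:R]card_ord mulr_natl -sumr_const; apply: ler_sum => i _.
  by rewrite ler_wiXn2l ?(ltW s1)// ltnW.
move=> h; apply: (@le_trans _ _ ((\sum_(i < n) s ^+ i) * (1 - s))).
  by rewrite ler_wpM2r// ltW.
rewrite mulrC -opprB mulNr -subrX1 opprB gerBl exprn_ge0//.
Qed.

Lemma step_poly_cvg1 (t : R) : 0 <= t < 2^-1 -> step_poly n t @[n --> \oo] --> (1 : R).
Proof.
move=> /andP[t0 t2].
have r0 : 0 <= 2 * t by rewrite mulr_ge0.
have r1 : 2 * t < 1 by lra.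
set s := Num.sqrt (2 * t).
have s0 : 0 <= s by rewrite sqrtr_ge0.
have s1 : s < 1 by rewrite -sqrtr1 ltr_sqrt.
have ss : s ^+ 2 = 2 * t by rewrite sqr_sqrtr.
have lim0 : 1 - (1 - s)^-1 * s ^+ n @[n --> \oo] --> (1 : R).
  rewrite -[X in _ --> X]subr0; apply: cvgB; first exact: cvg_cst.
  rewrite -(mulr0 (1 - s)^-1); apply: cvgM; first exact: cvg_cst.
  by apply: cvg_expr; rewrite ger0_norm.
have lim1 : (fun _ : nat => 1) @ \oo --> (1 : R) by exact: cvg_cst.
apply: (squeeze_cvgr _ lim0 lim1); near=> n.
have t1 : 0 <= t <= 1 by rewrite t0/=; lra.
have /andP[_ ->] := step_poly_itv n t1; rewrite andbT.
have tn : 0 <= t ^+ n <= 1 by rewrite exprn_ge0// exprn_ile1//; lra.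
apply: le_trans (bernoulli_ge _ tn); rewrite lerD2l lerN2.
rewrite natrM natrX -mulrA -exprMn -ss -exprM mulnC exprM expr2 mulrA.
by rewrite ler_wpM2r ?exprn_ge0// natmulX_le// s0.
Unshelve. all: by end_near.
Qed.

Lemma step_poly_cvg0 (t : R) : 2^-1 <= t <= 1 -> step_poly n t @[n --> \oo] --> (0 : R).
Proof.
move=> /andP[t2 t1]; have t0 : 0 <= t by apply: le_trans t2; rewrite invr_ge0.
have t01 : 0 <= t <= 1 by rewrite t0.
have lim0 : n.+1%:R^-1 @[n --> \oo] --> (0 : R) by exact: cvg_harmonic.
apply: (squeeze_cvgr _ (cvg_cst 0) lim0); near=> n.
have /andP[-> _] := step_poly_itv n t01; rewrite /=.
have tn : 0 <= t ^+ n <= 1 by rewrite exprn_ge0// exprn_ile1.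
have /= := bernoulli_le (n * 2 ^ n) tn; rewrite -/(step_poly n t).
move=> h; rewrite -[leRHS]mul1r ler_pdivlMr//; apply: le_trans h.
rewrite ler_wpM2l//; first by have /andP[] := step_poly_itv n t01.
rewrite -natr1 addrC lerD2l natrM natrX -mulrA -exprMn ler_peMr//.
by rewrite exprn_ege1//; lra.
Unshelve. all: by end_near.
Qed.

End trig_polynomials.

(** * Density of exponentials for measures with bounded support *)

Section L2_density.
Context (R : realType) (nu : probability R R) (D : set R) (K : R).
Local Open Scope complex_scope.
Local Notation C := (R[i]).
Hypothesis exps_in : forall t : R, in_closed_span nu D (fun x => expi (2 * pi * t * x)).
Hypothesis nu_supp : nu [set x | K < `|x|] = 0%E.
Hypothesis K0 : 0 <= K.

Lemma in_closed_span_trig s : in_closed_span nu D (trig s).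
Proof.
apply: in_closed_span_sum => p.
  by apply: cmeasurableM; [exact: cmeasurable_cst|exact: cmeasurable_expi].
by apply: in_closed_spanZ; [exact: cmeasurable_expi|exact: exps_in].
Qed.

Lemma measurable_gtnorm : measurable [set x : R | K < `|x|].
Proof.
rewrite (_ : [set x | _] = [set x : R | K < x] `|` [set x : R | x < - K]).
  apply: measurableU.
    rewrite (_ : [set x | _] = `]K, +oo[%classic) //.
    by apply/seteqP; split => x /=; rewrite in_itv/= andbT.
  by rewrite (_ : [set x | _] = `]-oo, (- K)[%classic).
apply/seteqP; split => x /=.
  by rewrite ltNge ler_norml negb_and -!ltNge => /orP[|]; [right|left].
by move=> H; rewrite ltNge ler_norml negb_and -!ltNge; case: H => ->; rewrite ?orbT.
Qed.

Lemma ae_norm_le : {ae nu, forall x, `|x| <= K}.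
Proof.
exists [set x | K < `|x|]; split => //; first exact: measurable_gtnorm.
by move=> x /= /negP; rewrite -ltNge.
Qed.

Lemma integrable_cst1 : nu.-integrable [set: R] (EFin \o (fun _ : R => 1)).
Proof.
apply/integrableP; split; first exact: measurable_cst.
under eq_integral do rewrite /= normr1.
by rewrite integral_cst// mul1e -ge0_fin_numE// fin_num_measure.
Qed.

(** On the support, a sine of small frequency xi centred at a has the sign of
    x - a, so a polynomial in the sine which approximates a step is a
    trigonometric polynomial approximating the half-line. *)
Lemma in_closed_span_ray (a : R) : in_closed_span nu D (fun x => (\1_(`]-oo, a[%classic) x)%:C).
Proof.
(* The frequency keeps the argument of the sine strictly between -pi and pi
   for |x| <= K. *)
pose xi : R := (4 * (K + `|a| + 1))^-1.
have q0 : 0 < K + `|a| + 1 by rewrite ltr_wpDl// addr_ge0.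
have xi0 : 0 < xi by rewrite invr_gt0 mulr_gt0.
pose g (x : R) : R := (1 + sin (2 * pi * xi * (x - a))) / 2.
pose h n (x : R) : R := step_poly n (g x).
have g01 x : 0 <= g x <= 1.
  have := sin_geN1 (2 * pi * xi * (x - a)); have := sin_le1 (2 * pi * xi * (x - a)).
  by rewrite /g; lra.
have th n : is_trig (fun x => (h n x)%:C).
  have -> : (fun x => (h n x)%:C) =
      (fun x => (1 + (- 1) * (2^-1 * (1 + (sin (2 * pi * xi * (x - a)))%:C)) ^+ n) ^+ (n * 2 ^ n)).
    apply/funext => x; rewrite /h /step_poly /g !(rmorphXn, rmorphB, rmorphM, rmorphD, rmorph1, fmorphV)/=.
    by rewrite mulN1r [_ / _]mulrC.
  apply: is_trigX; apply: is_trigD; first exact: is_trig_cst.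
  apply: is_trigM; first exact: is_trig_cst.
  apply: is_trigX; apply: is_trigM; first exact: is_trig_cst.
  apply: is_trigD; first exact: is_trig_cst.
  exact: is_trig_sin.
apply: (@in_closed_span_dominated _ _ _ h (\1_(`]-oo, a[%classic)) (fun=> 1)).
- move=> n; have [s hs] := th n; have [+ _] := cmeasurable_trig s.
  by rewrite -hs.
- exact: measurable_indic.
- by move=> n; have [s ->] := th n; exact: in_closed_span_trig.
- apply: filterS ae_norm_le => x xK.
  have small : `|2 * xi * (x - a)| < 1.
    rewrite !normrM (gtr0_norm xi0) ger0_norm// /xi.
    rewrite -mulrA -[ltRHS](mulfV (lt0r_neq0 q0)).
    rewrite invfM !mulrA mulrAC [ltRHS]mulrC.
    apply: (@le_lt_trans _ _ (2 / 4 * (K + `|a| + 1) / (K + `|a| + 1))).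
      rewrite ler_wpM2r ?invr_ge0 ?(ltW q0)// ler_wpM2l//.
      by rewrite (le_trans (ler_normB _ _))// -addrA lerD// lerDl.
    by rewrite mulfK ?gt_eqF// mulVf ?gt_eqF//; lra.
  set u := 2 * pi * xi * (x - a).
  have uE : u = pi * (2 * xi * (x - a)) by rewrite /u; ring.
  have p0 := pi_gt0 R.
  rewrite indicE; case: (ltP x a) => xa.
    rewrite mem_set//=.
    apply: step_poly_cvg1; have /andP[-> _] := g01 x; rewrite /g -/u /=.
    have : sin u < 0.
      rewrite -oppr_gt0 -sinN sin_gt0_pi// uE.
      have : 0 < - (2 * xi * (x - a)).
        by rewrite -mulrN mulr_gt0 ?opprB ?subr_gt0// mulr_gt0.
      move: small; rewrite ltr_norml => /andP[s1 s2] s3.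
      rewrite -mulrN mulr_gt0//= -[ltRHS]mulr1 ltr_pM2l//; lra.
    by lra.
  rewrite memNset/=; last by rewrite /= in_itv/= ltNge xa.
  apply: step_poly_cvg0; have /andP[_ ->] := g01 x; rewrite /g -/u andbT.
  have : 0 <= sin u.
    apply: sin_ge0_pi; rewrite uE.
    have : 0 <= 2 * xi * (x - a).
      by rewrite mulr_ge0 ?subr_ge0// mulr_ge0// ltW.
    move: small; rewrite ltr_norml => /andP[s1 s2] s3.
    apply/andP; split; first by rewrite mulr_ge0// ltW.
    by rewrite -[leRHS]mulr1 ler_pM2l// ltW.
  by lra.
- exact: integrable_cst1.
- move=> n x; have /andP[h0 h1] := step_poly_itv n (g01 x); rewrite -/(h n x) in h0 h1.
  rewrite indicE; case: (_ \in _) => /=.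
    by rewrite exprn_ile1 ?subr_ge0// gerBl.
  by rewrite sub0r sqrrN exprn_ile1.
Qed.

(** Half-lines generate the Borel sets, and the sets whose indicator lies in
    the closed span form a Dynkin system. *)
Lemma in_closed_span_indic (A : set R) : measurable A ->
  in_closed_span nu D (fun x => (\1_A x)%:C).
Proof.
have mE : @measurable _ (measurableTypeR R) = <<s (@RGenInftyO.G R) >> := RGenInftyO.measurableE R.
pose P (A : set R) := measurable A /\ in_closed_span nu D (fun x => (\1_A x)%:C).
move=> mA; suff [] : P A by [].
have {mA} : <<s (@RGenInftyO.G R) >> A by rewrite -mE.
move: A; apply: (dynkin_induction mE) => //.
- move=> _ _ [a ->] [b ->]; exists (Num.min a b).
  apply/seteqP; split => x /=; rewrite !in_itv/= lt_min; first by case=> -> ->.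
  by move/andP.
- split; first exact: measurableT.
  rewrite (_ : (fun x => _) = trig [:: (0, 1)]); first exact: in_closed_span_trig.
  apply/funext => x; rewrite indicT /trig big_seq1 /= mulr0 mul0r expi0 mulr1//.
- by move=> _ [a ->]; split; [exact: measurable_itv|exact: in_closed_span_ray].
- move=> S mS [_ PS]; split; first exact: measurableC.
  rewrite (_ : (fun x => _) = (fun x => trig [:: (0, 1)] x + (- 1) * (\1_S x)%:C)); last first.
    apply/funext => x; rewrite indicC /trig big_seq1 /= mulr0 mul0r expi0 mulr1.
    rewrite indicE; case: (x \in S); rewrite /= mulN1r ?subrr ?subr0//.
  apply: in_closed_spanD; first exact: cmeasurable_trig.
  + apply: cmeasurableM; first exact: cmeasurable_cst.
    by apply: cmeasurable_real; exact: measurable_indic.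
  + exact: in_closed_span_trig.
  + by apply: in_closed_spanZ => //; apply: cmeasurable_real; exact: measurable_indic.
move=> F mF tF PF; split; first exact: bigcupT_measurable.
have mFR i : measurable (F i : set R) := mF i.
pose h n (x : R) : R := \sum_(i < n) \1_(F i) x.
have hE n x : h n x = \1_(\bigcup_(i < n) F i) x.
  have [[k kn Fk]|nF] := pselect ((\bigcup_(i < n) F i) x).
    rewrite /h (bigD1 (Ordinal kn))//= !indicE !mem_set//; last by exists k.
    rewrite big1 ?addr0// => i ik; rewrite indicE memNset// => Fi.
    move/negP: ik; apply; apply/eqP/val_inj => /=.
    by apply: tF => //; exists x.
  rewrite indicE memNset// /h big1// => i _; rewrite indicE memNset// => Fi.
  by apply: nF; exists i => /=.
apply: (@in_closed_span_dominated _ _ _ h _ (fun=> 1)).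
- move=> n; apply: measurable_sum => i.
  by have mFi := mFR i; apply: measurable_indic.
- by apply: measurable_indic; exact: bigcupT_measurable.
- move=> n; rewrite (_ : (fun x => _) = (fun x => \sum_(i < n) (\1_(F i) x)%:C)).
    apply: in_closed_span_sum => i.
      by apply: cmeasurable_real; have mFi := mFR i; apply: measurable_indic.
    by have [] := PF i.
  by apply/funext => x; rewrite rmorph_sum.
- apply: aeW => x; have [[k _ Fk]|nF] := pselect ((\bigcup_k F k) x).
    rewrite indicE mem_set; last by exists k.
    apply: cvg_near_cst; exists k.+1 => // n /= kn.
    by rewrite hE indicE mem_set//; exists k.
  rewrite indicE memNset//; apply: cvg_near_cst; exists 0 => // n _.
  by rewrite hE indicE memNset// => -[k _ Fk]; apply: nF; exists k.
- exact: integrable_cst1.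
- move=> n x; rewrite hE !indicE; case: (_ \in _); case: (_ \in _) => /=;
  by rewrite ?subrr ?subr0 ?sub0r ?sqrrN ?expr0n ?expr1n.
Qed.


Import HBNNSimple.

(** Monotone approximation by simple functions, dominated by the square of f. *)
Lemma in_closed_span_nneg (f : R -> R) : measurable_fun [set: R] f ->
  (forall x, 0 <= f x) -> nu.-integrable [set: R] (EFin \o (fun x => f x ^+ 2)) ->
  in_closed_span nu D (fun x => (f x)%:C).
Proof.
move=> mf f0 if2.
have mfE : measurable_fun [set: R] (EFin \o f) by exact/measurable_EFinP.
pose h := nnsfun_approx measurableT mfE.
pose g n (x : R) : R := h n x.
apply: (@in_closed_span_dominated _ _ _ g f (fun x => f x ^+ 2)) => //.
- move=> n; rewrite (_ : (fun x => _) =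
    (fun x => \sum_(y <- fset_set (range (h n))) y%:C * (\1_(h n @^-1` [set y]) x)%:C)); last first.
    apply/funext => x; rewrite /g (fimfunE (h n) x) fsbig_finite//= rmorph_sum/=.
    by apply: eq_bigr => y _; rewrite rmorphM.
  apply: in_closed_span_sum => y.
    apply: cmeasurableM; first exact: cmeasurable_cst.
    by apply: cmeasurable_real; exact: measurable_indic.
  apply: in_closed_spanZ; first by apply: cmeasurable_real; exact: measurable_indic.
  exact: in_closed_span_indic.
- apply: aeW => x.
  have := @cvg_nnsfun_approx _ _ _ _ measurableT _ mfE _ x I.
  move=> /(_ (fun x _ => f0 x)) /fine_cvgP[_]; exact.
- move=> n x.
  have hf : g n x <= f x.
    have := @le_approx _ _ _ [set: R] (EFin \o f) n x (fun x _ => f0 x) I.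
    by rewrite /g /h nnsfun_approxE lee_fin.
  by rewrite ler_sqr ?nnegrE ?subr_ge0// gerBl.
Qed.

Lemma in_closed_span_real (f : R -> R) : measurable_fun [set: R] f ->
  nu.-integrable [set: R] (EFin \o (fun x => f x ^+ 2)) ->
  in_closed_span nu D (fun x => (f x)%:C).
Proof.
move=> mf if2.
have part (g : R -> R) : measurable_fun [set: R] g -> (forall x, 0 <= g x) ->
    (forall x, g x <= `|f x|) -> in_closed_span nu D (fun x => (g x)%:C).
  move=> mg g0 gf; apply: in_closed_span_nneg => //.
  apply: (le_integrable measurableT _ _ if2) => /=.
    by apply/measurable_EFinP; exact: measurable_funX.
  move=> x _; rewrite lee_fin !normrX ler_pXn2r ?nnegrE//.
  by rewrite ger0_norm.
pose fp x := Num.max (f x) 0; pose fn x := Num.max (- f x) 0.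
have mfp : measurable_fun [set: R] fp.
  by apply: measurable_maxr => //; exact: measurable_cst.
have mfn : measurable_fun [set: R] fn.
  by apply: measurable_maxr; [exact: measurableT_comp|exact: measurable_cst].
rewrite (_ : (fun x => _) = (fun x => (fp x)%:C + (- 1) * (fn x)%:C)); last first.
  apply/funext => x; rewrite mulN1r -rmorphB /fp /fn /=; congr (_%:C).
  by rewrite /Num.max; do 2 case: ifP; lra.
apply: in_closed_spanD; first exact: cmeasurable_real.
- apply: cmeasurableM; first exact: cmeasurable_cst.
  exact: cmeasurable_real.
- apply: part => // x; first by rewrite /fp le_max lexx orbT.
  by rewrite /fp ge_max ler_norm normr_ge0.
- apply: in_closed_spanZ; first exact: cmeasurable_real.
  apply: part => // x; first by rewrite /fn le_max lexx orbT.
  by rewrite /fn ge_max -normrN ler_norm normr_ge0.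
Qed.

Theorem in_closed_span_L2 (f : R -> C) : in_L2 nu f -> in_closed_span nu D f.
Proof.
move=> [[mr mi] f2].
have i2 : nu.-integrable [set: R] (fun x => (nsq (f x))%:E).
  apply/integrableP; split; first exact: measurable_nsq.
  rewrite L2normsqE in f2; apply: le_lt_trans f2.
  by rewrite le_eqVlt; apply/orP; left; apply/eqP/eq_integral => x _;
    rewrite gee0_abs// lee_fin nsq_ge0.
rewrite (_ : f = (fun x => (complex.Re (f x))%:C + 'i * (complex.Im (f x))%:C)); last first.
  by apply/funext => x; exact: complexE.
have part (g : R -> R) : measurable_fun [set: R] g -> (forall x, g x ^+ 2 <= nsq (f x)) ->
    in_closed_span nu D (fun x => (g x)%:C).
  move=> mg gf; apply: in_closed_span_real => //.
  apply: (le_integrable measurableT _ _ i2) => /=.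
    by apply/measurable_EFinP; exact: measurable_funX.
  by move=> x _; rewrite lee_fin !ger0_norm ?sqr_ge0 ?nsq_ge0.
apply: in_closed_spanD.
- exact: cmeasurable_real.
- by apply: cmeasurableM; [exact: cmeasurable_cst|exact: cmeasurable_real].
- by apply: part => // x; rewrite /nsq lerDl sqr_ge0.
- apply: in_closed_spanZ; first exact: cmeasurable_real.
  by apply: part => // x; rewrite /nsq lerDr sqr_ge0.
Qed.

End L2_density.

(** * A Parseval criterion for spectral measures *)

Section spectral_criterion.
Context (R : realType) (nu : probability R R).
Local Open Scope complex_scope.
Local Notation C := (R[i]).

(** The sign convention is that of the masks: no minus sign in the exponent. *)
Definition ft (t : R) : C := cintegral nu (fun x => expi (2 * pi * t * x)).

Definition cintegrable (f : R -> C) :=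
  nu.-integrable [set: R] (EFin \o (fun x => complex.Re (f x))) /\
  nu.-integrable [set: R] (EFin \o (fun x => complex.Im (f x))).

Lemma integrable_of_le (f : R -> R) (M : R) : measurable_fun [set: R] f ->
  (forall x, `|f x| <= M) -> nu.-integrable [set: R] (EFin \o f).
Proof.
move=> mf fM; apply: measurable_bounded_integrable => //.
  by rewrite -ge0_fin_numE// fin_num_measure.
by exists M; split; [exact: num_real|move=> y My x _ /=; rewrite (le_trans (fM x))// ltW].
Qed.

Lemma cintegrable_expi t : cintegrable (fun x => expi (2 * pi * t * x)).
Proof.
have [mr mi] := @cmeasurable_expi R t.
split; apply: (@integrable_of_le _ 1) => // x /=.
  by rewrite ler_norml cos_geN1 cos_le1.
by rewrite ler_norml sin_geN1 sin_le1.
Qed.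

Lemma integrableD_real (f g : R -> R) : nu.-integrable [set: R] (EFin \o f) ->
  nu.-integrable [set: R] (EFin \o g) ->
  nu.-integrable [set: R] (EFin \o (fun x => f x + g x)).
Proof. by move=> fi gi; have := integrableD measurableT fi gi. Qed.

Lemma integrableZ_real k (f : R -> R) : nu.-integrable [set: R] (EFin \o f) ->
  nu.-integrable [set: R] (EFin \o (fun x => k * f x)).
Proof. by move=> fi; have := integrableZl measurableT k fi. Qed.

Lemma cintegralD f g : cintegrable f -> cintegrable g ->
  cintegral nu (fun x => f x + g x) = cintegral nu f + cintegral nu g /\
  cintegrable (fun x => f x + g x).
Proof.
move=> [fr fi] [gr gi].
have eR : (fun x => complex.Re (f x + g x)) = (fun x => complex.Re (f x) + complex.Re (g x)).
  by apply/funext => x; case: (f x) (g x) => [a b] [c d].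
have eI : (fun x => complex.Im (f x + g x)) = (fun x => complex.Im (f x) + complex.Im (g x)).
  by apply/funext => x; case: (f x) (g x) => [a b] [c d].
split; last by rewrite /cintegrable eR eI; split; exact: integrableD_real.
by rewrite /cintegral eR eI !RintegralD//.
Qed.

Lemma cintegralZ (c : C) f : cintegrable f ->
  cintegral nu (fun x => c * f x) = c * cintegral nu f /\
  cintegrable (fun x => c * f x).
Proof.
move=> [fr fi]; case: c => u v.
have eR : (fun x => complex.Re ((u +i* v) * f x)) = (fun x => u * complex.Re (f x) + (- v) * complex.Im (f x)).
  by apply/funext => x; case: (f x) => [a b]; rewrite /= mulNr.
have eI : (fun x => complex.Im ((u +i* v) * f x)) = (fun x => u * complex.Im (f x) + v * complex.Re (f x)).
  by apply/funext => x; case: (f x) => [a b].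
split; last by rewrite /cintegrable eR eI; split; apply: integrableD_real; exact: integrableZ_real.
rewrite /cintegral eR eI; rewrite !RintegralD ?RintegralZl//; try exact: integrableZ_real.
by apply/eqP; rewrite eq_complex /= mulNr !eqxx.
Qed.

Lemma cintegral_trig s :
  cintegral nu (trig s) = \sum_(p <- s) p.2 * ft p.1 /\ cintegrable (trig s).
Proof.
elim: s => [|p s [IH1 IH2]].
  rewrite /trig; under [fun x => _]funext do rewrite big_nil.
  rewrite big_nil /cintegral /cintegrable /= /Rintegral integral0; split=> //.
  by split; exact: integrable0.
have -> : trig (p :: s) = (fun x => p.2 * expi (2 * pi * p.1 * x) + trig s x).
  by apply/funext => x; rewrite /trig big_cons.
have [e1 i1] := cintegralZ p.2 (cintegrable_expi p.1).
have [e2 i2] := cintegralD i1 IH2.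
by rewrite big_cons e2 e1 IH1.
Qed.

Lemma ft0 : ft 0 = 1.
Proof.
rewrite /ft (_ : (fun x => _) = (fun=> 1)); last first.
  by apply/funext => x; rewrite mulr0 mul0r expi0.
rewrite /cintegral /= /Rintegral integral0 integral_cst// mul1e.
rewrite -[RHS]/(1 +i* 0); congr (_ +i* _).
exact: (congr1 fine (@probability_setT _ _ _ nu)).
Qed.

Lemma ftN t : ft (- t) = conjc (ft t).
Proof.
rewrite /ft /cintegral /conjc /=; congr (_ +i* _).
  by congr fine; apply: eq_integral => x _; rewrite mulrN mulNr cosN.
rewrite -[RHS]mulN1r -RintegralZl//; last by have [] := cintegrable_expi t.
by congr fine; apply: eq_integral => x _; rewrite mulrN mulNr sinN mulN1r.
Qed.

(** The square of the modulus of a trigonometric polynomial is again one, with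
    the differences of frequencies. *)
Lemma L2normsq_trig s : L2normsq nu (trig s) =
  (complex.Re (\sum_(p <- s) \sum_(q <- s) p.2 * conjc q.2 * ft (p.1 - q.1)))%:E.
Proof.
pose s2 := [seq (p.1 - q.1, p.2 * conjc q.2) | p <- s, q <- s].
have e2 x : (nsq (trig s x))%:C = trig s2 x.
  rewrite nsqE /trig conjc_sum big_distrlr /= big_allpairs_dep /=.
  apply: eq_bigr => p _; apply: eq_bigr => q _.
  by rewrite conjcM -expiN mulrACA -expiD; congr (_ * expi _); ring.
have [e3 [i3 _]] := cintegral_trig s2.
have -> : \sum_(p <- s) \sum_(q <- s) p.2 * conjc q.2 * ft (p.1 - q.1) = cintegral nu (trig s2).
  by rewrite e3 big_allpairs_dep.
have i4 : nu.-integrable [set: R] (EFin \o (fun x => nsq (trig s x))).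
  rewrite (_ : EFin \o _ = EFin \o (fun x => complex.Re (trig s2 x)))//.
  by apply/funext => x; rewrite /= -e2.
rewrite L2normsqE /= -[LHS]fineK; last exact: (integrable_fin_num measurableT i4).
by congr (_%:E); rewrite /Rintegral; congr fine; apply: eq_integral => x _; rewrite -e2.
Qed.

(** Equal frequencies are merged, as a family indexed by a set of frequencies
    requires. *)
Lemma trig_collect (D : set R) s : (forall p, p \in s -> D p.1) ->
  exists (u : seq R) (c : R -> C), (forall i, i \in u -> D i) /\
    trig s = (fun x => \sum_(i <- u) c i * expi (2 * pi * i * x)).
Proof.
move=> sD; exists (undup [seq p.1 | p <- s]), (fun i => \sum_(p <- s | p.1 == i) p.2); split.
  by move=> i; rewrite mem_undup => /mapP[p /sD Dp ->].
apply/funext => x; rewrite /trig.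
under [RHS]eq_bigr do rewrite mulr_suml.
rewrite (exchange_big_dep xpredT)//= !big_seq; apply: eq_bigr => p ps.
rewrite -big_filter (_ : [seq _ <- _ | _] = [:: p.1]) ?big_seq1//.
have pu : p.1 \in undup [seq q.1 | q <- s] by rewrite mem_undup map_f.
by rewrite (eq_filter (a2 := pred1 p.1)) ?filter_pred1_uniq ?undup_uniq// => i; rewrite /= eq_sym.
Qed.

Variable K : R.
Hypothesis K0 : 0 <= K.
Hypothesis nu_supp : nu [set x | K < `|x|] = 0%E.

(** By orthonormality, the squared distance of the exponential of frequency t
    to the span of a finite subfamily is 1 minus its Parseval sum at - t.
    Hence every exponential lies in the closed span of the family, and
    exponentials are total in L^2 because nu has bounded support. *)
Theorem spectral_of_parseval (Lam : nat -> seq R) :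
  (forall j, {subset Lam j <= Lam j.+1}) -> (forall j, uniq (Lam j)) ->
  (forall j l l', l \in Lam j -> l' \in Lam j -> l != l' -> ft (l - l') = 0) ->
  (forall xi e, 0 < e -> exists j, 1 - e <= \sum_(l <- Lam j) nsq (ft (xi + l))) ->
  spectral_measure nu.
Proof.
move=> sub uL orth dens; split; first exact: probability_setT.
pose D : set R := [set l | exists j, l \in Lam j].
have mono i j : (i <= j)%N -> {subset Lam i <= Lam j}.
  move=> /subnK <-; elim: (j - i)%N => [|k IH]; first by move=> x.
  by move=> x /IH; rewrite addSn; exact: sub.
have orth' l l' : D l -> D l' -> ft (l - l') = (l == l')%:R.
  move=> [i li] [j lj]; have [<-|ll'] := eqVneq l l'; first by rewrite subrr ft0.
  by apply: (orth (maxn i j)) => //; [exact: (mono i _ (leq_maxl _ _))|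
    exact: (mono j _ (leq_maxr _ _))].
exists D; split.
- move=> i _; split; first exact: cmeasurable_expi.
  rewrite L2normsqE; under eq_integral do rewrite nsq_expi.
  by rewrite integral_cst// mul1e -ge0_fin_numE// fin_num_measure.
- move=> i j Di Dj; rewrite -(orth' _ _ Di Dj) /L2dot /ft; congr cintegral.
  apply/funext => x; rewrite -?conjCE ?conjCE -expiN -expiD; congr expi; ring.
move=> f fL2 e e0.
have exps_in t : in_closed_span nu D (fun x => expi (2 * pi * t * x)).
  move=> d d0; have d2 : 0 < d / 2 by rewrite divr_gt0.
  have [j Hj] := dens (- t) (d / 2) d2.
  exists [seq (l, ft (t - l)) | l <- Lam j]; split.
    by move=> p /mapP[l lj ->]; exists j.
  pose T := [seq (l, - ft (t - l)) | l <- Lam j].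
  have -> : (fun x => expi (2 * pi * t * x) - trig [seq (l, ft (t - l)) | l <- Lam j] x)
     = trig ((t, 1) :: T).
    apply/funext => x; rewrite /trig big_cons /= mul1r !big_map -sumrN.
    by congr (_ + _); apply: eq_bigr => l _; rewrite mulNr.
  rewrite L2normsq_trig big_cons big_cons /= subrr ft0 conjc1 !mulr1.
  rewrite (_ : _ + _ + _ = (1 - \sum_(l <- Lam j) nsq (ft (t - l)))%:C); last first.
    rewrite rmorphB rmorph1 rmorph_sum/=.
    have -> : \sum_(q <- T) 1 * conjc q.2 * ft (t - q.1) = - \sum_(l <- Lam j) (nsq (ft (t - l)))%:C.
      rewrite big_map -sumrN; apply: eq_bigr => l _ /=.
      by rewrite mul1r raddfN mulNr nsqE mulrC.
    have -> : \sum_(p <- T) \sum_(q <- (t, 1) :: T) p.2 * conjc q.2 * ft (p.1 - q.1) = 0.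
      rewrite big_map big_seq big1// => l lj; rewrite big_cons /= conjc1 mulr1.
      rewrite big_map (bigD1_seq l)//= [X in _ + (_ + X)]big1_seq; last first.
        move=> l' /andP[l'l l'j]; have ll' : l != l' by rewrite eq_sym.
        by rewrite (orth j l l')// mulr0.
      rewrite subrr ft0 mulr1 addr0 -(opprB t l) ftN.
      by rewrite raddfN mulrNN mulNr addNr.
    by rewrite addr0.
  rewrite /= lte_fin.
  apply: (@le_lt_trans _ _ (d / 2)); last by rewrite ltr_pdivrMr// ltr_pMr// ltr1n.
  rewrite lerBlDr -lerBlDl (le_trans Hj)// le_eqVlt; apply/orP; left; apply/eqP.
  apply: eq_bigr => l _; rewrite -[in RHS](opprB l t) ftN nsqJ; congr (nsq (ft _)).
  by rewrite addrC.
have [s [sD sf]] := in_closed_span_L2 exps_in nu_supp K0 fL2 e0.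
have [u [c [uD tE]]] := trig_collect sD.
exists u, c; split => //.
by rewrite (_ : (fun x => _) = (fun x => f x - trig s x)%R)// tE.
Qed.

End spectral_criterion.

(** * Uniform measures on finite lists and their convolution *)

Section empirical_means.
Context (R : realType).
Local Open Scope complex_scope.
Implicit Types (s : seq R) (f : R -> R).

(** The integral of f against the uniform measure on s, counted with
    multiplicities. Lists avoid having to know whether the sums of digits are
    distinct. *)
Definition emp s f : R := (size s)%:R^-1 * \sum_(x <- s) f x.

Lemma empB s f g : emp s (fun x => f x - g x) = emp s f - emp s g.
Proof. by rewrite /emp sumrB mulrBr. Qed.

Lemma emp_le s f g : (forall x, x \in s -> f x <= g x) -> emp s f <= emp s g.
Proof.
by move=> fg; rewrite ler_wpM2l ?invr_ge0// !big_seq; apply: ler_sum.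
Qed.

Lemma eq_emp s f g : (forall x, x \in s -> f x = g x) -> emp s f = emp s g.
Proof. by move=> fg; rewrite /emp; congr (_ * _); apply: eq_big_seq. Qed.

Lemma emp_cst s (c : R) : s != [::] -> emp s (fun=> c) = c.
Proof.
move=> s0; rewrite /emp big_const_seq count_predT iter_addr_0 -(mulr_natl c) mulrA.
by rewrite mulVf ?mul1r// pnatr_eq0 size_eq0.
Qed.

Definition emp_measure s : set R -> \bar R :=
  mscale ((size s)%:R^-1)%:nng (msum (fun i => \d_(nth 0 s i)) (size s)).

HB.instance Definition _ s := Measure.on (emp_measure s).

Lemma emp_measureE s A : emp_measure s A = (emp s (\1_A))%:E.
Proof.
rewrite /emp_measure /mscale /= /msum /emp EFinM; congr (_ * _)%E.
rewrite (big_nth 0) big_mkord -sumEFin; apply: eq_bigr => i _.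
by [].
Qed.

Lemma ge0_integral_emp_measure s (f : R -> \bar R) : measurable_fun [set: R] f ->
  (forall x, 0 <= f x)%E ->
  (\int[emp_measure s]_x f x = ((size s)%:R^-1)%:E * \sum_(x <- s) f x)%E.
Proof.
move=> mf f0; rewrite ge0_integral_mscale//; congr (_ * _)%E.
rewrite ge0_integral_measure_sum// (big_nth 0) big_mkord; apply: eq_bigr => i _.
by rewrite integral_dirac// diracT mul1e.
Qed.

Lemma integral_emp_measure s f : measurable_fun [set: R] f ->
  (\int[emp_measure s]_x (f x)%:E)%E = (emp s f)%:E.
Proof.
move=> mf; have mfE : measurable_fun [set: R] (EFin \o f) by exact/measurable_EFinP.
rewrite integralE !ge0_integral_emp_measure//; last 2 first.
- exact: measurable_funeneg.
- exact: measurable_funepos.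
have pE (g : R -> R) : (\sum_(x <- s) (g x)%:E)%E = (\sum_(x <- s) g x)%:E by rewrite sumEFin.
have -> : ((EFin \o f)^\+ = EFin \o (fun x => Num.max (f x) (0 : R)%R))%E.
  by apply/funext => x; rewrite funeposE /= -EFin_max.
have -> : ((EFin \o f)^\- = EFin \o (fun x => Num.max (- f x)%R (0 : R)%R))%E.
  by apply/funext => x; rewrite funenegE /= -EFin_max.
rewrite /= !pE -!EFinM -EFinB -mulrBr -sumrB /emp; congr ((_ * _)%:E).
apply: eq_bigr => x _; rewrite /Num.max; do 2 case: ifP; lra.
Qed.

Definition sumset s t : seq R := [seq x + y | x <- s, y <- t].

Lemma emp_sumset s t f : emp (sumset s t) f = emp s (fun x => emp t (fun y => f (x + y))).
Proof.
rewrite /emp size_allpairs natrM invfM -!mulrA; congr (_ * _).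
by rewrite big_allpairs_dep/= mulr_sumr.
Qed.

(** The two measures are only assumed to agree with empirical ones on
    measurable sets, so that the lemma can be iterated along a convolution. *)
Lemma mconvolution_emp (mu nu : {finite_measure set R -> \bar R}) s t :
  (forall A, measurable A -> mu A = emp_measure s A) ->
  (forall A, measurable A -> nu A = emp_measure t A) ->
  forall A, measurable A -> mconvolution mu nu A = emp_measure (sumset s t) A.
Proof.
move=> ms nt A mA; rewrite /mconvolution /pushforward /= /product_measure1.
have madd : measurable ((fun z : R * R => z.1 + z.2) @^-1` A).
  rewrite -[X in measurable X]setTI.
  have madd : measurable_fun [set: R * R] (fun z : R * R => z.1 + z.2) by exact: measurable_funD.
  exact: madd.
rewrite (eq_measure_integral (emp_measure s)); last by move=> B mB _; exact: ms.
transitivity (\int[emp_measure s]_x (emp t (fun y => \1_A (x + y)))%:E)%E.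
  apply: eq_integral => x _ /=; rewrite nt; last exact: measurable_xsection.
  rewrite emp_measureE; congr (_%:E); apply: eq_emp => y _.
  rewrite !indicE mem_xsection; congr (nat_of_bool _)%:R.
rewrite integral_emp_measure; first by rewrite emp_measureE emp_sumset.
rewrite /emp; apply: measurable_funM => //; apply: measurable_sum => y.
apply: (@measurableT_comp _ _ _ _ _ _ (\1_A : R -> R) _ (fun x : R => x + y)); first exact: measurable_indic.
by apply: measurable_funD.
Qed.

Lemma delta_fset_emp (A : {fset R}) S : delta_fset A S = emp_measure A S.
Proof. by []. Qed.

End empirical_means.

(** * The limit of a decreasing sequence of empirical distribution functions *)

Section weak_limit.
Context (R : realType) (s_ : nat -> seq R) (K : R).
Hypothesis K0 : 0 <= K.
Hypothesis s_neq0 : forall k, s_ k != [::].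
Hypothesis s_itv : forall k x, x \in s_ k -> 0 <= x <= K.

Definition emp_cdf k (x : R) : R := emp (s_ k) (fun y => (y <= x)%R%:R).

Hypothesis emp_cdf_decr : forall k x, emp_cdf k.+1 x <= emp_cdf k x.

Lemma emp_cdf_nd k : nondecreasing (emp_cdf k).
Proof.
move=> x y xy; apply: emp_le => z _; case: (lerP z x) => zx.
  by rewrite (le_trans zx xy).
by case: (_ <= y).
Qed.

Lemma emp_cdf_ge0 k x : 0 <= emp_cdf k x.
Proof. by rewrite /emp_cdf /emp mulr_ge0 ?invr_ge0// sumr_ge0. Qed.

(** An empirical distribution function is locally constant on the right; this
    gives the right continuity of the limit. *)
Lemma emp_cdf_rstep k x : exists2 d, 0 < d & forall y, x <= y < x + d -> emp_cdf k y = emp_cdf k x.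
Proof.
have [d d0 H] : exists2 d : R, 0 < d & forall y z, z \in s_ k -> x <= y < x + d -> (z <= y) = (z <= x).
  elim: (s_ k) => [|a s [d d0 IH]]; first by exists 1.
  have [ax|xa] := leP a x.
    exists d => // y z; rewrite in_cons => /predU1P[->|]; last exact: IH.
    by move=> /andP[xy _]; rewrite ax (le_trans ax xy).
  exists (Num.min d (a - x)); first by rewrite lt_min d0 subr_gt0.
  move=> y z; rewrite in_cons addr_minr lt_min => /predU1P[->|zs] /and3P[xy yd].
    by rewrite addrC subrK => ya; rewrite leNgt ya (leNgt a x) xa.
  by move=> _; apply: IH => //; rewrite xy.
exists d => // y xy; apply: eq_emp => z zs; by rewrite (H y).
Qed.

Definition lim_cdf x : R := inf (range (emp_cdf ^~ x)).

Lemma lim_cdf_cvg x : emp_cdf k x @[k --> \oo] --> lim_cdf x.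
Proof.
apply: nonincreasing_cvgn; first by apply/nonincreasing_seqP => k.
by exists 0 => _ [k _ <-]; exact: emp_cdf_ge0.
Qed.

Lemma lim_cdf_le k x : lim_cdf x <= emp_cdf k x.
Proof. by apply: ge_inf; [exists 0 => _ [i _ <-]; exact: emp_cdf_ge0|exists k]. Qed.

Lemma lim_cdf_nd : nondecreasing lim_cdf.
Proof.
move=> x y xy; apply: (ler_cvg_to (lim_cdf_cvg (x := x)) (lim_cdf_cvg (x := y))).
by apply: nearW => k; exact: emp_cdf_nd.
Qed.

Lemma lim_cdf_lt0 x : x < 0 -> lim_cdf x = 0.
Proof.
move=> x0; apply/esym/(cvg_unique _ _ (lim_cdf_cvg (x := x))) => //.
rewrite (_ : emp_cdf ^~ x = cst 0); first exact: cvg_cst.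
apply/funext => k; rewrite /emp_cdf /emp big1_seq ?mulr0// => y /s_itv /andP[y0 _].
by rewrite leNgt (lt_le_trans x0 y0).
Qed.

Lemma lim_cdf_gtK x : K <= x -> lim_cdf x = 1.
Proof.
move=> Kx; apply/esym/(cvg_unique _ _ (lim_cdf_cvg (x := x))) => //.
rewrite (_ : emp_cdf ^~ x = cst 1); first exact: cvg_cst.
apply/funext => k; rewrite /emp_cdf -[RHS](@emp_cst _ (s_ k) 1)//; apply: eq_emp => y /s_itv /andP[_ yK].
by rewrite (le_trans yK Kx).
Qed.

(** An infimum of right continuous nondecreasing functions is right
    continuous. *)
Lemma lim_cdf_rc : right_continuous lim_cdf.
Proof.
move=> x; apply/cvgrPdist_lt => e e0.
have [k hk] : exists k, emp_cdf k x < lim_cdf x + e.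
  have := lim_cdf_cvg (x := x); move/cvgrPdist_lt => /(_ _ e0)[k _ /(_ _ (leqnn _))] /= h.
  by exists k; move: h; rewrite ltr_norml => /andP[+ _]; lra.
have [d d0 Hd] := emp_cdf_rstep k x.
near=> y.
have xy : x <= y by near: y; exact: nbhs_right_ge.
have yd : y < x + d by near: y; apply: nbhs_right_lt; rewrite ltrDl.
rewrite distrC ger0_norm ?subr_ge0 ?lim_cdf_nd// ltrBlDl.
by rewrite (le_lt_trans (lim_cdf_le k y))// Hd ?xy.
Unshelve. all: by end_near.
Qed.

HB.instance Definition _ := isCumulative.Build R _ R lim_cdf lim_cdf_nd lim_cdf_rc.

Lemma lim_cdfNy : lim_cdf @ -oo --> (0 : R).
Proof.
apply: cvg_near_cst; near=> x; apply: lim_cdf_lt0.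
near: x; exact: nbhs_ninfty_lt.
Unshelve. all: by end_near.
Qed.

Lemma lim_cdfy : lim_cdf @ +oo --> (1 : R).
Proof.
apply: cvg_near_cst; near=> x; apply: lim_cdf_gtK.
near: x; apply: nbhs_pinfty_ge; exact: num_real.
Unshelve. all: by end_near.
Qed.

HB.instance Definition _ := isCumulativeBounded.Build R 0 1 lim_cdf lim_cdfNy lim_cdfy.

Let idTR : measurableTypeR R -> R := idfun.

#[local] HB.instance Definition _ :=
  @isMeasurableFun.Build _ _ _ _ idTR (@measurable_id _ _ setT).

Let lsf := lebesgue_stieltjes_measure lim_cdf.

(** The Lebesgue-Stieltjes measure of the limit, transported by the identity
    to the Borel structure of the real line. *)
Definition weak_lim : probability R R := distribution lsf (idTR : {RV lsf >-> R}).

Lemma weak_lim_ray x : weak_lim `]-oo, x]%classic = (lim_cdf x)%:E.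
Proof. exact: cdf_lebesgue_stieltjes_id. Qed.

End weak_limit.

(** * Convergence of distribution functions implies weak convergence *)

Section weak_convergence_of_cdf.
Context (R : realType) (s_ : nat -> seq R) (K : R).
Hypothesis K0 : 0 <= K.
Hypothesis s_neq0 : forall k, s_ k != [::].
Hypothesis s_itv : forall k x, x \in s_ k -> 0 <= x <= K.
Variables (nu : probability R R) (F : R -> R).
Hypothesis emp_cdf_cvg : forall x, emp_cdf s_ k x @[k --> \oo] --> F x.
Hypothesis nu_ray : forall x, nu `]-oo, x]%classic = (F x)%:E.
Hypothesis F_m1 : F (-1) = 0.
Hypothesis F_K : F K = 1.

(** Uniform continuity near the compact interval, in the asymmetric form in
    which only one of the points is confined to it. *)
Lemma continuous_modulus (f : R -> R) (e : R) : continuous f -> 0 < e ->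
  exists2 d : R, 0 < d & forall x y, -1 <= x <= K -> `|x - y| < d -> `|f x - f y| < e.
Proof.
move=> cf e0.
have /compact_near_coveringP cov : compact `[(-1 : R), K]%classic by exact: segment_compact.
have e2 : 0 < e / 2 by rewrite divr_gt0.
have H : \forall d \near (0 : R)^'+, `[(-1 : R), K]%classic `<=`
    (fun x => forall y, `|x - y| < d -> `|f x - f y| < e).
  apply: cov => x _; have /cvgrPdist_lt /(_ _ e2) := cf x.
  move=> /nbhs_ballP[r /= r0 Hr].
  exists (ball x (r / 2), [set d | 0 < d < r / 2]) => /=.
    split; first by apply: nbhsx_ballx; rewrite divr_gt0.
    near=> d; apply/andP; split; first by near: d; exact: nbhs_right_gt.
    by near: d; apply: nbhs_right_lt; rewrite divr_gt0.
  move=> [x' d] /= [xx' /andP[d0 dr]] y x'y.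
  have h1 : `|f x - f x'| < e / 2.
    apply: Hr; apply: (@lt_trans _ _ (r / 2)) => //.
    by rewrite ltr_pdivrMr// ltr_pMr// ltr1n.
  have h2 : `|f x - f y| < e / 2.
    apply: Hr; rewrite /ball/= [r]splitr.
    rewrite (_ : x - y = (x - x') + (x' - y)); last by ring.
    rewrite (le_lt_trans (ler_normD _ _))// ltrD//.
    exact: lt_trans dr.
  rewrite (_ : f x' - f y = (f x - f y) - (f x - f x')); last by ring.
  by rewrite (le_lt_trans (ler_normB _ _))// [e]splitr ltrD.
have [d [d0 Hd]] := filter_ex (filterI (nbhs_right_gt (0 : R)) H).
by exists d => // x y xK; apply: Hd; rewrite /= in_itv.
Unshelve. all: by end_near.
Qed.

Variable f : R -> R.
Hypothesis cf : continuous f.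
Variable M : R.
Hypothesis fM : forall x, `|f x| <= M.

(** The grid starts at -1, to the left of the support, so that an atom at 0 is
    covered by a half-open cell. *)
Definition grid (n i : nat) : R := -1 + i%:R * ((K + 1) / n.+1%:R).

(** The step function equal to f at the left end of each cell, written with
    indicators of half-lines so that its integral involves only the
    distribution function. *)
Definition grid_step n (x : R) : R :=
  \sum_(i < n.+1) f (grid n i) * ((x <= grid n i.+1)%R%:R - (x <= grid n i)%R%:R).

Lemma grid_nd n i j : (grid n i <= grid n j) = (i <= j)%N.
Proof.
have h : 0 < (K + 1) / n.+1%:R by rewrite divr_gt0// ltr_wpDl.
by rewrite /grid lerD2l ler_pM2r// ler_nat.
Qed.

Lemma grid0 n : grid n 0 = -1.
Proof. by rewrite /grid mul0r addr0. Qed.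

Lemma grid_last n : grid n n.+1 = K.
Proof. by rewrite /grid mulrCA mulfV ?pnatr_eq0// mulr1 addrC addrK. Qed.

Lemma grid_step_close n (e d : R) :
  (forall x y, -1 <= x <= K -> `|x - y| < d -> `|f x - f y| < e) ->
  (K + 1) / n.+1%:R < d ->
  forall x, -1 < x <= K -> `|f x - grid_step n x| < e.
Proof.
move=> mod nd x /andP[x1 xK].
have ex : exists i, x <= grid n i by exists n.+1; rewrite grid_last.
case: (ex_minnP ex) => i xi imin.
have xle j : (x <= grid n j) = (i <= j)%N.
  apply/idP/idP => [/imin//|ij]; by rewrite (le_trans xi)// grid_nd.
have i0 : (0 < i)%N.
  by rewrite lt0n; apply/eqP => i0; move: xi; rewrite i0 grid0 leNgt x1.
have iN : (i.-1 < n.+1)%N.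
  by rewrite prednK// -xle grid_last.
have -> : grid_step n x = f (grid n i.-1).
  rewrite /grid_step (bigD1 (Ordinal iN))//= !xle prednK// leqnn.
  rewrite (leqNgt i i.-1) prednK// leqnn subr0 mulr1 big1 ?addr0// => j ji.
  rewrite !xle; suff -> : (i <= j.+1)%N = (i <= j)%N by rewrite subrr mulr0.
  rewrite leq_eqVlt ltnS; case: eqP => //= ij.
  by move: ji; rewrite -val_eqE/= ij eqxx.
have x1K : -1 <= x <= K by rewrite (ltW x1).
apply: mod => //.
have xg : grid n i.-1 < x by rewrite ltNge xle -ltnNge prednK.
rewrite ger0_norm ?subr_ge0 ?(ltW xg)// (le_lt_trans _ nd)//.
rewrite lerBlDr (le_trans xi)// /grid -{1}(prednK i0) -natr1.
by rewrite le_eqVlt; apply/orP; left; apply/eqP; ring.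
Qed.

Lemma measurable_ray_ind (t : R) : measurable_fun [set: R] (fun x => (x <= t)%R%:R : R).
Proof.
rewrite (_ : (fun x => _) = \1_(`]-oo, t]%classic)); first exact: measurable_indic.
apply/funext => x; rewrite indicE; congr (nat_of_bool _)%:R.
by apply/idP/idP; rewrite in_setE /= in_itv.
Qed.

Lemma Rintegral_ray_ind (t : R) : \int[nu]_x ((x <= t)%R%:R : R) = F t.
Proof.
have -> : F t = fine (nu `]-oo, t]%classic) by rewrite nu_ray.
rewrite -(setIT `]-oo, t]%classic) -integral_indic//; congr fine.
apply: eq_integral => x _; congr ((nat_of_bool _)%:R%:E).
by apply/idP/idP; rewrite in_setE /= in_itv.
Qed.

Lemma integrable_ray_ind (t : R) : nu.-integrable [set: R] (EFin \o (fun x => (x <= t)%R%:R : R)).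
Proof.
apply: (@integrable_of_le _ _ _ 1); first exact: measurable_ray_ind.
by move=> x; case: (lerP x t) => _ /=; rewrite ?normr1 ?normr0.
Qed.

Lemma Rintegral_grid_step n :
  nu.-integrable [set: R] (EFin \o (grid_step n)) /\
  \int[nu]_x (grid_step n x) =
    \sum_(i < n.+1) f (grid n i) * (F (grid n i.+1) - F (grid n i)).
Proof.
rewrite /grid_step; elim: (index_enum _) => [|i r [IH1 IH2]].
  under [fun x => _]funext do rewrite big_nil.
  by rewrite big_nil /Rintegral integral0; split => //; exact: integrable0.
under [fun x => _]funext do rewrite big_cons.
have i1 : nu.-integrable [set: R] (EFin \o (fun x => f (grid n i) *
    ((x <= grid n i.+1)%R%:R + (- 1) * (x <= grid n i)%R%:R))).
  apply: integrableZ_real; apply: integrableD_real; first exact: integrable_ray_ind.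
  by apply: integrableZ_real; exact: integrable_ray_ind.
have eq1 : (fun x => f (grid n i) * ((x <= grid n i.+1)%R%:R + (- 1) * (x <= grid n i)%R%:R)) =
   (fun x => f (grid n i) * ((x <= grid n i.+1)%R%:R - (x <= grid n i)%R%:R)).
  by apply/funext => x; rewrite mulN1r.
split; first by apply: integrableD_real => //; rewrite -eq1.
rewrite RintegralD//; last by rewrite -eq1.
rewrite IH2 big_cons; congr (_ + _); rewrite -eq1 RintegralZl//; last first.
  apply: integrableD_real; first exact: integrable_ray_ind.
  by apply: integrableZ_real; exact: integrable_ray_ind.
rewrite RintegralD// ?RintegralZl// ?Rintegral_ray_ind ?mulN1r//; try exact: integrable_ray_ind.
by apply: integrableZ_real; exact: integrable_ray_ind.
Qed.

Lemma emp_grid_step n k : emp (s_ k) (grid_step n) =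
    \sum_(i < n.+1) f (grid n i) * (emp_cdf s_ k (grid n i.+1) - emp_cdf s_ k (grid n i)).
Proof.
rewrite /emp /grid_step exchange_big/= mulr_sumr; apply: eq_bigr => i _.
by rewrite -mulr_sumr mulrCA sumrB mulrBr.
Qed.

Lemma grid_step_bound n x : `|grid_step n x| <= \sum_(i < n.+1) `|f (grid n i)|.
Proof.
rewrite (le_trans (ler_norm_sum _ _ _))//; apply: ler_sum => i _.
rewrite normrM ler_piMr//.
by case: (lerP x (grid n i.+1)) => _; case: (lerP x (grid n i)) => _ /=; rewrite ?subrr ?subr0 ?sub0r ?normrN ?normr0 ?normr1.
Qed.

(** Outside ]-1, K] the error is only bounded, but this set has measure 0 for
    nu: the dominating function charges it with two half-line indicators,
    whose integrals are F (-1) = 0 and F K = 1. *)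
Lemma Rintegral_close n (e : R) : 0 <= e ->
  (forall x, -1 < x <= K -> `|f x - grid_step n x| <= e) ->
  `|\int[nu]_x f x - \int[nu]_x (grid_step n x)| <= e.
Proof.
move=> e0 close.
have [ig _] := Rintegral_grid_step n.
have mf : measurable_fun [set: R] f by exact: continuous_measurable_fun.
have ifn : nu.-integrable [set: R] (EFin \o f) by exact: (integrable_of_le nu mf fM).
rewrite -RintegralB//; apply: le_trans (le_normr_Rintegral _ _) _ => //.
  have := integrableB measurableT ifn ig; exact.
set M' := M + \sum_(i < n.+1) `|f (grid n i)|.
(* The right-hand side is e on ]-1, K] and M' + e elsewhere. *)
have bound x : `|f x - grid_step n x| <=
   (e + M' * 1) + M' * (x <= -1)%R%:R + (- M') * (x <= K)%R%:R.
  have b1 : `|f x - grid_step n x| <= M'.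
    by rewrite (le_trans (ler_normB _ _))// lerD// grid_step_bound.
  have M'0 : 0 <= M' by exact: le_trans b1.
  case: (lerP x (-1)) => x1 /=.
    rewrite (le_trans x1) /=; last by rewrite (le_trans _ K0)// lerN10.
    by lra.
  case: (lerP x K) => xK /=; last by lra.
  have := close x; rewrite x1 xK => /(_ isT); lra.
have ic (c : R) : nu.-integrable [set: R] (EFin \o (fun _ : R => c)).
  by apply: (@integrable_of_le _ _ _ `|c|).
have iB : nu.-integrable [set: R] (EFin \o (fun x =>
   (e + M' * 1) + M' * (x <= -1)%R%:R + (- M') * (x <= K)%R%:R)).
  apply: integrableD_real; last by apply: integrableZ_real; exact: integrable_ray_ind.
  apply: integrableD_real; last by apply: integrableZ_real; exact: integrable_ray_ind.
  exact: ic.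
apply: (@le_trans _ _ (\int[nu]_x ((e + M' * 1) + M' * (x <= -1)%R%:R + (- M') * (x <= K)%R%:R))).
  apply: le_Rintegral => //.
  have := integrable_norm (integrableB measurableT ifn ig); exact.
rewrite RintegralD//; last 2 first.
- apply: integrableD_real; last by apply: integrableZ_real; exact: integrable_ray_ind.
  exact: ic.
- by apply: integrableZ_real; exact: integrable_ray_ind.
rewrite RintegralD//; last by apply: integrableZ_real; exact: integrable_ray_ind.
rewrite !RintegralZl ?Rintegral_ray_ind//; try exact: integrable_ray_ind.
rewrite F_m1 F_K Rintegral_cst//.
have -> : fine (nu [set: R]) = 1 by exact: (congr1 fine (@probability_setT _ _ _ nu)).
by lra.
Qed.

Lemma emp_close n k (e : R) :
  (forall x, -1 < x <= K -> `|f x - grid_step n x| <= e) ->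
  `|emp (s_ k) f - emp (s_ k) (grid_step n)| <= e.
Proof.
move=> close; rewrite -empB -(emp_cst e (s_neq0 k)) ler_norml -mulN1r.
have sx x : x \in s_ k -> `|f x - grid_step n x| <= e.
  move=> /s_itv/andP[x0 xK]; apply: close; rewrite xK andbT.
  by rewrite (lt_le_trans _ x0)// ltrN10.
apply/andP; split.
  rewrite (_ : -1 * _ = emp (s_ k) (fun=> - e)); last by rewrite !emp_cst// mulN1r.
  by apply: emp_le => x /sx; rewrite ler_norml => /andP[].
by apply: emp_le => x /sx; rewrite ler_norml => /andP[].
Qed.

(** For a fixed grid both integrals are finite combinations of values of
    distribution functions, which converge; the grid is fine enough to make
    the two discretization errors at most e/4. *)
Theorem emp_weak_cvg : emp (s_ k) f @[k --> \oo] --> \int[nu]_x f x.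
Proof.
apply/cvgrPdist_lt => e e0.
have e4 : 0 < e / 4 by rewrite divr_gt0.
have [d d0 mod] := continuous_modulus cf e4.
pose n := Num.truncn ((K + 1) / d).
have nd : (K + 1) / n.+1%:R < d.
  rewrite ltr_pdivrMr// mulrC -ltr_pdivrMr//; exact: truncnS_gt.
have close x : -1 < x <= K -> `|f x - grid_step n x| <= e / 4.
  by move=> xx; apply/ltW; exact: (grid_step_close mod nd xx).
have := Rintegral_close (ltW e4) close.
have [_ ->] := Rintegral_grid_step n => h1.
have lim : \sum_(i < n.+1) f (grid n i) * (emp_cdf s_ k (grid n i.+1) - emp_cdf s_ k (grid n i)) @[k --> \oo] -->
  \sum_(i < n.+1) f (grid n i) * (F (grid n i.+1) - F (grid n i)).
  apply: cvg_big => [|i _]; first exact: add_continuous.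
  by apply: cvgM; [exact: cvg_cst|apply: cvgB; exact: emp_cdf_cvg].
move/cvgrPdist_lt : lim => /(_ _ e4); apply: filterS => k hk.
have h2 := emp_close k close.
rewrite emp_grid_step in h2.
move: h1 h2 hk; set a := \int[nu]_x f x; set b := \sum_(i < n.+1) _; set c := emp (s_ k) f.
set c' := \sum_(i < n.+1) _; rewrite !ler_norml !ltr_norml.
by move=> /andP[? ?] /andP[? ?] /andP[? ?]; apply/andP; split; lra.
Qed.

End weak_convergence_of_cdf.

(** * Existence, Fourier transform and support of infinite convolutions *)

Section clamp.
Context (R : realType).

(** Truncation to [0, 1], written with absolute values to make continuity
    evident. It serves to build continuous functions approximating indicators. *)
Definition clamp01 (y : R) : R :=
  let u := (y + `|y|) / 2 in (1 + u - `|1 - u|) / 2.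

Lemma continuous_clamp01 : continuous clamp01.
Proof.
have c1 : continuous (fun y : R => (y + `|y|) / 2).
  move=> y; apply: cvgM; last exact: cvg_cst.
  by apply: cvgD; [exact: cvg_id|exact: norm_continuous].
have c2 : continuous (fun u : R => (1 + u - `|1 - u|) / 2).
  move=> u; apply: cvgM; last exact: cvg_cst.
  apply: cvgB; first by apply: cvgD; [exact: cvg_cst|exact: cvg_id].
  apply: cvg_norm; apply: cvgB; [exact: cvg_cst|exact: cvg_id].
move=> y; exact: (@continuous_comp _ _ _ _ _ y (c1 y) (c2 _)).
Qed.

Lemma clamp01_cases y : clamp01 y = if y <= 0 then 0 else if y <= 1 then y else 1.
Proof.
rewrite /clamp01 /=; case: (lerP y 0) => y0.
  by rewrite ler0_norm// subrr mul0r subr0 normr1 addr0 subrr mul0r.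
have -> : (y + `|y|) / 2 = y by rewrite gtr0_norm//; field.
by case: (lerP y 1) => y1; field.
Qed.

Lemma clamp01_itv y : 0 <= clamp01 y <= 1.
Proof.
rewrite clamp01_cases; case: (lerP y 0) => y0; first by rewrite lexx ler01.
by case: (lerP y 1) => y1; rewrite ?ler01 ?lexx// (ltW y0).
Qed.

Lemma clamp01_le0 y : y <= 0 -> clamp01 y = 0.
Proof. by rewrite clamp01_cases => ->. Qed.

Lemma clamp01_ge1 y : 1 <= y -> clamp01 y = 1.
Proof.
move=> y1; rewrite clamp01_cases leNgt (lt_le_trans ltr01 y1)/=.
by case: (lerP y 1) => // y1'; apply/eqP; rewrite eq_le y1' y1.
Qed.

Lemma clamp01_gt0 y : 0 < y -> 0 < clamp01 y.
Proof. by move=> y0; rewrite clamp01_cases leNgt y0 /=; case: ifP. Qed.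

End clamp.

Section infinite_convolutions.
Context (R : realType) (m : nat).
Context (N : 'I_m.+1 -> nat) (B : 'I_m.+1 -> {fset int}) (n : nat -> nat).
Local Open Scope complex_scope.
Local Notation C := (R[i]).
Implicit Type w : codespace R m.

Definition code_base w (j : nat) : nat := (N (w j) ^ n j)%N.
Definition code_digits w (j : nat) : seq int := B (w j).
Local Notation P w k := ((nprod (code_base w) 0 k)%:R : R).

Definition scaled_digits w k : seq R := [seq b%:~R / P w k.+1 | b <- code_digits w k].

(** The possible sums of scaled digits with their multiplicities: the
    empirical measure of this list is the partial convolution. *)
Fixpoint atoms w k : seq R :=
  if k is k'.+1 then sumset (atoms w k') (scaled_digits w k) else scaled_digits w 0.

Hypothesis N2 : forall j, (2 <= N j)%N.
Hypothesis n0 : forall k, (0 < n k)%N.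

Lemma code_base_ge2 w j : (2 <= code_base w j)%N.
Proof.
rewrite /code_base -(prednK (n0 j)) expnS (leq_trans (N2 (w j)))// leq_pmulr//.
by rewrite expn_gt0 (leq_trans _ (N2 (w j))).
Qed.

(** Distinct digits have distinct scaled values, so the finite set of the
    factor has as many elements as the list of digits. *)
Lemma conv_factor_emp w k A : conv_factor N B n w k A = emp_measure (scaled_digits w k) A.
Proof.
rewrite /conv_factor /= delta_fset_emp !emp_measureE; congr (_%:E).
have -> : \prod_(j < k.+1) (N (w j))%:R ^- n j = (P w k.+1)^-1 :> R.
  rewrite /nprod big_mkord natr_prod prodfV; congr (_^-1).
  by apply: eq_bigr => i _; rewrite natrX.
set f := fun b : int => (P w k.+1)^-1 * b%:~R.
have injf : injective f.
  move=> a b /(mulfI _) ab; apply/eqP; rewrite -(eqr_int R); apply/eqP/ab.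
  by rewrite invr_eq0 nprodR_neq0//; exact: code_base_ge2.
rewrite /emp /scaled_digits size_map; congr (_%:R^-1 * _).
  by rewrite card_imfset.
rewrite big_map big_imfset /=; last by move=> a b _ _; exact: injf.
by apply: eq_bigr => b _; rewrite /f mulrC.
Qed.

Lemma partial_conv_emp w k A : measurable A ->
  partial_conv N B n w k A = emp_measure (atoms w k) A.
Proof.
elim: k A => [|k IH] A mA; first exact: conv_factor_emp.
by apply: mconvolution_emp => // S mS; exact: conv_factor_emp.
Qed.

Lemma integral_partial_conv w k (f : R -> R) : measurable_fun [set: R] f ->
  (\int[partial_conv N B n w k]_x (f x)%:E)%E = (emp (atoms w k) f)%:E.
Proof.
move=> mf; rewrite -integral_emp_measure//; apply: eq_measure_integral => A mA _.
exact: partial_conv_emp.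
Qed.

Lemma atoms_ext w w' k : (forall i, (i <= k)%N -> w i = w' i) -> atoms w k = atoms w' k.
Proof.
have dig j : (forall i, (i <= j)%N -> w i = w' i) -> scaled_digits w j = scaled_digits w' j.
  move=> ww; rewrite /scaled_digits /code_digits ww//.
  rewrite (_ : nprod (code_base w) 0 j.+1 = nprod (code_base w') 0 j.+1)//.
  by apply: eq_big_nat => i /andP[_ ij]; rewrite /code_base ww.
elim: k => [|k IH] ww /=; first exact: dig.
by rewrite IH ?dig// => i ik; rewrite ww// ltnW.
Qed.

Definition cmean (s : seq R) (t : R) : C :=
  (size s)%:R^-1 * \sum_(x <- s) expi (2 * pi * t * x).

Lemma cmeanE s t : cmean s t =
  (emp s (fun x => cos (2 * pi * t * x))) +i* (emp s (fun x => sin (2 * pi * t * x))).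
Proof.
rewrite /cmean /emp natr_complex -fmorphV /=.
apply/eqP; rewrite eq_complex /=.
case E : (\sum_(x <- s) _) => [a b] /=.
have := congr1 (@complex.Re R) E; rewrite Re_sum /= => ->.
have := congr1 (@complex.Im R) E; rewrite Im_sum /= => ->.
by rewrite !mul0r subr0 addr0 !eqxx.
Qed.

Lemma cmean_sumset s u t : cmean (sumset s u) t = cmean s t * cmean u t.
Proof.
rewrite /cmean size_allpairs natrM invfM mulrACA; congr (_ * _).
rewrite big_allpairs_dep big_distrlr/=; apply: eq_bigr => x _; apply: eq_bigr => y _.
by rewrite mulrDr expiD.
Qed.

Lemma cmean_scaled_digits w k t : cmean (scaled_digits w k) t = maskf (code_digits w k) (t / P w k.+1).
Proof.
rewrite /cmean /maskf size_map big_map; congr (_ * _); apply: eq_bigr => b _.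
by congr expi; ring.
Qed.

(** Convolution becomes multiplication: the transform of the partial
    convolution is a product of masks. *)
Lemma cmean_atoms w k t : cmean (atoms w k) t = mprod (code_base w) (code_digits w) 0 k.+1 t.
Proof.
elim: k => [|k IH]; first by rewrite /mprod big_nat1 cmean_scaled_digits.
by rewrite mprod_recr// -IH -cmean_scaled_digits -cmean_sumset.
Qed.

Hypothesis B0 : forall j, 0 \in B j.
Hypothesis Bge0 : forall j b, b \in B j -> 0 <= b.
Variable K : R.
Hypothesis BK : forall j b, b \in B j -> `|b%:~R| <= K :> R.

Lemma digit_bound_ge0 : 0 <= K.
Proof. by apply: le_trans (BK (B0 ord0)); rewrite normr_ge0. Qed.

Lemma P_gt0 w k : 0 < P w k.
Proof. by rewrite nprodR_gt0//; exact: code_base_ge2. Qed.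

Lemma scaled_digits_ge0 w k x : x \in scaled_digits w k -> 0 <= x <= K / P w k.+1.
Proof.
move=> /mapP[b bB ->]; have P0 := P_gt0 w k.+1.
rewrite divr_ge0 ?ler0z ?(Bge0 bB) ?(ltW P0)//=.
by rewrite ler_pM2r ?invr_gt0// (le_trans (ler_norm _))// (BK bB).
Qed.

Lemma scaled_digits_neq0 w k : scaled_digits w k != [::].
Proof. rewrite -size_eq0 size_map size_eq0; apply/eqP => b0.
by have : 0 \in code_digits w k := B0 (w k); rewrite b0. Qed.

Lemma atoms_neq0 w k : atoms w k != [::].
Proof.
elim: k => [|k IH]; first exact: scaled_digits_neq0.
by rewrite -size_eq0 size_allpairs muln_eq0 negb_or !size_eq0 IH scaled_digits_neq0.
Qed.

(** The scales decrease at least like powers of 1/2, so the digits bounded by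
    K contribute at most K in total. *)
Lemma atoms_itv w k x : x \in atoms w k -> 0 <= x <= K.
Proof.
have K0 := digit_bound_ge0.
suff : x \in atoms w k -> 0 <= x <= K * \sum_(0 <= i < k.+1) (P w i.+1)^-1.
  move=> H /H /andP[-> /le_trans]; apply.
  rewrite -[leRHS]mulr1 ler_wpM2l//.
  rewrite (le_trans (sum_inv_nprod R (code_base_ge2 w) (leq0n k.+1)))//.
  by rewrite /nprod big_geq// invr1 gerBl invr_ge0.
elim: k x => [|k IH] x.
  by move=> /scaled_digits_ge0; rewrite big_nat1.
move=> /allpairsP[[a b] /= [/IH /andP[a0 a1] /scaled_digits_ge0 /andP[b0 b1] ->]].
by rewrite addr_ge0//= big_nat_recr//= mulrDr lerD.
Qed.

(** Convolving with a measure on [0, +oo[ pushes mass to the right. *)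
Lemma atoms_cdf_decr w k x : emp_cdf (atoms w) k.+1 x <= emp_cdf (atoms w) k x.
Proof.
rewrite /emp_cdf emp_sumset; apply: emp_le => y _.
rewrite -[leRHS](emp_cst _ (scaled_digits_neq0 w k.+1)); apply: emp_le => b /scaled_digits_ge0/andP[b0 _].
case: (lerP (y + b) x) => h; last by [].
by rewrite (le_trans _ h)// lerDl.
Qed.

(** Nonnegative digits make the distribution functions of the partial
    convolutions decrease pointwise, so that they converge without any
    compactness argument; all supports lie in [0, K]. *)
Theorem infinite_conv_exists_of_nonneg w : infinite_conv_exists N B n w.
Proof.
have K0 := digit_bound_ge0.
have hs k x : x \in atoms w k -> 0 <= x <= K by exact: atoms_itv.
pose nu := weak_lim (atoms_neq0 w) hs (atoms_cdf_decr w).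
exists nu => f cf [M [_ Mf]].
have fM x : `|f x| <= `|M| + 1.
  by apply: Mf => //; rewrite (le_lt_trans (ler_norm _))// ltrDl.
have mf : measurable_fun [set: R] f by exact: continuous_measurable_fun.
have ifn := integrable_of_le nu mf fM.
rewrite -(fineK (integrable_fin_num measurableT ifn)).
rewrite (_ : (fun k => _) = EFin \o (fun k => emp (atoms w k) f)); last first.
  by apply/funext => k /=; rewrite integral_partial_conv.
apply: cvg_EFin; first by near=> k.
apply: (@emp_weak_cvg _ _ K K0 (atoms_neq0 w) hs nu (lim_cdf (atoms w))) => //.
- by move=> x; apply: lim_cdf_cvg; exact: atoms_cdf_decr.
- by move=> x; exact: weak_lim_ray.
- by apply: (lim_cdf_lt0 hs (atoms_cdf_decr w)); rewrite ltrN10.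
- by apply: (lim_cdf_gtK (atoms_neq0 w) hs (atoms_cdf_decr w)).
Unshelve. all: by end_near.
Qed.


Section weak_limits.
Variables (w : codespace R m) (nu : probability R R).
Hypothesis nu_lim : weak_cvg (partial_conv N B n w) nu.

Lemma emp_atoms_cvg (f : R -> R) (M : R) : continuous f -> (forall x, `|f x| <= M) ->
  emp (atoms w k) f @[k --> \oo] --> \int[nu]_x f x.
Proof.
move=> cf fM; have mf : measurable_fun [set: R] f by exact: continuous_measurable_fun.
have bf : bounded_fun f.
  by exists M; split; [exact: num_real|move=> y My x _ /=; rewrite (le_trans (fM x))// ltW].
have := nu_lim cf bf.
rewrite (_ : (fun k => _) = EFin \o (fun k => emp (atoms w k) f)); last first.
  by apply/funext => k /=; rewrite integral_partial_conv.
rewrite -(fineK (integrable_fin_num measurableT (integrable_of_le nu mf fM))).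
by move/fine_cvgP => [_].
Qed.

(** Weak convergence tested on cosines and sines. *)
Lemma ft_mprod_cvg t (e : R) : 0 < e -> exists k0, forall k, (k0 <= k)%N ->
  Normc.normc (ft nu t - mprod (code_base w) (code_digits w) 0 k t) < e.
Proof.
move=> e0; have e2 : 0 < e / 2 by rewrite divr_gt0.
have cc : continuous (fun x : R => cos (2 * pi * t * x)).
  move=> x; apply: (@continuous_comp _ _ _ ( *%R (2 * pi * t)) (@cos R)).
    exact: mulrl_continuous.
  exact: continuous_cos.
have cs : continuous (fun x : R => sin (2 * pi * t * x)).
  move=> x; apply: (@continuous_comp _ _ _ ( *%R (2 * pi * t)) (@sin R)).
    exact: mulrl_continuous.
  exact: continuous_sin.
have cb (x : R) : `|cos (2 * pi * t * x)| <= 1 by rewrite ler_norml cos_geN1 cos_le1.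
have sb (x : R) : `|sin (2 * pi * t * x)| <= 1 by rewrite ler_norml sin_geN1 sin_le1.
have := emp_atoms_cvg cc cb => /cvgrPdist_lt /(_ _ e2) h1.
have := emp_atoms_cvg cs sb => /cvgrPdist_lt /(_ _ e2) h2.
have [k0 _ Hk] := filterI h1 h2.
exists k0.+1 => -[//|k]; rewrite ltnS => kk.
rewrite -cmean_atoms cmeanE (le_lt_trans (normc_ReIm _))//= [e]splitr.
by have [a b] := Hk k kk; rewrite ltrD.
Qed.

(** A continuous nonnegative function vanishing exactly on [-K, K] has zero
    mean on the atoms, hence zero integral for nu. *)
Lemma weak_limit_support : nu [set x | K < `|x|] = 0%E.
Proof.
have K0 := digit_bound_ge0.
pose h (x : R) := clamp01 (`|x| - K).
have ch : continuous h.
  have c1 : continuous (fun y : R => `|y| - K).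
    by move=> y; apply: cvgB; [exact: norm_continuous|exact: cvg_cst].
  move=> x; exact: (@continuous_comp _ _ _ _ _ x (c1 x) (@continuous_clamp01 R _)).
have hM x : `|h x| <= 1 by have /andP[a b] := clamp01_itv (`|x| - K); rewrite ger0_norm.
have mh : measurable_fun [set: R] h by exact: continuous_measurable_fun.
have h0 : \int[nu]_x h x = 0.
  apply/esym/(cvg_unique _ _ (emp_atoms_cvg ch hM)) => //.
  rewrite (_ : (fun k => _) = cst 0); first exact: cvg_cst.
  apply/funext => k; rewrite -(emp_cst 0 (atoms_neq0 w k)); apply: eq_emp => x.
  move=> /atoms_itv/andP[x0 xK]; rewrite /h clamp01_le0// ger0_norm//.
  by rewrite subr_le0.
have [] := (@ae_eq_integral_abs _ _ _ nu _ measurableT (EFin \o h) _).1.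
- exact/measurable_EFinP.
- have ih := integrable_of_le nu mh hM.
  rewrite (_ : (\int[nu]_x _)%E = (\int[nu]_x (h x)%:E)%E); last first.
    apply: eq_integral => x _; rewrite /= ger0_norm//.
    by have /andP[] := clamp01_itv (`|x| - K).
  by rewrite -(fineK (integrable_fin_num measurableT ih)) [fine _]h0.
move=> A [mA A0 hA]; apply/(negligibleP _ (measurable_gtnorm K)).
exists A; split => // x /= Kx; apply: hA => /= /(_ I) /eqP; rewrite eqe.
by rewrite gt_eqF// clamp01_gt0// subr_gt0.
Qed.

End weak_limits.

End infinite_convolutions.

(** * Measurability of the limit in the code *)

Section measurability_in_the_code.
Context (R : realType) (m : nat).
Local Notation Omega := (borel_codespace R m).

Lemma open_cylinder (A : set (codespace R m)) k :
  (forall w w' : codespace R m, (forall i, (i < k)%N -> w i = w' i) -> A w -> A w') ->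
  open A.
Proof.
move=> loc; rewrite openE => w Aw; apply/nbhs_ballP; exists (2 ^- k) => /=.
  by rewrite invr_gt0 exprn_gt0.
move=> w'; rewrite /ball/= => ww'; apply: (loc w) => // i ik.
exact: (code_dist_le w w' k).1 (ltW ww') i ik.
Qed.

(** Sets depending on finitely many letters are open. *)
Lemma measurable_cylinder (A : set Omega) k :
  (forall w w' : Omega, (forall i, (i < k)%N -> w i = w' i) -> A w -> A w') ->
  measurable A.
Proof. by move=> loc; apply: sub_sigma_algebra; exact: open_cylinder loc. Qed.

Lemma measurable_fun_cylinder (h : Omega -> R) k :
  (forall w w' : Omega, (forall i, (i < k)%N -> w i = w' i) -> h w = h w') ->
  measurable_fun [set: Omega] h.
Proof.
move=> loc _ Y mY; rewrite setTI; apply: (@measurable_cylinder _ k) => w w' ww' /=.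
by rewrite (loc _ _ ww').
Qed.

Context (N : 'I_m.+1 -> nat) (B : 'I_m.+1 -> {fset int}) (n : nat -> nat).
Hypothesis N2 : forall j, (2 <= N j)%N.
Hypothesis n0 : forall k, (0 < n k)%N.
Variable rho : Omega -> probability R R.
Hypothesis rho_lim : forall w : codespace R m, weak_cvg (partial_conv N B n w) (rho w).

Lemma measurable_Rintegral_weak_limit (f : R -> R) (M : R) :
  continuous f -> (forall x, `|f x| <= M) ->
  measurable_fun [set: Omega] (fun w => (\int[rho w]_x (f x)%:E)%E).
Proof.
move=> cf fM; have mf : measurable_fun [set: R] f by exact: continuous_measurable_fun.
apply: (@emeasurable_fun_cvg _ _ _ _ (fun k (w : Omega) => (emp (@atoms R m N B n w k) f)%:E)).
  move=> k; apply/measurable_EFinP; apply: (@measurable_fun_cylinder _ k.+1) => w w' ww'.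
  by rewrite (@atoms_ext _ _ _ _ _ w w').
move=> w _; have ifn := integrable_of_le (rho w) mf fM.
rewrite -(fineK (integrable_fin_num measurableT ifn)).
apply: cvg_EFin; first by near=> k.
have := emp_atoms_cvg N2 n0 (@rho_lim w) cf fM; exact.
Unshelve. all: by end_near.
Qed.

(** The indicator of the half-line is a limit of continuous functions, whose
    integrals are limits of finite sums depending on finitely many letters. *)
Lemma measurable_weak_limit_ray (a : R) :
  measurable_fun [set: Omega] (fun w => rho w `]-oo, a[%classic).
Proof.
pose f (j : nat) (x : R) := clamp01 (j%:R * (a - x)).
have cf j : continuous (f j).
  have c1 : continuous (fun y : R => j%:R * (a - y)).
    move=> y; apply: cvgM; first exact: cvg_cst.
    by apply: cvgB; [exact: cvg_cst|exact: cvg_id].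
  move=> x; exact: (@continuous_comp _ _ _ _ _ x (c1 x) (@continuous_clamp01 R _)).
have fM j x : `|f j x| <= 1 by have /andP[p q] := clamp01_itv (j%:R * (a - x)); rewrite ger0_norm.
apply: (@emeasurable_fun_cvg _ _ _ _ (fun j w => (\int[rho w]_x (f j x)%:E)%E)).
  by move=> j; exact: measurable_Rintegral_weak_limit (cf j) (fM j).
move=> w _.
have mf j : measurable_fun [set: R] (fun x => (f j x)%:E).
  by apply/measurable_EFinP; exact: continuous_measurable_fun.
rewrite -(setIT `]-oo, a[%classic) -integral_indic//.
have [||||_ _ //] := @dominated_convergence _ _ _ (rho w) [set: R] measurableT
   (fun j x => (f j x)%:E) (fun x => (\1_(`]-oo, a[%classic) x)%:E) (fun=> 1%E) mf.
- by apply/measurable_EFinP; exact: measurable_indic.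
- apply: aeW => x _; apply: cvg_EFin; first by near=> j.
  rewrite indicE; case: (ltP x a) => xa.
    rewrite mem_set//=; apply: cvg_near_cst.
    exists (Num.truncn (a - x)^-1).+1 => // j /=; rewrite -(ler_nat R) => jx.
    rewrite /f /= clamp01_ge1//.
    have ax : 0 < a - x by rewrite subr_gt0.
    rewrite -ler_pdivrMr// div1r (le_trans _ jx)// ltW//; exact: truncnS_gt.
  rewrite memNset /=; last by rewrite /= in_itv/= ltNge xa.
  apply: cvg_near_cst; apply: nearW => j.
  by rewrite /f /= clamp01_le0// mulr_ge0_le0// subr_le0.
- exact: (integrable_cst1 (rho w)).
- by apply: aeW => x j _; rewrite /= lee_fin fM.
Unshelve. all: by end_near.
Qed.

(** No choice of the limits matters: integrals of bounded continuous functions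
    are determined by the partial convolutions, and a Dynkin argument extends
    measurability from half-lines to Borel sets. *)
Theorem random_measure_weak_limits : random_measure (fun w => rho w : {measure set R -> \bar R}).
Proof.
have mE : @measurable _ (measurableTypeR R) = <<s (@RGenInftyO.G R) >> := RGenInftyO.measurableE R.
pose P (A : set R) := measurable A /\ measurable_fun [set: Omega] (fun w => rho w A).
move=> A mA; suff [] : P A by [].
have {mA} : <<s (@RGenInftyO.G R) >> A by rewrite -mE.
move: A; apply: (dynkin_induction mE) => //.
- move=> _ _ [a ->] [b ->]; exists (Num.min a b).
  apply/seteqP; split => x /=; rewrite !in_itv/= lt_min; first by case=> -> ->.
  by move/andP.
- split; first exact: measurableT.
  rewrite (_ : (fun w => _) = cst 1%E); first exact: measurable_cst.
  by apply/funext => w; exact: (@probability_setT _ _ _ (rho w)).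
- by move=> _ [a ->]; split; [exact: measurable_itv|exact: measurable_weak_limit_ray].
- move=> S mS [mSR PS]; split; first exact: measurableC.
  rewrite (_ : (fun w => _) = (fun w => 1 - rho w S)%E); last first.
    by apply/funext => w; exact: probability_setC.
  by apply: emeasurable_funB => //; exact: measurable_cst.
move=> F mF tF PF; split; first exact: bigcupT_measurable.
rewrite (_ : (fun w => _) = (fun w => \sum_(0 <= k <oo) rho w (F k))%E); last first.
  by apply/funext => w; rewrite measure_semi_bigcup//; exact: bigcupT_measurable.
by apply: ge0_emeasurable_sum => // k _; have [] := PF k.
Qed.

End measurability_in_the_code.

(** * Good levels for unbounded exponents *)

Section good_levels_give_spectra.
Context (R : realType) (m : nat).
Context (N : 'I_m.+1 -> nat) (B : 'I_m.+1 -> {fset int}) (n : nat -> nat).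
Hypothesis hNB : forall k, admissible_pair R (N k) (B k).
Hypothesis B0 : forall k, 0 \in B k.
Hypothesis Bge0 : forall k b, b \in B k -> 0 <= b.
Hypothesis n0 : forall k, (0 < n k)%N.
Local Notation normc := (@Normc.normc R).

Lemma admissible_N2 j : (2 <= N j)%N.
Proof. by have [] := hNB j. Qed.

Lemma digit_bound : exists K : nat, forall j b, b \in B j -> `|b%:~R| <= K%:R :> R.
Proof.
exists (\max_(j < m.+1) \max_(b <- B j) `|b|%N) => j b bB.
rewrite -intr_norm -abszE -pmulrn ler_nat.
apply: leq_trans (leq_bigmax (F := fun j : 'I_m.+1 => (\max_(b <- B j) `|b|)%N) j).
by rewrite (big_rem b)//= leq_maxl.
Qed.

(** The frequencies of the pair (N, B) yield some for (N^n, B). *)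
Lemma code_parseval (w : codespace R m) i : exists L : seq int,
  0 \in L /\ @parseval_frequencies R (code_digits B w i) (code_base N n w i) L.
Proof.
have [L [L0 PL]] := admissible_parseval (hNB (w i)).
have N2 := admissible_N2 (w i).
exists [seq l * (N (w i) ^ (n i).-1)%N%:Z | l <- L]; split.
  by apply/mapP; exists 0; rewrite // mul0r.
by apply: parseval_pow => //; exact: leq_trans N2.
Qed.

(** The construction of frequencies along the good levels meets the hypotheses
    of the Parseval criterion. *)
Theorem spectral_of_good_levels (w : codespace R m) (nu : probability R R) (D : nat) (eps : R) :
  weak_cvg (partial_conv N B n w) nu ->
  (0 < D)%N -> (forall i b, b \in B (w i) -> (D %| b)%Z) -> 0 < eps ->
  (forall k0, exists k, (k0 <= k)%N /\
     @good_level R (code_base N n w) (code_digits B w) D k eps) ->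
  spectral_measure nu.
Proof.
move=> nulim D0 DB eps0 good.
have [K BK] := digit_bound.
have base2 := code_base_ge2 admissible_N2 n0 w.
have dB i b : b \in code_digits B w i -> `|b%:~R| <= K%:R :> R by exact: BK.
have d0 i : 0 \in code_digits B w i by exact: B0.
have flim := ft_mprod_cvg admissible_N2 n0 nulim.
have [Lam [h1 h2 h3 h4]] := spectrum_exists base2 (ler0n _ K) dB d0 D0 DB (code_parseval w) flim eps0 good.
apply: (spectral_of_parseval (ler0n R K) _ h1 h2 h3 h4).
exact: (weak_limit_support admissible_N2 n0 B0 Bge0 BK nulim).
Qed.

(** Compared with the bound at level a, the denominator gains the base of
    index a. When that base is huge, the tail is close to 1 on a whole period. *)
Lemma mprod_near0_succ (w : codespace R m) (K : R) a b xi :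
  0 <= K -> (forall j b, b \in B j -> `|b%:~R| <= K) -> (a <= b)%N ->
  1 - 8 * pi * K * `|xi| / (nprod (code_base N n w) 0 a.+1)%:R <=
  normc (mprod (code_base N n w) (code_digits B w) a b xi).
Proof.
move=> K0 BK.
have base2 := code_base_ge2 admissible_N2 n0 w.
have P0 := nprodR_gt0 R base2 0 a.+1.
rewrite leq_eqVlt => /predU1P[<-|ab].
  by rewrite mprod_nil Normc.normc1 gerBl divr_ge0 ?ler0n// !mulr_ge0 ?pi_ge0.
have d0 i : 0 \in code_digits B w i by exact: B0.
have dB i c : c \in code_digits B w i -> `|c%:~R| <= K by exact: BK.
rewrite (@mprod_cat _ _ _ a.+1)// /mprod big_nat1 -/(mprod _ _ a.+1 b xi).
set x := maskf _ _; set y := mprod _ _ _ _ _.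
have y1 := normc_mprod_le1 (code_base N n w) (code_digits B w) a.+1 b xi.
have x1 : normc x <= 1 by exact: normc_maskf_le1.
have hy : 1 - 4 * pi * K * `|xi| / (nprod (code_base N n w) 0 a.+1)%:R <= normc y.
  exact: mprod_near0.
have hx : normc (1 - x) <= 4 * pi * K * `|xi| / (nprod (code_base N n w) 0 a.+1)%:R.
  have <- : maskf (code_digits B w a) 0 = 1 :> R[i].
    by rewrite maskf0//; have := d0 a; case: (code_digits B w a).
  rewrite (le_trans (maskf_lip _ _ K0 (dB a)))// sub0r normrN normrM -mulrA.
  by rewrite (@ger0_norm _ _^-1) ?invr_ge0 ?ler0n// !mulrA.
have h1 : normc 1 <= normc (1 - x) + normc x by rewrite -{1}(subrK x 1) le_normcD.
rewrite Normc.normc1 in h1.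
rewrite Normc.normcM.
have : normc y <= 1 by [].
set A := 4 * pi * K * `|xi| / _ in hx hy *.
have -> : 8 * pi * K * `|xi| / (nprod (code_base N n w) 0 a.+1)%:R = 2 * A.
  by rewrite /A; ring.
move=> y1'; have := normc_ge0 x; have := normc_ge0 y => yy xx.
have : (1 - normc x) * normc y <= 1 - normc x by rewrite ler_piMr// subr_ge0.
by lra.
Qed.

(** Just before a large exponent n k, the first factor of the tail already has
    the scale N^(n k): every class modulo 1 has a representative in [0, 1[, at
    which the whole tail is within 1/2 of 1. *)
Lemma good_levels_of_unbounded (w : codespace R m) : (forall b, exists k, (b < n k)%N) ->
  forall k0, exists k, (k0 <= k)%N /\
     @good_level R (code_base N n w) (code_digits B w) 1 k (1 / 2).
Proof.
move=> unb k0; have [K BK] := digit_bound.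
have base2 := code_base_ge2 admissible_N2 n0 w.
set c : R := 16 * pi * K%:R.
have [k nk] := unb (maxn (Num.truncn c).+1 (\max_(j < k0) n j)).
have kk : (k0 <= k)%N.
  rewrite leqNgt; apply/negP => k1.
  have : (n k <= \max_(j < k0) n j)%N by exact: (leq_bigmax (F := fun j : 'I_k0 => n j) (Ordinal k1)).
  by rewrite leqNgt (leq_ltn_trans _ nk)// leq_maxr.
exists k; split=> // x; exists (- Num.floor x) => b kb.
have cN : c <= (code_base N n w k)%:R.
  rewrite (le_trans (ltW (truncnS_gt c)))// ler_nat.
  rewrite (leq_trans _ (leq_trans (ltnW nk) _)) ?leq_maxl//.
  by rewrite (leq_trans (ltnW (ltn_expl (n k) (ltnSn 1))))// /code_base leq_exp2r// admissible_N2.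
apply: (le_trans _ (mprod_near0_succ w _ (ler0n R K) BK kb)).
have P0 := nprodR_gt0 R base2 0 k; have P1 := nprodR_gt0 R base2 0 k.+1.
set y := x + _; have y1 : `|y| <= 1.
  rewrite /y divr1 rmorphN /= ger0_norm; last by rewrite subr_ge0 ge_floor.
  by rewrite lerBlDl ltW// -intrD1 lt_succ_floor.
rewrite normrM (ger0_norm (ltW P0)) nprod_recr// natrM.
have N0 : 0 < (code_base N n w k)%:R :> R by rewrite ltr0n (leq_trans _ (base2 k)).
have -> : 8 * pi * K%:R * ((nprod (code_base N n w) 0 k)%:R * `|y|) /
    ((nprod (code_base N n w) 0 k)%:R * (code_base N n w k)%:R)
   = (c * `|y|) / (code_base N n w k)%:R / 2.
  by rewrite /c; field; rewrite ?gt_eqF.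
have : c * `|y| / (code_base N n w k)%:R <= 1.
  rewrite ler_pdivrMr// mul1r (le_trans _ cN)// ler_piMr//.
  by rewrite !mulr_ge0 ?pi_ge0.
lra.
Qed.

End good_levels_give_spectra.

(** * The tree of translates with nonvanishing mask product *)

Section digit_tree.
Context (R : realType) (Ns : nat -> nat) (Bs : nat -> seq int).
Local Open Scope complex_scope.
Local Notation C := (R[i]).
Local Notation nprod := (nprod Ns).
Local Notation mprod := (@mprod R Ns Bs).
Hypothesis Ns2 : forall i, (2 <= Ns i)%N.
Hypothesis Bu : forall i, uniq (Bs i).
Hypothesis B0 : forall i, 0 \in Bs i.
Hypothesis Bge0 : forall i b, b \in Bs i -> 0 <= b.
Variable D : nat.
Hypothesis D0 : (0 < D)%N.
Hypothesis DB : forall i b, b \in Bs i -> (D %| b)%Z.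
Hypothesis hL : forall i, exists L : seq int, 0 \in L /\ @parseval_frequencies R (Bs i) (Ns i) L.

Let DR0 : D%:R != 0 :> R. Proof. by rewrite pnatr_eq0 -lt0n. Qed.
Let NR0 i : (Ns i)%:R != 0 :> R. Proof. by rewrite pnatr_eq0 -lt0n (leq_trans _ (Ns2 i)). Qed.

Lemma maskf_periodD i x (t : int) : maskf (Bs i) (x + t%:~R / D%:R) = maskf (Bs i) x :> C.
Proof.
apply: maskf_period => b /DB /dvdzP[q ->].
have -> : (q * D)%:~R * (t%:~R / D%:R) = q%:~R * t%:~R :> R.
  by rewrite intrM -pmulrn; field.
by rewrite rpredM ?intr_int.
Qed.

(** Since masks have period 1/D, a frequency l/N may be replaced by r/(D N)
    with 0 <= r < N, where r is D l modulo N. *)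
Definition residue i (l : int) : nat := `|((D%:Z * l) %% (Ns i)%:Z)%Z|%N.

Lemma residue_lt i l : (residue i l < Ns i)%N.
Proof.
have N0 : (Ns i)%:Z != 0 by rewrite eqz_nat -lt0n (leq_trans _ (Ns2 i)).
rewrite /residue -ltz_nat gez0_abs ?modz_ge0//.
by rewrite (lt_le_trans (ltz_mod _ N0))// ger0_norm.
Qed.

Lemma maskf_residue i x l :
  maskf (Bs i) (x + l%:~R / (Ns i)%:R) = maskf (Bs i) (x + (residue i l)%:R / (D%:R * (Ns i)%:R)) :> C.
Proof.
have N0 : (Ns i)%:Z != 0 by rewrite eqz_nat -lt0n (leq_trans _ (Ns2 i)).
rewrite -(maskf_periodD i (x + (residue i l)%:R / (D%:R * (Ns i)%:R)) (D%:Z * l %/ (Ns i)%:Z)%Z).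
congr (maskf _ _); rewrite -addrA; congr (_ + _).
have -> : (residue i l)%:R = ((D%:Z * l) %% (Ns i)%:Z)%Z%:~R :> R.
  by rewrite /residue pmulrn gez0_abs// modz_ge0.
have : ((D%:Z * l)%:~R : R) = (D%:Z * l %/ (Ns i)%:Z)%Z%:~R * (Ns i)%:R + ((D%:Z * l) %% (Ns i)%:Z)%Z%:~R.
  by rewrite {1}(divz_eq (D%:Z * l) (Ns i)%:Z) intrD intrM -pmulrn.
rewrite intrM -pmulrn => e.
have -> : l%:~R = D%:R * l%:~R / D%:R :> R by field.
by rewrite e; field; rewrite DR0 NR0.
Qed.

(** The Parseval sum is 1, so one of its terms is nonzero. *)
Lemma maskf_child i (x : R) : exists2 l : nat, (l < Ns i)%N &
  maskf (Bs i) (x + l%:R / (D%:R * (Ns i)%:R)) != 0 :> C.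
Proof.
have [L [L0 PL]] := hL i.
have [/hasP[l lL ml]|/hasPn nL] := boolP (has (fun l => maskf (Bs i) (x + l%:~R / (Ns i)%:R) != 0 :> C) L).
  by exists (residue i l); [exact: residue_lt|rewrite -maskf_residue].
have := PL x; rewrite big1_seq; first by move/esym/eqP; rewrite oner_eq0.
by move=> l /= lL; have := nL l lL; rewrite negbK => /eqP ->; rewrite nsq0.
Qed.

(** If a single residue is allowed, all nonzero terms of the Parseval sum have
    the same value. Two of them are impossible: the Parseval sum at the
    opposite of one frequency would contain the value 1 twice. Hence the
    single remaining term is 1. *)
Lemma maskf_only_child i (x : R) (l0 : nat) :
  (forall l : nat, (l < Ns i)%N -> maskf (Bs i) (x + l%:R / (D%:R * (Ns i)%:R)) != 0 :> C -> l = l0) ->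
  nsq (maskf (Bs i) (x + l0%:R / (D%:R * (Ns i)%:R)) : C) = 1.
Proof.
move=> H; have [L [L0 PL]] := hL i.
have [/hasP[l lL ml]|/hasPn nL] := boolP (has (fun l => maskf (Bs i) (x + l%:~R / (Ns i)%:R) != 0 :> C) L); last first.
  have := PL x; rewrite big1_seq; first by move/esym/eqP; rewrite oner_eq0.
  by move=> l /= lL; have := nL l lL; rewrite negbK => /eqP ->; rewrite nsq0.
have resE l' : maskf (Bs i) (x + l'%:~R / (Ns i)%:R) != 0 :> C -> residue i l' = l0.
  by rewrite maskf_residue => /H; apply; exact: residue_lt.
have := PL x; rewrite (big_rem l)//= maskf_residue (resE l ml) big1_seq ?addr0//.
move=> l' /= l'r; apply: contrapT => /eqP h.
have ml' : maskf (Bs i) (x + l'%:~R / (Ns i)%:R) != 0 :> C.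
  by apply: contra h => /eqP ->; rewrite nsq0.
have := PL (- (l%:~R / (Ns i)%:R)); rewrite (big_rem l)//= addNr (big_rem l')//=.
have B0s : (0 < size (Bs i))%N by have := B0 i; case: (Bs i).
rewrite maskf_residue (resE l' ml') -(resE l ml) -maskf_residue addNr maskf0// nsq1.
move=> e; have : 0 <= \sum_(y <- rem l' (rem l L)) nsq (maskf (Bs i) (- (l%:~R / (Ns i)%:R) + y%:~R / (Ns i)%:R) : C).
  by apply: sumr_ge0 => *; exact: nsq_ge0.
move: e; lra.
Qed.

Variable u : R.
Hypothesis u01 : 0 <= u < 1.

Definition child_ok i (K l : nat) : bool :=
  maskf (Bs i) ((u + K%:R) / (D%:R * (nprod 0 i.+1)%:R) + l%:R / (D%:R * (Ns i)%:R)) != 0 :> C.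

Definition children i K : seq nat := [seq l <- iota 0 (Ns i) | child_ok i K l].

(** The translates (u + K)/D with K < P(i) at which the product of the first i
    masks does not vanish, organized as a tree: an integer K extends to K +
    P(i) l, which leaves the earlier masks unchanged. *)
Fixpoint nodes i : seq nat := if i is i'.+1 then
  [seq (K + nprod 0 i' * l)%N | K <- nodes i', l <- children i' K] else [:: 0%N].

Lemma childE i K l : (u + (K + nprod 0 i * l)%:R) / D%:R / (nprod 0 i.+1)%:R =
  (u + K%:R) / (D%:R * (nprod 0 i.+1)%:R) + l%:R / (D%:R * (Ns i)%:R) :> R.
Proof.
have := nprodR_neq0 R Ns2 0 i => p0.
by rewrite nprod_recr// natrM natrD natrM; field; rewrite DR0 NR0 p0.
Qed.

Lemma nodesP i : uniq (nodes i) /\ forall K, K \in nodes i ->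
  (K < nprod 0 i)%N /\ mprod 0 i ((u + K%:R) / D%:R) != 0.
Proof.
elim: i => [|i [IHu IH]].
  split => // K; rewrite inE => /eqP ->; rewrite /nprod big_geq//; split=> //.
  by rewrite mprod_nil oner_eq0.
split.
  apply: allpairs_uniq_dep => //.
    by move=> K _; rewrite filter_uniq ?iota_uniq.
  move=> [K l] [K' l'] /allpairsPdep[K1 [l1 [/IH[KP _] _ E1]]].
  move=> /allpairsPdep[K2 [l2 [/IH[K'P _] _ E2]]] /=.
  move: (congr1 (@projT1 _ _) E1) (congr1 (@projT1 _ _) E2) => /=.
  move=> eK1 eK2; rewrite -{}eK1 in KP; rewrite -{}eK2 in K'P => {E1 E2} e.
  have eK : K = K'.
    have := congr1 (modn^~ (nprod 0 i)) e.
    by rewrite !(mulnC (nprod 0 i)) !(addnC _ (_ * _)%N) !modnMDl !modn_small.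
  move: e; rewrite eK => /addnI /eqP; rewrite eqn_pmul2l; last exact: nprod_gt0.
  by move=> /eqP ->.
move=> K' /= /allpairsPdep[K [l [/IH[KP mK]]]]; rewrite mem_filter mem_iota /= add0n => /andP[cl lN ->].
split.
  rewrite nprod_recr// -addSn (leq_trans (leq_add KP (leqnn _)))//.
  by rewrite -mulnS leq_mul2l lN orbT.
rewrite mprod_recr// mulf_neq0//; last by rewrite childE.
rewrite natrD natrM addrA mulrDl.
rewrite (_ : _ + _ / D%:R = (u + K%:R) / D%:R + (nprod 0 i)%:R * (l%:Z%:~R / D%:R)); last first.
  by rewrite -pmulrn mulrA.
by rewrite mprod_period.
Qed.

Lemma children_gt0 i K : (0 < size (children i K))%N.
Proof.
have [l lN ml] := maskf_child i ((u + K%:R) / (D%:R * (nprod 0 i.+1)%:R)).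
have : l \in children i K by rewrite mem_filter /child_ok ml mem_iota.
by case: (children i K).
Qed.

Lemma size_nodesS i : size (nodes i.+1) = (\sum_(K <- nodes i) size (children i K))%N.
Proof. by rewrite /= size_allpairs_dep sumnE big_map. Qed.

Lemma leq_size_nodesS i : (size (nodes i) <= size (nodes i.+1))%N.
Proof. by rewrite size_nodesS -sum1_size leq_sum// => K _; exact: children_gt0. Qed.

(** Every node has at least one child. *)
Lemma leq_size_nodes i j : (i <= j)%N -> (size (nodes i) <= size (nodes j))%N.
Proof. by move=> /subnKC <-; elim: (j - i)%N => [|k /leq_trans]; rewrite ?addn0 ?addnS//; apply; exact: leq_size_nodesS. Qed.

(** A level with no growth has exactly one child for each node; the mask of
    modulus 1 at this child makes all the multiples by digits integral. *)
Lemma only_child i K : size (nodes i.+1) = size (nodes i) -> K \in nodes i ->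
  exists2 l, (K + nprod 0 i * l)%N \in nodes i.+1 &
   forall b, b \in Bs i ->
     b%:~R * ((u + (K + nprod 0 i * l)%:R) / D%:R / (nprod 0 i.+1)%:R) \is a Num.int.
Proof.
move=> eqs Kn.
have ch1 : size (children i K) = 1%N.
  apply/eqP; rewrite eqn_leq children_gt0 andbT leqNgt; apply/negP => c2.
  have : (size (nodes i) < size (nodes i.+1))%N.
    rewrite size_nodesS -sum1_size (big_rem K)//= [X in (_ < X)%N](big_rem K)//=.
    by rewrite -addSn leq_add// leq_sum// => K' _; exact: children_gt0.
  by rewrite eqs ltnn.
case E : (children i K) ch1 => [//|l [|//]] _.
have lc : l \in children i K by rewrite E mem_head.
exists l; first by apply/allpairsPdep; exists K, l.
move=> b bB; rewrite childE; apply: (maskf_nsq1 (Bu i) (B0 i)) => //.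
apply: maskf_only_child => l' l'N ml'.
have : l' \in children i K by rewrite mem_filter /child_ok ml' mem_iota.
by rewrite E inE => /eqP.
Qed.

(** Following the unique descendants of K through a run of levels without
    growth: the integrality obtained at each descendant is multiplied by the
    bases in between and so pulled back to the single point (u + K)/(D P(a)). *)
Lemma constant_run a r K : size (nodes (a + r)) = size (nodes a) -> K \in nodes a ->
  forall i, (a <= i < a + r)%N -> forall b, b \in Bs i ->
    b%:~R * ((u + K%:R) / D%:R / (nprod 0 a)%:R) \is a Num.int.
Proof.
move=> eqs Kn.
have P0 := nprodR_neq0 R Ns2 0 a.
suff H k : (k <= r)%N -> exists2 q, (K + nprod 0 a * q)%N \in nodes (a + k) &
    forall i, (a <= i < a + k)%N -> forall b, b \in Bs i ->
      b%:~R * ((u + K%:R) / D%:R / (nprod 0 a)%:R) \is a Num.int.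
  by have [] := H r (leqnn r).
elim: k => [|k IH] kr.
  exists 0%N; first by rewrite muln0 !addn0.
  by move=> i; rewrite addn0 => /andP[/leq_ltn_trans h /h]; rewrite ltnn.
have [q qn Hq] := IH (ltnW kr).
have eqk : size (nodes (a + k).+1) = size (nodes (a + k)).
  apply/eqP; rewrite eqn_leq leq_size_nodesS andbT.
  rewrite (leq_trans (leq_size_nodes (_ : _ <= a + r)%N)) ?ltn_add2l// eqs.
  by rewrite leq_size_nodes// leq_addr.
have [l ln Hl] := only_child eqk qn.
exists (q + nprod a (a + k) * l)%N.
  by rewrite addnS mulnDr addnA mulnA -nprod_cat ?leq_addr.
move=> i; rewrite addnS ltnS => /andP[ai]; rewrite leq_eqVlt => /predU1P[->|ilt] b bB; last first.
  by apply: (Hq i _ b bB); rewrite ai.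
have /dvdzP[c bc] := DB bB.
have := Hl b bB.
have -> : b%:~R * ((u + K%:R) / D%:R / (nprod 0 a)%:R) =
   b%:~R * ((u + (K + nprod 0 a * q + nprod 0 (a + k) * l)%:R) / D%:R / (nprod 0 (a + k).+1)%:R)
     * (nprod a (a + k).+1)%:R - (c * q%:Z + c * (nprod a (a + k) * l)%:Z)%:~R :> R.
  have P1 := nprodR_neq0 R Ns2 a (a + k).+1.
  rewrite (@nprod_cat _ a 0 (a + k).+1) ?(@nprod_cat _ a 0 (a + k)) ?leq_addr// ?leqW ?leq_addr//.
  rewrite bc !intrM !intrD !intrM -!pmulrn !natrD !natrM.
  by field; rewrite DR0 P0 P1.
move=> h; rewrite rpredB ?intr_int//.
by rewrite rpredM// natr_int.
Qed.

Variable r : nat.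
Hypothesis run : forall j (y : R),
  (forall i, (j <= i < j + r)%N -> forall b, b \in Bs i -> b%:~R * y \is a Num.int) ->
  D%:R * y \is a Num.int.

(** A run long enough to see all the digits makes (u + K)/P(a) an integer; it
    lies in [0, 1[, so it is 0. *)
Lemma constant_run_u0 a : size (nodes (a + r)) = size (nodes a) -> u = 0.
Proof.
move=> eqs.
have s0 : (0 < size (nodes a))%N by apply: leq_trans (leq_size_nodes (leq0n a)).
have Kn : nth 0%N (nodes a) 0 \in nodes a by exact: mem_nth.
move: (nth _ _ _) Kn => K Kn.
have := run (constant_run eqs Kn).
have [KP _] := (nodesP a).2 _ Kn.
have P0 := nprodR_gt0 R Ns2 0 a.
have -> : D%:R * ((u + K%:R) / D%:R / (nprod 0 a)%:R) = (u + K%:R) / (nprod 0 a)%:R.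
  by field; rewrite DR0 gt_eqF.
case/andP: u01 => u0 u1 /intrP[z hz].
have z0 : (0 : int) <= z by rewrite -(ler_int R) -hz divr_ge0 ?addr_ge0 ?ler0n.
have z1 : z < 1.
  rewrite -(ltr_int R) -hz ltr_pdivrMr// mul1r.
  have : K.+1%:R <= (nprod 0 a)%:R :> R by rewrite ler_nat.
  by rewrite -natr1; lra.
have zE : z = 0 by lia.
move: hz; rewrite zE => /eqP; rewrite mulf_eq0 invr_eq0 (gt_eqF P0) orbF.
have : 0 <= K%:R :> R by []. 
by move=> h /eqP; lra.
Qed.

(** For u <> 0, the number of nodes grows at least by one every r levels. *)
Lemma size_nodes_run k : u != 0 -> (k < size (nodes (k * r)))%N.
Proof.
move=> u0; elim: k => [//|k IH]; apply: (leq_ltn_trans IH).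
rewrite ltn_neqAle leq_size_nodes ?leq_mul2r ?leqnSn ?orbT// andbT.
apply/eqP => e; move/eqP: u0; apply; apply: (@constant_run_u0 (k * r)).
by rewrite e mulSn addnC.
Qed.

Variables (bmax Nmax : nat).
Hypothesis Bmax : forall i b, b \in Bs i -> (`|b| <= bmax)%N.
Hypothesis NsMax : forall i, (Ns i <= Nmax)%N.

(** A bound for the degree of the polynomial below, the same for all data with
    these bounds on digits and bases. *)
Definition zero_bound i0 := (i0 * (bmax * Nmax ^ i0))%N.

(** The masks with indices q to q + i0 - 1, up to constant factors, are
    polynomials in the single exponential of (u + K)/P(q + i0). *)
Definition tail_poly q i0 : {poly C} := \prod_(q <= i < q + i0)
  \sum_(b <- Bs i) 'X^(`|b|%N %/ D * nprod i.+1 (q + i0)).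

Lemma size_prod_bound (T : eqType) (s : seq T) (F : T -> {poly C}) d :
  (forall i, i \in s -> (size (F i) <= d.+1)%N) ->
  (size (\prod_(i <- s) F i)%R <= (size s * d).+1)%N.
Proof.
elim: s => [|i s IH] Fd; first by rewrite big_nil size_poly1.
rewrite big_cons (leq_trans (size_polyMleq _ _))//= mulSn.
have Fi := Fd i (mem_head _ _).
have {}IH := IH (fun j js => Fd j (mem_behead (s := i :: s) js)).
by move: (size (F i)) (size (polyseq (\prod_(j <- s) _))) Fi IH => x y; lia.
Qed.

Lemma nprod_le_exp a k : (nprod a (a + k) <= Nmax ^ k)%N.
Proof.
elim: k => [|k IH]; first by rewrite addn0 /nprod big_geq.
by rewrite addnS nprod_recr ?leq_addr// expnSr leq_mul.
Qed.

Lemma size_tail_poly q i0 : (size (tail_poly q i0) <= (zero_bound i0).+1)%N.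
Proof.
rewrite (leq_trans (@size_prod_bound _ _ _ (bmax * Nmax ^ i0) _))//; last first.
  by rewrite size_iota addKn.
move=> i; rewrite mem_index_iota => /andP[qi iq].
rewrite (leq_trans (size_sum _ _ _))//; apply/bigmax_leqP_seq => b bB _.
rewrite size_polyXn ltnS leq_mul// ?(leq_trans (leq_div _ _))// ?(Bmax bB)//.
have -> : (q + i0 = i.+1 + (q + i0 - i.+1))%N by rewrite subnKC.
rewrite (leq_trans (nprod_le_exp _ _))// leq_pexp2l//; last by lia.
by rewrite (leq_trans _ (NsMax 0))// ltnW.
Qed.

Lemma tail_poly_neq0 q i0 : tail_poly q i0 != 0.
Proof.
have : (tail_poly q i0).[1] != 0.
  rewrite horner_prod prodf_seq_neq0; apply/allP => i _ /=.
  rewrite horner_sum (eq_bigr (fun=> 1)) => [|b _]; last by rewrite hornerXn expr1n.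
  rewrite big_const_seq count_predT iter_addr_0 pnatr_eq0.
  by have := B0 i; case: (Bs i).
by apply: contra => /eqP ->; rewrite horner0.
Qed.

Definition node_point q i0 (K : nat) : C :=
  expi (2 * pi * ((u + K%:R) / (nprod 0 (q + i0))%:R)).

Lemma node_point_inj q i0 : {in nodes q &, injective (node_point q i0)}.
Proof.
move=> K K' /(nodesP q).2[KP _] /(nodesP q).2[KP' _] e.
have P0 := nprodR_gt0 R Ns2 0 (q + i0).
have PP : (nprod 0 q <= nprod 0 (q + i0))%N.
  by rewrite (@nprod_cat _ q 0 (q + i0)) ?leq_addr// leq_pmulr// nprod_gt0.
have : expi (2 * pi * ((K%:R - K'%:R) / (nprod 0 (q + i0))%:R)) = 1 :> C.
  have -> : 2 * pi * ((K%:R - K'%:R) / (nprod 0 (q + i0))%:R) =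
     2 * pi * ((u + K%:R) / (nprod 0 (q + i0))%:R) - 2 * pi * ((u + K'%:R) / (nprod 0 (q + i0))%:R) :> R.
    by ring.
  rewrite expiD -/(node_point q i0 K) e /node_point -expiD subrr expi0//.
move/expi_eq1/intrP => [z hz].
have KR : K%:R - K'%:R = z%:~R * (nprod 0 (q + i0))%:R :> R by rewrite -hz divfK ?gt_eqF.
have : (K%:Z - K'%:Z) = z * (nprod 0 (q + i0))%:Z.
  by apply/(@intr_inj R); rewrite intrM rmorphB /= -!pmulrn.
move: (nprod 0 q) (nprod 0 (q + i0)) KP KP' PP => P P' KP KP' PP eqz.
have [z0|z1|z1] : [\/ z = 0, 1 <= z | z <= -1] by case: (ltgtP z 0) => h; [constructor 3|constructor 2|constructor 1]; lia.
- by move: eqz; rewrite z0 mul0r; lia.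
- by have h : P'%:Z <= z * P'%:Z by [rewrite ler_peMl]; lia.
- by have h : z * P'%:Z <= - P'%:Z by [rewrite -mulN1r ler_wpM2r]; lia.
Qed.

Lemma tail_root q i0 K : mprod q (q + i0) ((u + K%:R) / D%:R) = 0 ->
  root (tail_poly q i0) (node_point q i0 K).
Proof.
move=> /eqP; rewrite prodf_seq_eq0 => /hasP [k]; rewrite mem_index_iota => /andP[qk kq] /= m0.
rewrite /root horner_prod prodf_seq_eq0; apply/hasP; exists k; first by rewrite mem_index_iota qk kq.
rewrite /= horner_sum.
have B0s : (0 < size (Bs k))%N by have := B0 k; case: (Bs k).
move: m0; rewrite /maskf mulf_eq0 invr_eq0 pnatr_eq0 eqn0Ngt B0s /=.
congr (_ == 0); rewrite big_seq [RHS]big_seq; apply: eq_bigr => b bB.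
rewrite hornerXn -expiMn; congr expi.
have bE : b%:~R = (`|b| %/ D)%:R * D%:R :> R.
  rewrite -natrM divnK; first by rewrite pmulrn gez0_abs// (Bge0 bB).
  by have := DB bB; rewrite dvdzE.
have P1 := nprodR_neq0 R Ns2 0 k.+1; have P2 := nprodR_neq0 R Ns2 k.+1 (q + i0).
rewrite bE natrM (@nprod_cat _ k.+1 0 (q + i0))// natrM.
by field; rewrite DR0 P1 P2.
Qed.

(** At level q there are more nodes than the polynomial of the next i0 masks
    has roots, and distinct nodes give distinct points on the unit circle. So
    some node survives i0 further levels. For u = 0 the node K = 0 survives
    forever. *)
Lemma tree_avoids_zeros i0 : let q := (zero_bound i0 * r)%N in
  exists2 K, (K < nprod 0 q)%N & mprod 0 (q + i0) ((u + K%:R) / D%:R) != 0.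
Proof.
move=> q; have [uE|u0] := eqVneq u 0.
  exists 0%N; first exact: nprod_gt0.
  by rewrite uE add0r mul0r mprod0 ?oner_eq0.
have [/hasP[K Kn mK]|/hasPn nK] := boolP (has (fun K : nat => mprod q (q + i0) ((u + K%:R) / D%:R) != 0) (nodes q)).
  have [KP m0] := (nodesP q).2 _ Kn.
  by exists K => //; rewrite (@mprod_cat _ _ _ q) ?leq_addr// mulf_neq0.
have := size_nodes_run (zero_bound i0) u0; rewrite -/q ltnNge => /negP[].
rewrite -ltnS (leq_trans _ (size_tail_poly q i0))//.
rewrite -(size_map (node_point q i0)); apply: max_poly_roots.
- exact: tail_poly_neq0.
- apply/allP => _ /mapP[K Kn ->]; apply: tail_root.
  by have := nK K Kn; rewrite negbK => /eqP.
- by rewrite map_inj_in_uniq; [exact: (nodesP q).1|exact: node_point_inj].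
Qed.

End digit_tree.

(** * Recurrent words give good levels *)

Lemma nprod_nil Ns a : nprod Ns a a = 1%N.
Proof. by rewrite /nprod big_geq. Qed.

(** D is the greatest common divisor; the Bezout relation recovers D y from
    the integers b y. *)
Lemma common_digit_divisor (R : realType) (s : seq int) : exists D : nat,
  (forall b, b \in s -> (D %| b)%Z) /\
  forall y : R, (forall b, b \in s -> b%:~R * y \is a Num.int) -> D%:R * y \is a Num.int.
Proof.
elim: s => [|a s [D [DB Dy]]].
  by exists 0%N; split=> // y _; rewrite mul0r rpred0.
exists (gcdn `|a| D); split.
  move=> b; rewrite in_cons => /predU1P[->|/DB Db].
    by rewrite dvdzE dvdn_gcdl.
  by rewrite (dvdz_trans _ Db)// dvdzE dvdn_gcdr.
move=> y ysat; have [v [z e]] := Bezoutz a D.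
have -> : (gcdn `|a| D)%:R = (gcdz a D)%:~R :> R by [].
rewrite -e intrD !intrM mulrDl -!mulrA rpredD// rpredM ?intr_int//.
  by rewrite ysat// mem_head.
by apply: Dy => b bs; apply: ysat; rewrite in_cons bs orbT.
Qed.

Lemma normc_dist (R : realType) (z w : R[i]) :
  `|Normc.normc z - Normc.normc w| <= Normc.normc (z - w).
Proof.
have h z' w' : Normc.normc z' - Normc.normc w' <= Normc.normc (z' - w') :> R.
  by rewrite lerBlDr -{1}(subrK w' z') le_normcD.
by rewrite ler_norml h andbT lerNl opprB normcB h.
Qed.

Lemma lipschitz_continuous (R : realType) (f : R -> R) (c : R) :
  (forall x y, `|f x - f y| <= c * `|x - y|) -> continuous f.
Proof.
move=> fl x; apply/cvgrPdist_lt => e e0; near=> y.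
rewrite (le_lt_trans (fl x y))//.
have c0 : 0 < `|c| + 1 by rewrite ltr_wpDl.
apply: (@le_lt_trans _ _ ((`|c| + 1) * `|x - y|)).
  by rewrite ler_wpM2r// (le_trans (ler_norm c))// lerDl.
rewrite -ltr_pdivlMl//; near: y; apply: cvgr_dist_lt => //.
by rewrite mulr_gt0// invr_gt0.
Unshelve. all: by end_near. Qed.

(** The sum of the functions is continuous and positive on [0, 1], so it has a
    positive minimum, and one of the terms carries its share. *)
Lemma lipschitz_cover_lower_bound (R : realType) (k : nat) (f : 'I_k -> R -> R) (c : R) :
  (forall j x y, `|f j x - f j y| <= c * `|x - y|) ->
  (forall j x, 0 <= f j x) ->
  (forall x, 0 <= x <= 1 -> exists j, 0 < f j x) ->
  exists2 e, 0 < e & forall x, 0 <= x <= 1 -> exists j, e <= f j x.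
Proof.
move=> fl f0 fpos.
pose g x := \sum_j f j x.
have gl x y : `|g x - g y| <= (c *+ k) * `|x - y|.
  rewrite /g -sumrB (le_trans (ler_norm_sum _ _ _))//.
  rewrite (le_trans (ler_sum _ (fun j _ => fl j x y)))//.
  by rewrite sumr_const card_ord mulrnAl.
have [x0 x01 x0min] : exists2 x0, x0 \in `[0, 1] & forall t, t \in `[0, 1] -> g x0 <= g t.
  by apply: EVT_min => //; apply: continuous_subspaceT; exact: lipschitz_continuous gl.
have g0 : 0 < g x0.
  move: x01; rewrite in_itv /= => /fpos[j fj].
  by rewrite /g (bigD1 j)//= ltr_wpDr// sumr_ge0.
exists (g x0 / k.+1%:R); first by rewrite divr_gt0.
move=> x x01'; apply: contrapT => /forallNP nex.
have : g x <= g x0 / k.+1%:R *+ k.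
  rewrite /g -[X in _ <= _ *+ X]card_ord -sumr_const ler_sum// => j _.
  by have /negP := nex j; rewrite -ltNge => /ltW.
have : g x0 <= g x by apply: x0min; rewrite in_itv.
move=> h1 h2; have := le_trans h1 h2; rewrite -mulr_natr -mulrA ler_pMr//.
rewrite mulrC ler_pdivlMr// mul1r ler_nat ltnn //.
Qed.

Lemma finite_min_bound (R : realType) (I : finType) (P : I -> R -> Prop) :
  (forall i e e', e' <= e -> P i e -> P i e') -> (forall i, exists2 e, 0 < e & P i e) ->
  exists2 e, 0 < e & forall i, P i e.
Proof.
move=> Pdown Pex.
have H (s : seq I) : exists2 e, 0 < e & forall i, i \in s -> P i e.
  elim: s => [|i s [e e0 He]]; first by exists 1.
  have [e' e'0 He'] := Pex i.
  exists (Num.min e e'); first by rewrite lt_min e0.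
  move=> j; rewrite in_cons => /predU1P[->|js].
    by apply: Pdown He'; rewrite ge_min lexx orbT.
  by apply: Pdown (He j js); rewrite ge_min lexx.
have [e e0 He] := H (enum I); exists e => // i.
by apply: He; rewrite mem_enum.
Qed.

Section uniform_lower_bound.
Context (R : realType) (Ns : nat -> nat) (Bs : nat -> seq int).
Local Open Scope complex_scope.
Local Notation C := (R[i]).
Local Notation normc := (@Normc.normc R).
Local Notation nprod := (nprod Ns).
Local Notation mprod := (@mprod R Ns Bs).
Hypothesis Ns2 : forall i, (2 <= Ns i)%N.
Hypothesis Bu : forall i, uniq (Bs i).
Hypothesis B0 : forall i, 0 \in Bs i.
Hypothesis Bge0 : forall i b, b \in Bs i -> 0 <= b.
Variable D : nat.
Hypothesis D0 : (0 < D)%N.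
Hypothesis DB : forall i b, b \in Bs i -> (D %| b)%Z.
Hypothesis hL : forall i, exists L : seq int, 0 \in L /\ @parseval_frequencies R (Bs i) (Ns i) L.
Variable r : nat.
Hypothesis run : forall j (y : R),
  (forall i, (j <= i < j + r)%N -> forall b, b \in Bs i -> b%:~R * y \is a Num.int) ->
  D%:R * y \is a Num.int.
Variables (bmax Nmax : nat).
Hypothesis Bmax : forall i b, b \in Bs i -> (`|b| <= bmax)%N.
Hypothesis NsMax : forall i, (Ns i <= Nmax)%N.

(** The point D x is reduced to u in [0, 1[. To use compactness the interval
    is closed at 1, where u = 1 is treated as u = 0 with K replaced by K + 1;
    the indices are therefore shifted by one, K = j - 1. *)
Lemma uniform_node_bound i0 : let q := (zero_bound bmax Nmax i0 * r)%N in
  exists2 e : R, 0 < e & forall x : R, exists t : int,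
    `|x + t%:~R / D%:R| <= (nprod 0 q)%:R /\
    e <= normc (mprod 0 (q + i0) (x + t%:~R / D%:R)).
Proof.
move=> q.
have D0R : 0 < D%:R :> R by rewrite ltr0n.
have D1R : 1 <= D%:R :> R by rewrite ler1n.
have BK i b : b \in Bs i -> `|b%:~R| <= bmax%:R :> R.
  by move=> bB; rewrite -intr_norm -abszE -pmulrn ler_nat (Bmax bB).
pose f (j : 'I_(nprod 0 q).+1) (v : R) := normc (mprod 0 (q + i0) ((v + j%:R - 1) / D%:R)).
pose c : R := 4 * pi * bmax%:R.
have c0 : 0 <= c by rewrite !mulr_ge0 ?pi_ge0 ?ler0n.
have fl j x y : `|f j x - f j y| <= c * `|x - y|.
  apply: (le_trans (normc_dist _ _)).
  apply: (le_trans (mprod_lip Ns2 (ler0n _ bmax) BK _ _ _ _)).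
  rewrite nprod_nil divr1 -/c ler_wpM2l//.
  rewrite (_ : _ - _ = (x - y) / D%:R); last by ring.
  by rewrite normrM (@ger0_norm _ _^-1) ?invr_ge0 ?ler0n// ler_piMr// invf_le1.
have [|e e0 He] := lipschitz_cover_lower_bound fl (fun _ _ => normc_ge0 _).
  move=> x /andP[x0]; rewrite le_eqVlt => /predU1P[->|x1].
    have [//|K KP m0] := @tree_avoids_zeros R Ns Bs Ns2 Bu B0 Bge0 D D0 DB hL 0 _ r run bmax Nmax Bmax NsMax i0.
      by rewrite lexx ltr01.
    (* At u = 1, index K gives the same point as u = 0 with translate K. *)
    exists (widen_ord (leqnSn _) (Ordinal KP)).
    rewrite /f /= lt_neqAle normc_ge0 andbT eq_sym.
    apply: contra m0 => /eqP/Normc.eq0_normc; rewrite -/q.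
    by rewrite addrAC subrr => ->.
  have [|K KP m0] := @tree_avoids_zeros R Ns Bs Ns2 Bu B0 Bge0 D D0 DB hL x _ r run bmax Nmax Bmax NsMax i0.
    by rewrite x0.
  (* Index K + 1 stands for the translate K. *)
  exists (lift ord0 (Ordinal KP)).
  rewrite /f lift0 /= lt_neqAle normc_ge0 andbT eq_sym.
  apply: contra m0 => /eqP/Normc.eq0_normc; rewrite -/q.
  by rewrite -natr1 addrA addrK => ->.
exists e => // x.
set y := D%:R * x; pose v := y - (Num.floor y)%:~R.
have v0 : 0 <= v by rewrite subr_ge0 ge_floor.
have v1 : v <= 1 by rewrite lerBlDl ltW// -intrD1 lt_succ_floor.
have [|j hj] := He v; first by rewrite v0.
exists (j%:Z - 1 - Num.floor y).
have -> : x + (j%:Z - 1 - Num.floor y)%:~R / D%:R = (v + j%:R - 1) / D%:R.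
  by rewrite !intrB -pmulrn /v /y; field; rewrite gt_eqF.
split; last exact: hj.
rewrite normrM (@ger0_norm _ _^-1) ?invr_ge0 ?ler0n// ler_pdivrMr//.
apply: le_trans (_ : (nprod 0 q)%:R <= _); last by rewrite ler_peMr ?ler0n.
have P1 : 1 <= (nprod 0 q)%:R :> R by rewrite ler1n nprod_gt0.
have jP : j%:R <= (nprod 0 q)%:R :> R by rewrite ler_nat -ltnS.
by have := ler0n R j; rewrite ler_norml; lra.
Qed.

End uniform_lower_bound.

Lemma nprod_shift (Ns Ns' : nat -> nat) p k : (forall i, (i < k)%N -> Ns' i = Ns (p + i)%N) ->
  nprod Ns p (p + k) = nprod Ns' 0 k.
Proof.
move=> e; rewrite /nprod -[X in \prod_(X <= _ < _) _]add0n (addnC p) big_addn addnK.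
rewrite big_nat_cond [RHS]big_nat_cond; apply: eq_bigr => i /andP[/andP[_ ik] _].
by rewrite e// addnC.
Qed.

(** After rescaling, the block of factors starting at p only depends on the
    bases and digits of that block. *)
Lemma mprod_shift (R : realType) (Ns Ns' : nat -> nat) (Bs Bs' : nat -> seq int) p k (x : R) :
  (forall i, (2 <= Ns i)%N) ->
  (forall i, (i < k)%N -> Ns' i = Ns (p + i)%N /\ Bs' i = Bs (p + i)%N) ->
  mprod Ns Bs p (p + k) ((nprod Ns 0 p)%:R * x) = mprod Ns' Bs' 0 k x.
Proof.
move=> Ns2 e; rewrite /mprod -[X in \prod_(X <= _ < _) _]add0n (addnC p) big_addn addnK.
rewrite big_nat_cond [RHS]big_nat_cond; apply: eq_bigr => i /andP[/andP[_ ik] _].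
rewrite (e i ik).2 (addnC i p); congr maskf.
have P0 := nprodR_neq0 R Ns2 0 p; have P1 := nprodR_neq0 R Ns2 p (p + i.+1).
rewrite -(@nprod_shift Ns Ns' p i.+1); last first.
  by move=> j ji; rewrite (e j (leq_trans ji ik)).1.
by rewrite -addnS (@nprod_cat _ p 0 (p + i.+1)) ?leq_addr// natrM; field; rewrite P0 P1.
Qed.

Section recurrent_word.
Context (R : realType) (m : nat).
Context (N : 'I_m.+1 -> nat) (B : 'I_m.+1 -> {fset int}) (n : nat -> nat).
Hypothesis hNB : forall k, admissible_pair R (N k) (B k).
Hypothesis B0 : forall k, 0 \in B k.
Hypothesis Bge0 : forall k b, b \in B k -> 0 <= b.
Hypothesis n0 : forall k, (0 < n k)%N.
Variable nmax : nat.
Hypothesis n_le : forall k, (n k <= nmax)%N.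
Local Notation normc := (@Normc.normc R).

(** The periodic repetition of the list S: each window of length size S meets
    all letters of S. *)
Definition word_of (S : seq 'I_m.+1) : codespace R m := fun i => nth ord0 S (i %% size S).

Lemma word_of_mem S i : (0 < size S)%N -> word_of S i \in S.
Proof. by move=> S0; rewrite mem_nth// ltn_mod. Qed.

Lemma word_of_recurrent S s j : s \in S -> exists2 i, (j <= i < j + size S)%N & word_of S i = s.
Proof.
move=> sS; have S0 : (0 < size S)%N by case: S sS.
have kS : (index s S < size S)%N by rewrite index_mem.
exists (j + (index s S + (size S - j %% size S)) %% size S)%N.
  by rewrite leq_addr ltn_add2l ltn_mod.
rewrite /word_of modnDmr -modnDml (addnC (index s S)) addnA subnKC; last by rewrite ltnW// ltn_mod.
by rewrite modnDl modn_small// nth_index.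
Qed.

Lemma exists_nonzero_digit j : exists2 b, b \in B j & b != 0.
Proof.
have [_ B2 _] := hNB j.
apply: contrapT => /forall2NP h.
have : (B j `<=` [fset 0])%fset.
  apply/fsubsetP => b bB; rewrite in_fset1; have [//|/negP] := h b.
  by rewrite negbK.
move/fsubset_leq_card; rewrite cardfs1 => h1.
by have := leq_trans B2 h1.
Qed.

(** The word has length T = q + i0, where i0 makes the tail after T levels
    close to 1, and q lets the tree produce enough nodes. The exponents on the
    window take finitely many values, so a single lower bound serves for all
    windows that spell the word. *)
Theorem good_level_at_word (S : seq 'I_m.+1) : (0 < size S)%N ->
  exists (D T : nat) (eps : R),
  [/\ (0 < D)%N, forall s b, s \in S -> b \in B s -> (D %| b)%Z, 0 < eps &
   forall w : codespace R m, (forall i, w i \in S) ->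
     forall p, (forall i, (i < T)%N -> w (p + i)%N = word_of S i) ->
       @good_level R (code_base N n w) (code_digits B w) D p eps].
Proof.
move=> S0.
have [D [DB Dy]] := common_digit_divisor R (flatten [seq (B s : seq int) | s <- S]).
have DBs s b : s \in S -> b \in B s -> (D %| b)%Z.
  by move=> sS bB; apply: DB; apply/flattenP; exists (B s : seq int) => //; exact: (map_f (fun s => B s : seq int)).
have D0 : (0 < D)%N.
  have [b bB bn0] := exists_nonzero_digit (nth ord0 S 0).
  have := DBs _ _ (mem_nth ord0 S0) bB.
  by rewrite lt0n; apply: contraTneq => ->; rewrite dvd0z.
have [bmax Bm] := @digit_bound R m B.
have Bmax j b : b \in B j -> (`|b| <= bmax)%N.
  by move=> /Bm; rewrite -intr_norm -abszE -pmulrn ler_nat.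
pose Nmax := ((\max_j N j) ^ nmax.+1)%N.
have NsMax (e : nat -> nat) (w : codespace R m) i : (e i <= nmax.+1)%N -> (code_base N e w i <= Nmax)%N.
  move=> ei; rewrite /code_base /Nmax.
  have N1 : (0 < N (w i))%N by exact: leq_trans (admissible_N2 hNB (w i)).
  have NM : (N (w i) <= \max_j N j)%N by exact: leq_bigmax.
  apply: (@leq_trans ((\max_j N j) ^ e i)); last by rewrite leq_pexp2l// (leq_trans N1).
  by case: (e i) => [|k]; rewrite ?expn0// leq_exp2r.
pose c : R := 8 * pi * bmax%:R.
pose i0 := (Num.truncn c).+1.
pose q := (zero_bound bmax Nmax i0 * size S)%N.
pose T := (q + i0)%N.
pose W := word_of S.
(* Configurations record the predecessors of the exponents: every value is
   then legitimate, since exponents are only required to be positive. *)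
pose ex (v : {ffun 'I_T.+1 -> 'I_nmax.+1}) (i : nat) := (v (inord i)).+1.
have ex0 v i : (0 < ex v i)%N by [].
have base2 v := code_base_ge2 (admissible_N2 hNB) (ex0 v) W.
have BW i b : b \in code_digits B W i -> (D %| b)%Z.
  by move=> /DBs; apply; exact: word_of_mem.
have run j (y : R) : (forall i, (j <= i < j + size S)%N -> forall b, b \in code_digits B W i ->
    b%:~R * y \is a Num.int) -> D%:R * y \is a Num.int.
  move=> H; apply: Dy => b /flattenP[_ /mapP[s sS ->]] bs.
  have [i ij ws] := word_of_recurrent j sS.
  by apply: (H i ij); rewrite /code_digits /W ws.
have [eps eps0 Heps] : exists2 eps : R, 0 < eps & forall v, forall x : R, exists t : int,
    `|x + t%:~R / D%:R| <= (nprod (code_base N (ex v) W) 0 q)%:R /\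
    eps <= normc (mprod (code_base N (ex v) W) (code_digits B W) 0 T (x + t%:~R / D%:R)).
  apply: finite_min_bound => [v e e' ee' H x|v].
    by have [t [t1 t2]] := H x; exists t; split=> //; exact: le_trans t2.
  apply: (uniform_node_bound (base2 v) _ _ _ D0 BW (code_parseval hNB (ex0 v) W) run) => i.
  - exact: fset_uniq.
  - exact: B0.
  - by move=> b; exact: Bge0.
  - by move=> b; exact: Bmax.
  - by apply: NsMax; rewrite ltn_ord.
exists D, T, (eps / 2); split=> //; first by rewrite divr_gt0.
move=> w wS p pW x.
have n1 i : (0 < n i)%N by exact: n0.
have wbase2 := code_base_ge2 (admissible_N2 hNB) n0 w.
pose v : {ffun 'I_T.+1 -> 'I_nmax.+1} := [ffun i : 'I_T.+1 => inord (n (p + i)%N).-1].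
have sh i : (i < T)%N -> code_base N (ex v) W i = code_base N n w (p + i)%N /\
    code_digits B W i = code_digits B w (p + i)%N.
  move=> iT; rewrite /code_base /code_digits /W -(pW i iT); split=> //.
  have nK : (n (p + i)).-1.+1 = n (p + i)%N by rewrite prednK.
  suff -> : ex v i = n (p + i)%N by [].
  by rewrite /ex /v ffunE (@inordK T i) ?(leqW iT)// inordK ?nK// leqW.
have [t [t1 t2]] := Heps v x; exists t => b pb.
set z := x + _ in t1 t2 *.
have w0 i : 0 \in code_digits B w i by exact: B0.
have P0 := nprodR_gt0 R wbase2 0 p.
have big : eps <= normc (mprod (code_base N n w) (code_digits B w) p (p + T) ((nprod (code_base N n w) 0 p)%:R * z)).
  by rewrite (mprod_shift z wbase2 sh).
have [bT|Tb] := leqP b (p + T).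
  apply: (@le_trans _ _ eps); first by rewrite ler_pdivrMr// ler_peMr ?ltW// ltr1n.
  apply: (le_trans big).
  rewrite (@mprod_cat _ _ _ b p (p + T))// Normc.normcM ler_piMr ?normc_ge0//.
  exact: normc_mprod_le1.
rewrite (@mprod_cat _ _ _ (p + T) p b) ?leq_addr ?(ltnW Tb)// Normc.normcM.
apply: ler_pM => //; [exact: ltW|].
have BK i d : d \in code_digits B w i -> `|d%:~R| <= bmax%:R :> R by exact: Bm.
apply: le_trans (mprod_near0 wbase2 (ler0n R bmax) BK w0 _ _ _).
rewrite normrM (ger0_norm (ltW P0)).
rewrite (@nprod_cat _ p 0 (p + T)) ?leq_addr// /T addnA (@nprod_cat _ (p + q) p) ?leq_addr//.
have Pq : nprod (code_base N n w) p (p + q) = nprod (code_base N (ex v) W) 0 q.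
  by apply: nprod_shift => i iq; rewrite (sh i _).1// (leq_trans iq)// leq_addr.
have Pq0 := nprodR_gt0 R wbase2 p (p + q).
have Pi0 : c <= (nprod (code_base N n w) (p + q) (p + q + i0))%:R.
  rewrite (le_trans (ltW (truncnS_gt c)))// ler_nat.
  rewrite (leq_trans (ltnW (ltn_expl i0 (ltnSn 1))))//.
  by have := nprod_ge_exp wbase2 (p + q) (p + q + i0); rewrite addKn.
rewrite -Pq in t1; move: t1.
have Pi1 := nprodR_gt0 R wbase2 (p + q) (p + q + i0).
move: (nprod _ (p + q) _) Pi0 Pi1 => P3 Pi0 Pi1.
move: (nprod _ 0 p) P0 => P1 P0.
move: (nprod _ p (p + q)) Pq0 => P2 Pq0 t1.
rewrite !natrM.
have -> : 4 * pi * bmax%:R * (P1%:R * `|z|) / (P1%:R * (P2%:R * P3%:R)) = (c / P3%:R) * (`|z| / P2%:R) / 2.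
  by rewrite /c; field; rewrite ?gt_eqF.
have h1 : `|z| / P2%:R <= 1 by rewrite ler_pdivrMr// mul1r.
have h2 : c / P3%:R <= 1 by rewrite ler_pdivrMr// mul1r.
have h3 : c / P3%:R * (`|z| / P2%:R) <= 1.
  by apply: mulr_ile1 => //; rewrite divr_ge0 ?ler0n// !mulr_ge0 ?pi_ge0 ?ler0n.
by lra.
Qed.

End recurrent_word.

(** * Recurrence of words under Bernoulli measures *)

Lemma mkseqD (T : Type) (f : nat -> T) k l :
  mkseq f (k + l) = mkseq f k ++ mkseq (fun i => f (k + i)%N) l.
Proof. by rewrite /mkseq iotaD map_cat add0n -[k in iota k l]addn0 iotaDl -map_comp. Qed.

Section bernoulli_recurrence.
Context (R : realType) (m : nat).
Variables (P : probability (borel_codespace R m) R) (p : 'I_m.+1 -> R).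
Hypothesis p0 : forall j, 0 <= p j.
Hypothesis Pcyl : forall a : seq 'I_m.+1,
  P [set w | mkseq w (size a) = a] = (\prod_(j <- a) p j)%:E.
Local Notation Om := (borel_codespace R m).

Definition prefix_in l (Q : pred (seq 'I_m.+1)) : set Om := [set w | Q (mkseq w l)].

Definition word_at k (a : seq 'I_m.+1) : set Om :=
  [set w | mkseq (fun i => w (k + i)%N) (size a) = a].

Lemma measurable_prefix_in l Q : measurable (prefix_in l Q).
Proof.
apply: (@measurable_cylinder R m _ l) => w w' ww'; rewrite /prefix_in /=.
suff -> : mkseq w l = mkseq w' l by [].
by apply/eq_in_map => i; rewrite mem_iota => /andP[_ il]; exact: ww'.
Qed.

Lemma word_atE l Q a : prefix_in l Q `&` word_at l a =
  prefix_in (l + size a) (fun s => Q (take l s) && (drop l s == a)).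
Proof.
apply/seteqP; split=> w; rewrite /prefix_in /word_at /= mkseqD take_size_cat ?drop_size_cat ?size_mkseq//.
  by move=> [-> ->]; rewrite eqxx.
by move=> /andP[-> /eqP].
Qed.

Lemma measurable_word_at l a : measurable (word_at l a).
Proof.
rewrite -[word_at l a]setTI (_ : setT = prefix_in l xpredT); last by apply/seteqP.
by rewrite word_atE; exact: measurable_prefix_in.
Qed.

(** Splitting along the values of the first l letters. *)
Lemma prefix_decomposition l Q (G : set Om) : measurable G ->
  P (prefix_in l Q `&` G) =
  (\sum_(a \in [set a : l.-tuple 'I_m.+1 | Q a]) P (prefix_in l (pred1 (a : seq _)) `&` G))%E.
Proof.
move=> mG; rewrite -measure_fin_bigcup//=.
- congr (P _); apply/seteqP; split=> w /=.
    move=> [Qw Gw]; have sz : size (mkseq w l) == l by rewrite size_mkseq.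
    by exists (Tuple sz) => //=; split=> //; rewrite /prefix_in /=.
  by move=> [a /= Qa [/eqP wa Gw]]; split=> //; rewrite /prefix_in /= wa.
- apply/trivIsetP => a b _ _ ab; apply/seteqP; split=> w //= -[[/eqP wa _] [/eqP wb _]].
  by move/eqP: ab; apply; apply: val_inj; rewrite /= -wa.
- by move=> a _; apply: measurableI => //; exact: measurable_prefix_in.
Qed.

(** A word at position l is independent of the first l letters. *)
Lemma prefix_then_word l Q (a : seq 'I_m.+1) :
  (P (prefix_in l Q `&` word_at l a) = P (prefix_in l Q) * (\prod_(j <- a) p j)%:E)%E.
Proof.
rewrite prefix_decomposition//; last exact: measurable_word_at.
rewrite -[in RHS](setIT (prefix_in _ _)) prefix_decomposition//.
have cyl (b : seq 'I_m.+1) : P (prefix_in (size b) (pred1 b)) = (\prod_(j <- b) p j)%:E.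
  rewrite -Pcyl; congr (P _); apply/seteqP; split=> w /=; first by move/eqP.
  by move=> e; apply/eqP.
rewrite ge0_mule_fsuml//; apply: eq_fsbigr => b _.
have sb : size b = l by rewrite size_tuple.
have -> : P (prefix_in l (pred1 (b : seq _)) `&` setT) = (\prod_(j <- b) p j)%:E.
  by rewrite setIT -cyl sb.
rewrite -EFinM -big_cat -cyl /=.
congr (P _); apply/seteqP; split=> w; rewrite /prefix_in /word_at /= size_cat sb mkseqD.
  by move=> [/eqP -> ->].
by rewrite eqseq_cat ?size_mkseq// => /andP[-> /eqP].
Qed.

Lemma ae_positive_letters : {ae P, forall w : Om, forall k, 0 < p (w k)}.
Proof.
apply: ae_foralln => k.
have : P.-negligible (\big[setU/set0]_(j <- [seq j <- enum 'I_m.+1 | p j == 0]) word_at k [:: j]).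
  rewrite big_seq; elim/big_ind : _ => [|A A' nA nA'|j].
  - exact: negligible_set0.
  - exact: negligibleU.
  - rewrite mem_filter => /andP[/eqP pj _].
    apply/negligibleP; first exact: measurable_word_at.
    have -> : word_at k [:: j] = prefix_in k xpredT `&` word_at k [:: j].
      by rewrite (_ : prefix_in k _ = setT) ?setTI//; apply/seteqP.
    by apply: (etrans (prefix_then_word k xpredT [:: j])); rewrite big_seq1 pj mule0.
apply: negligibleS => w /= /negP; rewrite -leNgt => pw.
rewrite -bigcup_seq; exists (w k); last by rewrite /word_at /mkseq /= addn0.
by rewrite /= mem_filter mem_enum andbT eq_le pw p0.
Qed.

Section avoidance.
Variables (a : seq 'I_m.+1) (k0 : nat).
Hypothesis apos : forall j, j \in a -> 0 < p j.

Fixpoint avoids J : set Om :=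
  if J is J'.+1 then avoids J' `\` word_at (k0 + J' * size a) a else setT.

Lemma avoids_prefix J : exists Q, avoids J = prefix_in (k0 + J * size a) Q.
Proof.
elim: J => [|J [Q IH]]; first by exists xpredT; apply/seteqP.
set l := (k0 + J * size a)%N in IH.
exists (fun s => Q (take l s) && (drop l s != a)).
rewrite /= -/l IH (_ : k0 + J.+1 * size a = l + size a)%N; last by rewrite /l mulSn; lia.
apply/seteqP; split=> w;
  rewrite /prefix_in /word_at /= mkseqD take_size_cat ?drop_size_cat ?size_mkseq//.
  by move=> [-> /eqP ->].
by move=> /andP[-> /eqP].
Qed.

Lemma measurable_avoids J : measurable (avoids J).
Proof. by have [Q ->] := avoids_prefix J; exact: measurable_prefix_in. Qed.

Lemma avoids_measure J : P (avoids J) = ((1 - \prod_(j <- a) p j) ^+ J)%:E.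
Proof.
elim: J => [|J IH]; first by rewrite /= probability_setT.
have [Q e] := avoids_prefix J.
have mA := measurable_avoids J.
have mW := measurable_word_at (k0 + J * size a) a.
have PD : P (avoids J.+1) = (P (avoids J) - P (avoids J `&` word_at (k0 + J * size a) a))%E.
  by apply: measureD => //; rewrite -ge0_fin_numE// fin_num_measure.
by rewrite PD e prefix_then_word -e IH -EFinM -EFinB exprS; congr (_%:E); ring.
Qed.

(** The measure of J avoided windows is (1 - p(a))^J, which tends to 0. *)
Lemma avoids_negligible : P.-negligible (\bigcap_J avoids J).
Proof.
have m0 : measurable (\bigcap_J avoids J) by apply: bigcap_measurable => // J _; exact: measurable_avoids.
apply/negligibleP => //; apply/eqP; rewrite eq_le measure_ge0 andbT.
have := avoids_measure; set pa := \prod_(j <- a) p j => Pav.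
have pa0 : 0 < pa by rewrite /pa big_seq prodr_gt0.
have pa1 : pa <= 1.
  by have : (0 <= P (avoids 1))%E by []; rewrite Pav expr1 lee_fin subr_ge0.
have fin := fin_num_measure P _ m0.
rewrite -(fineK fin) lee_fin.
have lim0 : (1 - pa) ^+ J @[J --> \oo] --> (0 : R).
  by apply: cvg_expr; rewrite ger0_norm ?subr_ge0// ltrBlDr ltrDl.
rewrite -(cvg_lim (@Rhausdorff R) lim0); apply: limr_ge; first by apply/cvg_ex; exists 0.
near=> J; rewrite -lee_fin fineK// -Pav le_measure// ?inE//; first exact: measurable_avoids.
exact: bigcap_inf.
Unshelve. all: by end_near. Qed.

End avoidance.

Lemma ae_recurrent_word (a : seq 'I_m.+1) : (forall j, j \in a -> 0 < p j) ->
  {ae P, forall w : Om, forall k0, exists2 k, (k0 <= k)%N &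
     forall i, (i < size a)%N -> w (k + i)%N = nth ord0 a i}.
Proof.
move=> apos; apply: ae_foralln => k0.
apply: negligibleS (avoids_negligible k0 apos).
move=> w /= H J _; elim: J => [//|J IH] /=; split=> //.
rewrite /word_at /= => e; apply: H; exists (k0 + J * size a)%N; first exact: leq_addr.
by move=> i ia; rewrite -[in RHS]e nth_mkseq.
Qed.

End bernoulli_recurrence.

(** * The theorem *)

Lemma infinite_convP (R : realType) (m : nat) (N : 'I_m.+1 -> nat) (B : 'I_m.+1 -> {fset int})
    (n : nat -> nat) (w : codespace R m) :
  infinite_conv_exists N B n w -> weak_cvg (partial_conv N B n w) (infinite_conv N B n w).
Proof. by move=> [nu nulim]; apply: (getPex (P := fun nu => weak_cvg _ nu)); exists nu. Qed.

Theorem corollary1p7 (R : realType) (m : nat)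
    (N : 'I_m.+1 -> nat) (B : 'I_m.+1 -> {fset int})
    (hNB : forall k, admissible_pair R (N k) (B k))
    (hB0 : forall k, 0 \in B k)
    (hBge0 : forall k b, b \in B k -> 0 <= b)
    (n : nat -> nat) (hn : forall k, (0 < n k)%N) :
  [/\ (forall w : codespace R m, infinite_conv_exists N B n w) /\
      random_measure (fun w : borel_codespace R m => infinite_conv N B n w),
      forall P : probability (borel_codespace R m) R, bernoulli_measure P ->
        {ae P, forall w, spectral_measure (infinite_conv N B n w)} &
      (forall b, exists k, (b < n k)%N) ->
        spectral_random_measure
          (fun w : borel_codespace R m => infinite_conv N B n w)].
Proof.
have N2 := admissible_N2 hNB.
have [K BK] := digit_bound R B.
have ex w : infinite_conv_exists N B n w := infinite_conv_exists_of_nonneg N2 hn hB0 hBge0 BK w.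
have lim (w : codespace R m) := infinite_convP (ex w).
have rand : random_measure (fun w : borel_codespace R m => infinite_conv N B n w).
  exact: (random_measure_weak_limits N2 hn lim).
have unb_spectral : (forall b, exists k, (b < n k)%N) ->
    forall w : codespace R m, spectral_measure (infinite_conv N B n w).
  move=> unb w.
  apply: (spectral_of_good_levels hNB hB0 hBge0 hn (lim w) (D := 1) (eps := 1 / 2)) => //.
  exact: good_levels_of_unbounded.
split=> //; last by move=> unb; split=> //; exact: unb_spectral.
move=> P [p [p0 p1 Pcyl]].
(* Unbounded exponents give spectral measures for all codes; for bounded ones,
   the exponents on a window take finitely many values. *)
have [unb|/existsNP[nmax bnd]] := pselect (forall b, exists k, (b < n k)%N).
  by apply: aeW => w; exact: unb_spectral.
have n_le k : (n k <= nmax)%N by rewrite leqNgt; apply/negP => h; apply: bnd; exists k.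
pose S := [seq j <- enum 'I_m.+1 | 0 < p j].
have memS j : (j \in S) = (0 < p j) by rewrite mem_filter mem_enum andbT.
have S0 : (0 < size S)%N.
  rewrite size_filter -has_count; apply: contrapT => /negP/hasPn h.
  move/eqP: p1; rewrite big1 ?(eq_sym 0) ?oner_eq0// => j _.
  by apply/eqP; rewrite eq_le p0 andbT leNgt h// mem_enum.
have [D [T [eps [D0 DB eps0 good]]]] := good_level_at_word hNB hB0 hBge0 hn n_le S0.
have wpos j : j \in mkseq (word_of R S) T -> 0 < p j.
  by move=> /mapP[i _ ->]; rewrite -memS; exact: word_of_mem.
have negl := negligibleU (ae_positive_letters p0 Pcyl) (ae_recurrent_word Pcyl wpos).
apply: (@negligibleS _ _ _ _ _ _ _ negl).
move=> w; apply: contra_notP => /not_orP[/contrapT pos /contrapT rec].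
have wS i : w i \in S by rewrite memS.
apply: (spectral_of_good_levels hNB hB0 hBge0 hn (lim w) D0 _ eps0).
  by move=> i b; exact: DB.
move=> k0; have [k kk0 hk] := rec k0; exists k; split=> //.
apply: good => // i iT; rewrite size_mkseq in hk.
by rewrite hk// nth_mkseq.
Qed.
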